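(* Let $\Omega\subset\mathbb{R}^N$ be an open and bounded set, let $1<p<\infty$ and $0<s<1$ be such that $s\,p\le N$. If $u\in \widetilde W^{s,p}_0(\Omega)$ achieves the minimum defining $\lambda^s_{1,p}(\Omega)$, then $u\in L^\infty(\mathbb{R}^N)$. Moreover, if $s\,p<N$, then $$\|u\|_{L^\infty(\Omega)}\le \widetilde C_{N,p,s}\, \left[\lambda_{1,p}^{s}(\Omega)\right]^{\frac{N}{s\, p^2}}\,\|u\|_{L^p(\Omega)},$$ where $\widetilde C_{N,p,s}>0$ is a constant depending only on $N,p$ and $s$, namely $$\widetilde C_{N,p,s}=\left(\sup_{v\in W^{s,p}_0(\mathbb{R}^N)\setminus\{0\}} \frac{\left(\int_{\mathbb{R}^N} |v|^\frac{N\,p}{N-s\,p}\, dx\right)^\frac{N-s\,p}{N}}{[v]^p_{W^{s,p}(\mathbb{R}^N)}}\right)^\frac{N}{s\,p^2}\, \left(\frac{N}{N-s\,p}\right)^{\frac{N(N-s\, p)}{s^2\,p^2}\,\frac{p-1}{p}}.$$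
   Context: For $1\le p<\infty$ and $s\in(0,1)$, the Gagliardo seminorm of a measurable function $u$ is $[u]_{W^{s,p}(\mathbb{R}^N)}=\left(\int_{\mathbb{R}^N}\int_{\mathbb{R}^N} \frac{|u(x)-u(y)|^p}{|x-y|^{N+s\,p}} \, dx\,dy\right)^{1/p}$. $\widetilde W^{s,p}_0(\Omega)$ is the closure of $C^\infty_0(\Omega)$ with respect to the norm $u\mapsto [u]_{W^{s,p}(\mathbb{R}^N)}+\|u\|_{L^p(\Omega)}$; functions are extended by $0$ outside $\Omega$. $W^{s,p}_0(\mathbb{R}^N)$ is the closure of $C^\infty_0(\mathbb{R}^N)$ with respect to $[\,\cdot\,]_{W^{s,p}(\mathbb{R}^N)}$. For $1<p<\infty$, $$\lambda^s_{1,p}(\Omega)=\min_{u\in\widetilde W^{s,p}_0(\Omega)} \left\{[u]^p_{W^{s,p}(\mathbb{R}^N)}\, :\,\|u\|_{L^p(\Omega)}=1,\ u\ge 0\right\}.$$ *)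

(* Defs.v *)
From HB Require Import structures.
From mathcomp Require Import all_boot all_order all_algebra.
From mathcomp Require Import all_classical all_reals all_analysis.

Set Implicit Arguments.
Unset Strict Implicit.
Unset Printing Implicit Defensive.

Import Order.TTheory GRing.Theory Num.Theory.
Import numFieldNormedType.Exports.

Local Open Scope classical_set_scope.
Local Open Scope ring_scope.

Fact row_measure_display : measure_display.
Proof. exact: default_measure_display. Qed.

(* R^n is 'rV[R]_n, with the product (that is, Borel) sigma-algebra, generated
   by the coordinates exactly as the library does for n.-tuple R. *)
Section row_measurable.
Context (R : realType) (n : nat).

Definition row_coord (i : 'I_n) (x : 'rV[R]_n) : measurableTypeR R := x 0 i.

Let row_set0 : g_sigma_preimage row_coord set0.
Proof. exact: sigma_algebra0. Qed.

Let row_setC A : g_sigma_preimage row_coord A ->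
  g_sigma_preimage row_coord (~` A).
Proof. exact: sigma_algebraC. Qed.

Let row_bigcup (F : (set 'rV[R]_n)^nat) :
  (forall i, g_sigma_preimage row_coord (F i)) ->
  g_sigma_preimage row_coord (\bigcup_i (F i)).
Proof. exact: sigma_algebra_bigcup. Qed.

HB.instance Definition _ := @isMeasurable.Build row_measure_display 'rV[R]_n
  (g_sigma_preimage row_coord) row_set0 row_setC row_bigcup.

Lemma measurable_row_coord (i : 'I_n) : measurable_fun setT (row_coord i).
Proof.
move=> _ Y mY; rewrite setTI; apply: sub_sigma_algebra => /=.
rewrite -bigcup_seq/=; exists i => /=; first by rewrite mem_index_enum.
by exists Y => //; rewrite setTI.
Qed.

Lemma measurable_fun_rowP d (T : measurableType d) (f : T -> 'rV[R]_n) :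
  (forall i, measurable_fun setT (row_coord i \o f)) -> measurable_fun setT f.
Proof.
move=> mf _ A mA; rewrite setTI.
suff : g_sigma_preimage (fun i => row_coord i \o f) `<=` measurable.
  apply; rewrite g_sigma_preimage_comp; exists A => //.
  by rewrite setTI.
apply: smallest_sub; first exact: sigma_algebra_measurable.
rewrite -bigcup_seq; apply: bigcup_sub => i _.
by move=> B [C mC <-]; exact: mf.
Qed.

End row_measurable.

Lemma sigma_finite_product d1 d2 (T1 : measurableType d1)
    (T2 : measurableType d2) (R : realType)
    (m1 : {sigma_finite_measure set T1 -> \bar R})
    (m2 : {sigma_finite_measure set T2 -> \bar R}) :
  sigma_finite setT (m1 \x m2)%E.
Proof.
have /sigma_finiteP[F [TF ndF Foo]] := sigma_finiteT m1.
have /sigma_finiteP[G [TG ndG Goo]] := sigma_finiteT m2.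
exists (fun n => F n `*` G n).
  rewrite -setXTT TF TG predeqE => -[x y]; split.
    move=> [/= [n _ Fnx] [k _ Gky]]; exists (maxn n k) => //; split.
    - by move: x Fnx; exact/subsetPset/ndF/leq_maxl.
    - by move: y Gky; exact/subsetPset/ndG/leq_maxr.
  by move=> [n _ []/= ? ?]; split; exists n.
move=> k; have [? ?] := Foo k; have [? ?] := Goo k.
split; first exact: measurableX.
by rewrite product_measure1E// lte_mul_pinfty// ge0_fin_numE.
Qed.

Section lebesgue_row.
Context (R : realType).

Definition row_cons n (z : measurableTypeR R * 'rV[R]_n) : 'rV[R]_n.+1 :=
  \row_i if unlift ord0 i is Some j then z.2 0 j else z.1.

Let row_uncons n (x : 'rV[R]_n.+1) : measurableTypeR R * 'rV[R]_n :=
  (x 0 ord0, \row_j x 0 (lift ord0 j)).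

Let row_consK n : cancel (@row_cons n) (@row_uncons n).
Proof.
move=> [a y]; rewrite /row_uncons /row_cons mxE unlift_none /=; congr pair.
by apply/rowP => j; rewrite !mxE liftK.
Qed.

Lemma measurable_row_cons n : measurable_fun setT (@row_cons n).
Proof.
apply: measurable_fun_rowP => i; rewrite /row_coord /comp /row_cons.
case: (unliftP ord0 i) => [j|] ->.
- rewrite [X in measurable_fun _ X](_ : _ = @row_coord R n j \o snd).
    exact: measurableT_comp (measurable_row_coord j) measurable_snd.
  by apply/funext => z /=; rewrite mxE liftK.
- rewrite [X in measurable_fun _ X](_ : _ = fst); first exact: measurable_fst.
  by apply/funext => z /=; rewrite mxE unlift_none.
Qed.

Let measurable_row_uncons n : measurable_fun setT (@row_uncons n).
Proof.
apply: measurable_fun_pair; first exact: measurable_row_coord.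
apply: measurable_fun_rowP => i.
rewrite [X in measurable_fun _ X](_ : _ = @row_coord R n.+1 (lift ord0 i)).
  exact: measurable_row_coord.
by apply/funext => x; rewrite /row_coord /comp mxE.
Qed.

Section lebesgue_row_step.
Context (n : nat) (mu : {sigma_finite_measure set 'rV[R]_n -> \bar R}).

Definition lebesgue_row_step : set 'rV[R]_n.+1 -> \bar R :=
  pushforward (@lebesgue_measure R \x mu)%E (@row_cons n).


Let step0 : lebesgue_row_step set0 = 0%E.
Proof. by rewrite /lebesgue_row_step /pushforward preimage_set0 measure0. Qed.

Let step_ge0 A : (0 <= lebesgue_row_step A)%E.
Proof. by rewrite /lebesgue_row_step /pushforward; exact: measure_ge0. Qed.

Let step_sigma_additive : semi_sigma_additive lebesgue_row_step.
Proof.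
move=> F mF tF mUF; rewrite /lebesgue_row_step /pushforward preimage_bigcup.
have mcons A : measurable A -> measurable (@row_cons n @^-1` A).
  by move=> mA; rewrite -[X in measurable X]setTI; exact: measurable_row_cons.
apply: measure_semi_sigma_additive; first by move=> k; exact: mcons.
- apply/trivIsetP => i j _ _ ij; rewrite -preimage_setI.
  by move/trivIsetP : tF => /(_ _ _ _ _ ij) ->//; rewrite preimage_set0.
- by rewrite -preimage_bigcup; exact: mcons.
Qed.

HB.instance Definition _ := isMeasure.Build _ _ _ lebesgue_row_step
  step0 step_ge0 step_sigma_additive.

Let step_sigma_finite : sigma_finite setT lebesgue_row_step.
Proof.
have [F TF Foo] : sigma_finite setT (@lebesgue_measure R \x mu)%E.
  exact: sigma_finite_product.
exists (fun k => @row_uncons n @^-1` F k).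
  by rewrite -preimage_bigcup -TF preimage_setT.
move=> k; have [mF Fk] := Foo k; split.
  by rewrite -[X in measurable X]setTI; exact: measurable_row_uncons.
rewrite /lebesgue_row_step /pushforward [X in (_ X < _)%E](_ : _ = F k) //.
by apply/seteqP; split => z /=; rewrite row_consK.
Qed.

HB.instance Definition _ := @isSFinite.Build _ _ _ lebesgue_row_step
  (sfinite_measure_sigma_finite step_sigma_finite).

HB.instance Definition _ := @isSigmaFinite.Build _ _ _ lebesgue_row_step
  step_sigma_finite.

End lebesgue_row_step.

(* Lebesgue measure on R^n, as the n-fold product of lebesgue_measure. *)
Fixpoint lebesgue_row n : {sigma_finite_measure set 'rV[R]_n -> \bar R} :=
  if n is k.+1 then lebesgue_row_step (lebesgue_row k)
  else @dirac _ 'rV[R]_0 0 R.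

End lebesgue_row.

Section fractional_sobolev.
Context (R : realType) (N : nat).
Implicit Types (u v phi : 'rV[R]_N -> R) (Omega : set 'rV[R]_N) (s p : R).

Local Notation mu := (@lebesgue_row R N).

(* The norm `|x| of 'rV[R]_N is the sup norm, hence this definition. *)
Definition eucl (x : 'rV[R]_N) : R := Num.sqrt (\sum_i x 0 i ^+ 2).

(* On the (negligible) diagonal x = y the integrand is 0 / 0 = 0. *)
Definition gagliardo s p u : \bar R :=
  ((\int[mu]_x \int[mu]_y
     (`|u x - u y| `^ p / eucl (x - y) `^ (N%:R + s * p))%:E) `^ p^-1)%E.

Fixpoint Ck k (f : 'rV[R]_N -> R) : Prop :=
  continuous f /\
  if k is k'.+1 then
    forall i, (forall x, derivable f x (delta_mx 0 i)) /\
              Ck k' (fun x => 'D_(delta_mx 0 i) f x)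
  else True.

Definition smooth f := forall k, Ck k f.

Definition test_function Omega phi : Prop :=
  [/\ smooth phi, compact (closure [set x | phi x != 0])
    & closure [set x | phi x != 0] `<=` Omega].

Definition Lp_norm (r : \bar R) Omega u : \bar R :=
  'N[mu]_r[(EFin \o u) \_ Omega]%E.

(* Elements of the function spaces are represented by measurable functions on
   the whole of R^N; all notions below are invariant under a.e. equality. *)

(* Closure of the test functions on Omega for [u]_{W^{s,p}} + |u|_{L^p(Omega)},
   among the functions vanishing outside Omega. *)
Definition W0tilde s p Omega : set ('rV[R]_N -> R) :=
  [set u : 'rV[R]_N -> R | [/\ measurable_fun setT u,
      {ae mu, forall x, ~ Omega x -> u x = 0}
    & forall e : R, 0 < e -> exists2 phi, test_function Omega phi
        & (gagliardo s p (phi \- u)%R + Lp_norm p%:E Omega (phi \- u)%R < e%:E)%E]].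

(* The seminorm alone does not see constants, so its closure is realised as a
   space of functions by requiring in addition that the approximating test
   functions converge a.e.: when s p < N this is the usual identification of
   the completion of the test functions with a function space. *)
Definition W0 s p : set ('rV[R]_N -> R) :=
  [set v : 'rV[R]_N -> R | measurable_fun setT v /\ exists phi : nat -> 'rV[R]_N -> R,
    [/\ forall k, test_function setT (phi k),
        gagliardo s p (phi k \- v) @[k --> \oo] --> 0%E
      & {ae mu, forall x, phi k x @[k --> \oo] --> v x}]].

Definition lambda_admissible s p Omega : set ('rV[R]_N -> R) :=
  [set u : 'rV[R]_N -> R | [/\ W0tilde s p Omega u, Lp_norm p%:E Omega u = 1%E
    & {ae mu, forall x, 0 <= u x}]].

Definition lambda1 s p Omega : \bar R :=
  ereal_inf [set (gagliardo s p u `^ p)%E | u in lambda_admissible s p Omega].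

Definition lambda1_minimizer s p Omega u : Prop :=
  lambda_admissible s p Omega u /\ (gagliardo s p u `^ p)%E = lambda1 s p Omega.

Definition sobolev_quotient s p v : \bar R :=
  ((\int[mu]_x (`|v x| `^ (N%:R * p / (N%:R - s * p)))%:E)
     `^ ((N%:R - s * p) / N%:R) / gagliardo s p v `^ p)%E.

Definition sobolev_sup s p : \bar R :=
  ereal_sup [set sobolev_quotient s p v | v in
    [set v : 'rV[R]_N -> R | W0 s p v /\ ~ {ae mu, forall x, v x = 0}]].

Definition Ctilde s p : \bar R :=
  (sobolev_sup s p `^ (N%:R / (s * p ^+ 2)) *
   ((N%:R / (N%:R - s * p))
      `^ (N%:R * (N%:R - s * p) / (s ^+ 2 * p ^+ 2) * ((p - 1) / p)))%:E)%E.

End fractional_sobolev.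

Arguments sobolev_sup {R} N s p.
Arguments Ctilde {R} N s p.

(* Main.v *)
Require Import Defs.
From mathcomp Require Import all_boot all_order all_algebra.
From mathcomp Require Import all_classical all_reals all_analysis.
From mathcomp Require Import measurable_realfun ess_sup_inf.
From mathcomp Require Import ring lra.

Set Implicit Arguments.
Unset Strict Implicit.
Unset Printing Implicit Defensive.

Import Order.TTheory GRing.Theory Num.Theory.
Import numFieldNormedType.Exports.

Local Open Scope classical_set_scope.
Local Open Scope ring_scope.

(** The minimizers are bounded by Moser's iteration.

    Write [E f] for the [p]-th power of the Gagliardo seminorm ([energy]), and
    let [u] be a minimizer with [|u|_p = 1] and [E u = la].  The iteration rests
    on two inequalities.

    The first one is the Sobolev inequality [|f|_q^p <= C (E f)] with
    [q = p chi], [chi = N / (N - sp)] ([sobolev]).  At a point where [|f| = a],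
    the set [{|f| >= a / 2}] has measure at most [m = (2 |f|_q / a)^q], hence
    occupies at most half of a cube of volume [2 m] around that point.  The rest
    of the cube contributes a multiple of [a^p m^(-sp/N)] to the inner integral
    of [E f]; integrating this lower bound gives the inequality whenever
    [|f|_q] is finite.  When [f] lives on a set of finite measure, [sp/N] may be
    replaced by a smaller exponent, which settles the case [sp = N] with
    [chi = 2].

    The second one is a Caccioppoli inequality ([caccioppoli]): for [th >= 1],
    [E ((clip M u)^th) <= la th^(p-1) |u^+|_(p th)^(p th)],
    where [clip M] is the truncation to values between [0] and [M].
    The function [u - t (clip M u)^b] with [b = p th - p + 1] and small [t > 0]
    is a nonnegative competitor.  Its energy is below that of [u] by a multiple
    of [t |u x - u y|^(p-1) |(clip M u x)^b - (clip M u y)^b|], integrated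
    against the kernel, and Jensen's inequality bounds this from below by the
    energy of [(clip M u)^th] ([power_convexity]).  Comparing with the loss in
    the [L^p] norm and letting [t] tend to [0] gives the claim.

    Both together, as [M] tends to infinity, yield
    [|u^+|_(p th chi) <= (C la th^(p-1))^(1/(p th)) |u^+|_(p th)].
    The product of these factors over [th = chi^k] is [moser_bound], and
    Chebyshev's inequality turns the bound on the norms into a bound on [u]
    ([moser]). With the best Sobolev constant the product is exactly the
    announced constant.

    It remains to stay within the given function spaces.  Test functions have
    finite energy ([energy_test_function_lty]), so that [la] is finite.  The
    competitors and the truncated powers belong to the closure of the test
    functions because they are superpositions of [u] with limits of smooth
    functions of bounded Lipschitz constant ([comp_approximates]).  Finally the
    Sobolev inequality extends by Fatou's lemma to the space over which the best
    constant is defined ([sobolev_W0]), so that this constant is finite. *)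

(** * Measure theory on R^N *)

Section rows.
Context (R : realType).

Definition cube N (x : 'rV[R]_N) (r : R) : set 'rV[R]_N :=
  [set y | forall i, `|x 0 i - y 0 i| < r].

Lemma measurable_cube N (x : 'rV[R]_N) r : measurable (cube x r).
Proof.
have -> : cube x r = \bigcap_(i in [set` index_enum 'I_N])
    (@row_coord R N i @^-1` ball (x 0 i) r).
  by apply/seteqP; split=> [y xy i _|y xy i];
    [exact: xy|exact/xy/mem_index_enum].
apply: fin_bigcap_measurable => [|i _]; first exact: finite_seq.
rewrite -[X in measurable X]setTI; apply: measurable_row_coord => //.
exact: measurable_ball.
Qed.

Lemma cube_ball N (x : 'rV[R]_N) (r : R) : 0 < r -> cube x r = ball x r.
Proof.
move=> r0; apply/seteqP; split=> [y xy|y [_ xy] i]; last exact: xy.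
by split=> // i j; rewrite ord1; exact: xy.
Qed.

Lemma bounded_sub_cube N (A : set 'rV[R]_N) :
  bounded_set A -> exists2 r : R, 0 < r & A `<=` cube 0 r.
Proof.
move=> [r [_ Ar]]; have r0 : 0 < `|r| + 2 by rewrite ltr_wpDl.
exists (`|r| + 2) => // x Ax; rewrite cube_ball// -ball_normE /= sub0r normrN.
have /Ar : r < `|r| + 1 by rewrite (le_lt_trans (ler_norm _))// ltrDl.
by move=> /(_ _ Ax) /le_lt_trans; apply; rewrite ltrD2l ltr1n.
Qed.

Lemma closure_support_out N (f : 'rV[R]_N -> R) x :
  ~ closure [set x | f x != 0] x -> f x = 0.
Proof.
move=> nx; apply/eqP; apply: contra_notT nx => fx; exact: subset_closure.
Qed.

(** Every open set is a countable union of cubes with rational centres and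
    radii [1 / (n + 1)], so that the product sigma-algebra is the Borel one. *)
Lemma open_measurable_row N (U : set 'rV[R]_N) : open U -> measurable U.
Proof.
move=> oU.
pose c (k : 'rV[rat]_N * nat) := cube (map_mx ratr k.1 : 'rV[R]_N) k.2.+1%:R^-1.
have -> : U = \bigcup_(k in [set k | c k `<=` U]) c k.
  apply/seteqP; split=> [x Ux|x [k kU /kU]//].
  have /nbhs_ballP[e /= e0 xeU] : nbhs x U by exact: open_nbhs_nbhs.
  have [n en] : exists n : nat, n.+1%:R^-1 < e / 2.
    have e20 : 0 < e / 2 by rewrite divr_gt0.
    exists (Num.trunc (e / 2)^-1); rewrite invf_plt ?posrE//.
    exact: truncnS_gt.
  have n0 : 0 < n.+1%:R^-1 :> R by rewrite invr_gt0.
  have rq i : exists q : rat, x 0 i - n.+1%:R^-1 < ratr q < x 0 i + n.+1%:R^-1.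
    have /rat_in_itvoo[q] : x 0 i - n.+1%:R^-1 < x 0 i + n.+1%:R^-1.
      by rewrite ltrD2l gtrN.
    by rewrite in_itv => ?; exists q.
  have [q qP] := choice rq.
  exists (\row_i q i, n) => /=; last first.
    by move=> i; rewrite /= !mxE ltr_distl; exact: qP.
  move=> y yc; apply: xeU; split=> // i j; rewrite !ord1.
  have := yc j; have := qP j; rewrite /= !mxE /ball/= !ltr_distl.
  by move: (x 0 j) (y 0 j) (ratr _) (n.+1%:R^-1) en => a b r h; lra.
have -> : \bigcup_(k in [set k | c k `<=` U]) c k = \bigcup_n
    (if unpickle n is Some k then if `[< c k `<=` U >] then c k else set0
     else set0).
  apply/seteqP; split=> [x [k /asboolT kU kx]|x [n _]].
    by exists (pickle k) => //; rewrite pickleK kU.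
  by case: unpickle => // k; case: asboolP => // kU kx; exists k.
apply: bigcupT_measurable => n; case: unpickle => // k.
by case: asboolP => // _; exact: measurable_cube.
Qed.

Lemma continuous_measurable_row N (f : 'rV[R]_N -> R) :
  continuous f -> measurable_fun setT f.
Proof.
move=> /continuousP cf.
apply: (measurability _ (RGenOpens.measurableE R)) => _ [_ [a [b ->] <-]].
rewrite setTI; apply: open_measurable_row; apply: cf; exact: interval_open.
Qed.

Lemma lebesgue_cube N (x : 'rV[R]_N) (r : R) :
  0 < r -> lebesgue_row R N (cube x r) = ((2 * r) ^+ N)%:E.
Proof.
move=> r0; elim: N x => [|N IH] x.
  by rewrite expr0 /= diracE mem_set// => -[].
rewrite /= /lebesgue_row_step /pushforward.
have -> : @row_cons R N @^-1` cube x r =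
    ball (x 0 ord0) r `*` cube (\row_j x 0 (lift ord0 j)) r.
  apply/seteqP; split=> -[a y] /=.
    move=> xr; split=> [|j]; first by have := xr ord0; rewrite mxE unlift_none.
    by have := xr (lift ord0 j); rewrite !mxE liftK.
  move=> [xa xy] i; rewrite mxE; case: (unliftP ord0 i) => [j|] ->//.
  by have := xy j; rewrite mxE.
rewrite product_measure1E//=; [|exact: measurable_ball|exact: measurable_cube].
by rewrite IH lebesgue_measure_ball ?ltW// -EFinM exprS mulr_natl.
Qed.

Lemma lebesgue_row_setT_gt0 N : (0 < lebesgue_row R N setT)%E.
Proof.
apply: (@lt_le_trans _ _ (lebesgue_row R N (cube 0 1))).
  by rewrite lebesgue_cube// lte_fin exprn_gt0.
by apply: le_measure; rewrite ?inE//; exact: measurable_cube.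
Qed.

Lemma eucl_ge0 N (x : 'rV[R]_N) : 0 <= eucl x.
Proof. exact: sqrtr_ge0. Qed.

Lemma coord_le_eucl N (x : 'rV[R]_N) i : `|x 0 i| <= eucl x.
Proof.
rewrite -(sqrtr_sqr (x 0 i)) ler_wsqrtr// (bigD1 i)//= lerDl.
by apply: sumr_ge0 => j _; exact: sqr_ge0.
Qed.

Lemma eucl_gt0 N (x : 'rV[R]_N) : x != 0 -> 0 < eucl x.
Proof.
move=> x0; rewrite lt_neqAle eucl_ge0 andbT eq_sym; apply: contraNneq x0 => e0.
apply/eqP/rowP => i; rewrite mxE; apply/eqP; rewrite -normr_eq0 eq_le normr_ge0.
by rewrite -e0 coord_le_eucl.
Qed.

Lemma euclN N (x : 'rV[R]_N) : eucl (- x) = eucl x.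
Proof. by congr Num.sqrt; apply: eq_bigr => i _; rewrite mxE sqrrN. Qed.

Lemma eucl_le_sup N (x : 'rV[R]_N) (r : R) :
  (forall i, `|x 0 i| <= r) -> 0 <= r -> eucl x <= N%:R * r.
Proof.
move=> xr r0; rewrite -(@ler_pXn2r _ 2)// ?nnegrE ?eucl_ge0//; last first.
  by rewrite mulr_ge0.
rewrite sqr_sqrtr; last by apply: sumr_ge0 => j _; exact: sqr_ge0.
apply: (@le_trans _ _ (\sum_(i < N) r ^+ 2)).
  by apply: ler_sum => i _; rewrite -real_normK ?num_real// lerXn2r ?nnegrE.
rewrite sumr_const card_ord exprMn -[leLHS]mulr_natl ler_wpM2r ?sqr_ge0//.
by rewrite -natrX ler_nat; case: (N) => // k; rewrite leq_pmulr.
Qed.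

Lemma measurable_rowB N : measurable_fun setT
  (fun z : 'rV[R]_N * 'rV[R]_N => z.1 - z.2 : 'rV[R]_N).
Proof.
apply: measurable_fun_rowP => i.
rewrite [X in measurable_fun _ X](_ : _ =
  ((@row_coord R N i \o fst) \- (@row_coord R N i \o snd)) :> (_ -> R)).
  apply: measurable_funB; apply: measurableT_comp => //;
    exact: measurable_row_coord.
by apply/funext => z; rewrite /= /row_coord !mxE.
Qed.

Lemma measurable_eucl N : measurable_fun setT (@eucl R N).
Proof.
apply: (@measurableT_comp _ _ _ _ _ _ (Num.sqrt : R -> R)
  _ (fun x : 'rV[R]_N => \sum_i x 0 i ^+ 2)).
  by apply: continuous_measurable_fun; exact: sqrt_continuous.
apply: measurable_sum => i; apply: measurable_funX; exact: measurable_row_coord.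
Qed.

End rows.

Lemma ae_product_fst d1 d2 (T1 : measurableType d1) (T2 : measurableType d2)
    (R : realType) (m1 : {sigma_finite_measure set T1 -> \bar R})
    (m2 : {sigma_finite_measure set T2 -> \bar R}) (P : T1 -> Prop) :
  {ae m1, forall x, P x} -> {ae (m1 \x m2)%E, forall z, P z.1}.
Proof.
move=> [A [mA A0 AP]]; exists (A `*` setT); split.
- exact: measurableX.
- rewrite product_measure1E//; transitivity (0 * m2 setT)%E; last
    by rewrite mul0e.
  by congr (_ * _)%E.
- by move=> z /= Pz; split=> //; exact: AP.
Qed.

Lemma ae_product_snd d1 d2 (T1 : measurableType d1) (T2 : measurableType d2)
    (R : realType) (m1 : {sigma_finite_measure set T1 -> \bar R})
    (m2 : {sigma_finite_measure set T2 -> \bar R}) (P : T2 -> Prop) :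
  {ae m2, forall x, P x} -> {ae (m1 \x m2)%E, forall z, P z.2}.
Proof.
move=> [A [mA A0 AP]]; exists (setT `*` A); split.
- exact: measurableX.
- rewrite product_measure1E//; transitivity (m1 setT * 0)%E; last
    by rewrite mule0.
  by congr (_ * _)%E.
- by move=> z /= Pz; split=> //; exact: AP.
Qed.

(** * The Gagliardo energy *)

Lemma measurable_fun_powR d (T : measurableType d) (R : realType) (g : T -> R)
    r :
  measurable_fun setT g -> measurable_fun setT (fun x => g x `^ r).
Proof. by move=> mg; exact: (measurableT_comp (measurable_powR r) mg). Qed.

Lemma measurable_fun_norm d (T : measurableType d) (R : realType) (g : T -> R) :
  measurable_fun setT g -> measurable_fun setT (fun x => `|g x|).
Proof. by move=> mg; exact: (measurableT_comp (@normr_measurable R setT) mg).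
Qed.

Lemma measurable_powR_norm d (T : measurableType d) (R : realType) (g : T -> R)
  r : measurable_fun setT g -> measurable_fun setT (fun x => `|g x| `^ r).
Proof.
by move=> mg; apply: measurable_fun_powR; exact: measurable_fun_norm.
Qed.

Section energy.
Context (R : realType) (N : nat).
Local Notation mu := (@lebesgue_row R N).
Implicit Types (s p : R) (f u v : 'rV[R]_N -> R).

Definition kern (a : R) (z : 'rV[R]_N * 'rV[R]_N) : R :=
  (eucl (z.1 - z.2) `^ a)^-1.

Definition energy s p f : \bar R := (\int[mu]_x \int[mu]_y
  (`|f x - f y| `^ p / eucl (x - y) `^ (N%:R + s * p))%:E)%E.

Lemma kern_ge0 a z : 0 <= kern a z.
Proof. by rewrite invr_ge0 powR_ge0. Qed.

Lemma measurable_kern a : measurable_fun setT (kern a).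
Proof.
rewrite /kern [X in measurable_fun _ X](_ : _ =
  (fun z : 'rV[R]_N * 'rV[R]_N => eucl (z.1 - z.2) `^ (- a))); last first.
  by apply/funext => z; rewrite powRN.
apply: measurable_fun_powR; apply: (@measurableT_comp _ _ _ _ _ _ (@eucl R N)).
  exact: measurable_eucl.
exact: measurable_rowB.
Qed.

Lemma measurable_incr f : measurable_fun setT f ->
  measurable_fun setT (fun z : 'rV[R]_N * 'rV[R]_N => f z.1 - f z.2).
Proof.
move=> mf; apply: measurable_funB.
- exact: (@measurableT_comp _ _ _ _ _ _ f _ fst).
- exact: (@measurableT_comp _ _ _ _ _ _ f _ snd).
Qed.

Lemma measurable_energy s p f : measurable_fun setT f ->
  measurable_fun setT (fun z : 'rV[R]_N * 'rV[R]_N =>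
    `|f z.1 - f z.2| `^ p * kern (N%:R + s * p) z).
Proof.
move=> mf; apply: measurable_funM; last exact: measurable_kern.
by apply: measurable_powR_norm; exact: measurable_incr.
Qed.

Lemma energyE s p f : measurable_fun setT f ->
  energy s p f = (\int[mu \x mu]_z
    (`|f z.1 - f z.2| `^ p * kern (N%:R + s * p) z)%:E)%E.
Proof.
move=> mf; rewrite fubini_tonelli1//.
  by apply/measurable_EFinP; exact: measurable_energy.
by move=> z; rewrite lee_fin mulr_ge0 ?powR_ge0// kern_ge0.
Qed.

Lemma energy_ge0 s p f : (0 <= energy s p f)%E.
Proof.
apply: integral_ge0 => x _; apply: integral_ge0 => y _.
by rewrite lee_fin mulr_ge0 ?powR_ge0// invr_ge0 powR_ge0.
Qed.

Lemma gagliardo_powR s p f : 0 < p -> (gagliardo s p f `^ p = energy s p f)%E.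
Proof.
move=> p0; rewrite /gagliardo -/(energy s p f) -poweRrM mulVf ?gt_eqF//.
by rewrite poweRe1// energy_ge0.
Qed.

Lemma energy_sub_sym s p u v : energy s p (u \- v) = energy s p (v \- u).
Proof.
apply: eq_integral => x _; apply: eq_integral => y _ /=.
congr ((_ `^ _) / _)%:E; rewrite -normrN.
by congr (`| _ |); ring.
Qed.

(** * The fractional Sobolev inequality *)

(** The three factors come from the increment [a / 2], from the diameter of a
    cube of side [(2 m)^(1/N)] and from its volume. *)
Definition csob s p : R :=
  (2 `^ p * (N%:R / 2) `^ (N%:R + s * p) * 2 `^ (1 + s * p / N%:R))^-1.

(** At a point where [|f| = a], choose the cube around [x] whose volume is twice
    an upper bound [m] for the measure of [{|f| >= a / 2}]: on at least half of
    it [f] differs from [f x] by [a / 2]. *)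
Lemma sobolev_pointwise s p f x (m : R) : (0 < N)%N -> 0 < p -> 0 <= s ->
  measurable_fun setT f -> 0 < m -> f x != 0 ->
  (mu [set y | (`|f x| / 2 <= `|f y|)%R] <= m%:E)%E ->
  ((csob s p * `|f x| `^ p / m `^ (s * p / N%:R))%:E <=
    \int[mu]_y (`|f x - f y| `^ p / eucl (x - y) `^ (N%:R + s * p))%:E)%E.
Proof.
move=> N0 p0 s0 mf m0 fx0 Am.
have NR0 : 0 < N%:R :> R by rewrite ltr0n.
set A := [set y | _] in Am.
have mA : measurable A.
  rewrite -[X in measurable X]setTI; apply: measurable_fun_ler => //.
  exact: measurable_fun_norm.
pose r := (2 * m) `^ (N%:R^-1) / 2.
have m20 : 0 < 2 * m by rewrite mulr_gt0.
have r0 : 0 < r by rewrite divr_gt0// powR_gt0.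
have muQ : mu (cube x r) = (2 * m)%:E.
  rewrite lebesgue_cube// /r mulrC divfK// -powR_mulrn ?powR_ge0//.
  by rewrite -powRrM mulVf ?gt_eqF// powRr1 ?ltW.
have mQ := measurable_cube x r.
have mE : (m%:E <= mu (cube x r `\` A))%E.
  have : (mu (cube x r) <= mu (cube x r `\` A) + m%:E)%E.
    rewrite {1}(measureDI mu mQ mA) leeD2l// (le_trans _ Am)//.
    by apply: le_measure; rewrite ?inE//; exact: measurableI.
  rewrite muQ; case: (mu (cube x r `\` A)) => [t| |]; rewrite ?leey//.
  by rewrite -EFinD !lee_fin; lra.
pose k : R := (`|f x| / 2) `^ p / (N%:R * r) `^ (N%:R + s * p).
have k0 : 0 <= k by rewrite divr_ge0 ?powR_ge0.
have mU : measurable_fun setT (fun y =>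
    (`|f x - f y| `^ p / eucl (x - y) `^ (N%:R + s * p))%:E).
  apply: (@measurableT_comp _ _ _ _ _ _ (fun z =>
    (`|f z.1 - f z.2| `^ p * kern (N%:R + s * p) z)%:E) _ (pair x)).
    by apply/measurable_EFinP; exact: measurable_energy.
  exact: measurable_pair1.
apply: (@le_trans _ _ (\int[mu]_(y in cube x r `\` A) k%:E)%E).
  rewrite integral_cst; last exact: measurableD.
  apply: (@le_trans _ _ (k%:E * m%:E)%E); last by rewrite lee_wpmul2l ?lee_fin.
  rewrite -EFinM lee_fin /k /csob /r.
  have -> : N%:R * ((2 * m) `^ N%:R^-1 / 2) = (N%:R / 2) * (2 * m) `^ N%:R^-1.
    by ring.
  rewrite [(_ * (2 * m) `^ _) `^ _]powRM ?powR_ge0 ?divr_ge0// -powRrM.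
  have -> : N%:R^-1 * (N%:R + s * p) = 1 + s * p / N%:R.
    by field; rewrite gt_eqF.
  rewrite [(2 * m) `^ _]powRM ?(ltW m0)// [m `^ (1 + _)]powRD; last first.
    by apply/implyP => _; rewrite gt_eqF.
  rewrite powRr1 ?(ltW m0)// [(`|f x| / 2) `^ p]powRM//.
  have -> : 2^-1 `^ p = (2 `^ p)^-1 :> R.
    by rewrite -powR_inv1// -powRrM mulN1r powRN.
  have h2p : 2 `^ p != 0 :> R by rewrite gt_eqF// powR_gt0.
  have h2s : 2 `^ (1 + s * p / N%:R) != 0 :> R by rewrite gt_eqF// powR_gt0.
  have hN : (N%:R / 2) `^ (N%:R + s * p) != 0 :> R.
    by rewrite gt_eqF// powR_gt0// divr_gt0.
  have hm : m `^ (s * p / N%:R) != 0 by rewrite gt_eqF// powR_gt0.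
  rewrite le_eqVlt; apply/orP; left; apply/eqP; field.
  by rewrite h2p h2s hm hN gt_eqF.
apply: (@le_trans _ _ (\int[mu]_(y in cube x r `\` A)
    (`|f x - f y| `^ p / eucl (x - y) `^ (N%:R + s * p))%:E)%E); last first.
  apply: ge0_subset_integral => //; first exact: measurableD.
  by move=> y _; rewrite lee_fin divr_ge0 ?powR_ge0.
apply: ge0_le_integral => //.
- exact: measurableD.
- exact: measurable_funTS.
move=> y [xy /negP]; rewrite -ltNge => fy.
have xny : x - y != 0.
  rewrite subr_eq0; apply: contraTneq fy => <-.
  by rewrite -leNgt ler_pdivrMr// ler_peMr// ler1n.
rewrite lee_fin ler_pM ?powR_ge0// ?invr_ge0 ?powR_ge0//.
  apply: ge0_ler_powR; rewrite ?nnegrE ?divr_ge0 ?(ltW p0)//.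
  have := lerB_dist (f x) (f y); move: fy.
  by move: `|f x| `|f y| `|f x - f y| => a b c; lra.
rewrite lef_pV2 ?posrE ?powR_gt0 ?eucl_gt0 ?mulr_gt0 ?powR_gt0//.
apply: ge0_ler_powR; rewrite ?nnegrE ?eucl_ge0 ?mulr_ge0 ?addr_ge0 ?mulr_ge0//;
  rewrite ?powR_ge0 ?(ltW p0)//.
apply: eucl_le_sup => [i|]; last exact: ltW.
by rewrite !mxE ltW.
Qed.

(** The Sobolev inequality, in two versions at once.  For [t = sp/N] it is the
    embedding into L^{Np/(N-sp)}; a smaller exponent [t] is admissible on
    functions supported in a set of measure at most [V], which also covers
    [sp = N].  The pointwise bound with [m = 2^q |f|_q^q / a^q] gives
    [|f x|^q <= C |f|_q^{qt} U x], to be integrated in [x]. *)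
Lemma sobolev s p (q t V : R) : (0 < N)%N -> 0 < p -> 0 <= s -> 0 < q ->
  0 <= t <= s * p / N%:R -> q * (1 - t) = p -> 0 < V ->
  exists2 C : R, 0 < C & forall f, measurable_fun setT f ->
    t = s * p / N%:R \/ (mu [set x | f x != 0%R] <= V%:E)%E ->
    (\int[mu]_x (`|f x| `^ q)%:E < +oo)%E ->
    ((\int[mu]_x (`|f x| `^ q)%:E) `^ (1 - t) <= C%:E * energy s p f)%E.
Proof.
move=> N0 p0 s0 q0 /andP[t0 ts] qt V0.
have NR0 : 0 < N%:R :> R by rewrite ltr0n.
have c0 : 0 < csob s p.
  by rewrite invr_gt0 !mulr_gt0// powR_gt0// divr_gt0.
pose W := Num.max 1 V `^ (s * p / N%:R - t).
have W0 : 0 < W by rewrite powR_gt0// lt_max ltr01.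
pose C := W * 2 `^ (q * t) / csob s p.
have C0 : 0 < C by rewrite divr_gt0// mulr_gt0// powR_gt0.
exists C => // f mf supp Xfin.
have X0 : (0 <= \int[mu]_x (`|f x| `^ q)%:E)%E.
  by apply: integral_ge0 => x _; rewrite lee_fin powR_ge0.
have [X XE] : exists X : R, (\int[mu]_x (`|f x| `^ q)%:E)%E = X%:E.
  exists (fine (\int[mu]_x (`|f x| `^ q)%:E)%E).
  by rewrite fineK// ge0_fin_numE.
have mfq : measurable_fun setT (fun x => (`|f x| `^ q)%:E).
  by apply/measurable_EFinP; exact: measurable_powR_norm.
rewrite XE /= in X0 Xfin *; rewrite lee_fin in X0.
move: X0; rewrite le_eqVlt => /predU1P[X0|X0].
  rewrite -X0 powR0; first by rewrite mule_ge0 ?energy_ge0// lee_fin ltW.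
  by apply: contraTneq p0 => t1; rewrite -qt t1 mulr0 ltxx.
pose U x := (\int[mu]_y
  (`|f x - f y| `^ p / eucl (x - y) `^ (N%:R + s * p))%:E)%E.
have mU : measurable_fun setT U.
  apply: (@measurable_fun_fubini_tonelli_F _ _ _ _ _ mu
    (fun z => (`|f z.1 - f z.2| `^ p * kern (N%:R + s * p) z)%:E)).
    by apply/measurable_EFinP; exact: measurable_energy.
  by move=> z; rewrite lee_fin mulr_ge0 ?powR_ge0// kern_ge0.
have U0 x : (0 <= U x)%E.
  by apply: integral_ge0 => y _; rewrite lee_fin divr_ge0 ?powR_ge0.
have pw x : ((`|f x| `^ q)%:E <= (C * X `^ t)%:E * U x)%E.
  have [fx|fx] := eqVneq (f x) 0.
    rewrite fx normr0 powR0 ?gt_eqF//.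
    by rewrite mule_ge0// lee_fin mulr_ge0 ?powR_ge0// ltW.
  set a := `|f x|; have a0 : 0 < a by rewrite normr_gt0.
  (* the bound of Chebyshev's inequality for the measure of {|f| >= a / 2} *)
  pose m1 := X / (a / 2) `^ q.
  have a20 : 0 < (a / 2) `^ q by rewrite powR_gt0// divr_gt0.
  have m10 : 0 < m1 by rewrite divr_gt0.
  have mA : measurable [set y | (a / 2 <= `|f y|)%R].
    rewrite -[X in measurable X]setTI; apply: measurable_fun_ler => //.
    exact: measurable_fun_norm.
  have cheb : (mu [set y | (a / 2 <= `|f y|)%R] <= m1%:E)%E.
    have := @le_integral_abse _ _ R mu setT measurableT _ _ mfq a20.
    under [X in (_ <= X)%E -> _]eq_integral do
      rewrite gee0_abs ?lee_fin ?powR_ge0//.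
    rewrite XE muleC -lee_pdivlMr// -EFinM => /(le_trans _); apply.
    apply: le_measure; rewrite ?inE//.
      rewrite setTI -[X in measurable X]setTI.
      apply: emeasurable_fun_c_infty => //.
      exact: (@measurableT_comp _ _ _ _ _ _ abse).
    move=> y /= ay; split; rewrite //= lee_fin ger0_norm ?powR_ge0//.
    by apply: ge0_ler_powR; rewrite ?nnegrE ?divr_ge0// ltW.
  have [m [m0 mle mt]] : exists m : R, [/\ 0 < m,
      (mu [set y | (a / 2 <= `|f y|)%R] <= m%:E)%E
      & m `^ (s * p / N%:R) <= W * m1 `^ t].
    case: supp => [st|sV].
      by exists m1; split; rewrite // /W -st subrr powRr0 mul1r.
    exists (Num.min m1 V); split; first by rewrite lt_min m10.
      rewrite EFin_min le_min cheb /= (le_trans _ sV)//.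
      apply: le_measure; rewrite ?inE//.
        rewrite [X in measurable X](_ : _ = setT `&` f @^-1` (~` [set 0])).
          by apply: mf => //; exact: measurableC.
        by apply/seteqP; split=> [z /= /eqP|z [_ /= /eqP]].
      move=> y /= ay; rewrite -normr_gt0 (lt_le_trans _ ay)// divr_gt0//.
    have mm : 0 < Num.min m1 V by rewrite lt_min m10.
    rewrite -{1}(subrK t (s * p / N%:R)) powRD; last first.
      by apply/implyP => _; rewrite gt_eqF.
    apply: ler_pM; rewrite ?powR_ge0//.
      apply: ge0_ler_powR; rewrite ?nnegrE ?subr_ge0 ?(ltW mm)//.
        by rewrite le_max ler01.
      by rewrite ge_min !le_max lexx !orbT.
    apply: ge0_ler_powR; rewrite ?nnegrE ?(ltW mm) ?(ltW m10)//.
    by rewrite ge_min lexx.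
  have := sobolev_pointwise N0 p0 s0 mf m0 fx mle.
  rewrite -/(U x) -/a => le1.
  have : ((a `^ q)%:E <= (C * X `^ t)%:E *
      (csob s p * a `^ p / m `^ (s * p / N%:R))%:E)%E.
    rewrite -EFinM lee_fin.
    have mt0 : 0 < m `^ (s * p / N%:R) by rewrite powR_gt0.
    have -> : C * X `^ t * (csob s p * a `^ p / m `^ (s * p / N%:R)) =
       (W * 2 `^ (q * t) * X `^ t * a `^ p) / m `^ (s * p / N%:R).
      by rewrite /C; field; rewrite !gt_eqF.
    rewrite ler_pdivlMr// (le_trans (ler_wpM2l (powR_ge0 _ _) mt))//.
    rewrite /m1 [(X / _) `^ t]powRM ?(ltW X0)//; last first.
      by rewrite invr_ge0 ltW.
    rewrite -[((a / 2) `^ q)^-1]powRN -powRrM powRM ?(ltW a0) ?invr_ge0//.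
    rewrite -[2^-1]powR_inv1// -powRrM mulNr mulN1r opprK.
    have -> : a `^ q * (W * (X `^ t * (a `^ (- (q * t)) * 2 `^ (q * t)))) =
       W * 2 `^ (q * t) * X `^ t * (a `^ q * a `^ (- (q * t))) by ring.
    rewrite -powRD; last by apply/implyP => _; rewrite gt_eqF.
    by rewrite -[X in X - _]mulr1 -mulrBr qt.
  move=> /le_trans; apply; apply: lee_wpmul2l => //.
  by rewrite lee_fin mulr_ge0 ?powR_ge0// ltW.
have Xle : (X%:E <= (C * X `^ t)%:E * energy s p f)%E.
  have CX : (0 <= (C * X `^ t)%:E)%E by rewrite lee_fin mulr_ge0 ?powR_ge0//
    ltW.
  rewrite -XE /energy -(ge0_integralZl _ measurableT mU (fun x _ => U0 x) CX).
  by apply: ge0_le_integral => //; exact: measurable_funeM.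
have Xt : 0 < X `^ t by rewrite powR_gt0.
rewrite powRB; last by apply/implyP => _; rewrite gt_eqF.
by rewrite powRr1 ?(ltW X0)// EFinM lee_pdivrMr// muleAC -EFinM.
Qed.

End energy.

(** * Pointwise inequalities *)

Section pointwise.
Context (R : realType).
Implicit Types a b x y M p th : R.

(** A convex power lies above its tangents; this is Young's inequality. *)
Lemma powR_tangent x y b : 0 <= x -> 0 <= y -> 1 <= b ->
  x `^ b + b * x `^ (b - 1) * (y - x) <= y `^ b.
Proof.
move=> x0 y0; rewrite le_eqVlt => /predU1P[<-|b1].
  by rewrite subrr powRr0 !powRr1// !mul1r subrKC.
have b0 : 0 < b by rewrite (lt_trans _ b1).
have bern (r : R) : 0 <= r -> 1 + b * (r - 1) <= r `^ b.
  move=> r0; have c0 : 0 < b / (b - 1) by rewrite divr_gt0// subr_gt0.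
  have := @conjugate_powR _ r 1 b (b / (b - 1)) r0 ler01 b0 c0.
  have -> : b^-1 + (b / (b - 1))^-1 = 1.
    by field; rewrite subr_eq0 (gt_eqF b0) (gt_eqF b1).
  move=> /(_ erefl); rewrite powR1 mulr1 => h.
  have : b * r <= b * (r `^ b / b + 1 / (b / (b - 1))) by rewrite ler_pM2l.
  have -> : b * (r `^ b / b + 1 / (b / (b - 1))) = r `^ b + b - 1.
    by field; rewrite subr_eq0 (gt_eqF b0) (gt_eqF b1).
  by lra.
move: x0; rewrite le_eqVlt => /predU1P[<-|x0].
  rewrite !powR0 ?subr_eq0 ?gt_eqF//.
  by rewrite mulr0 mul0r addr0 powR_ge0.
have := bern (y / x) (divr_ge0 y0 (ltW x0)).
rewrite powRM ?invr_ge0 ?(ltW x0)//.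
have -> : x^-1 `^ b = (x `^ b)^-1.
  by rewrite -powR_inv1 ?(ltW x0)// -powRrM mulN1r powRN.
have xb0 : 0 < x `^ b by rewrite powR_gt0.
rewrite ler_pdivlMr// => /(le_trans _); apply.
rewrite -(mulr_powRB1 (ltW x0) b0) le_eqVlt; apply/orP; left; apply/eqP.
by field; rewrite gt_eqF.
Qed.

Lemma powR_lipschitz M b x y : 1 <= b -> 0 <= x <= M -> 0 <= y <= M ->
  `|x `^ b - y `^ b| <= b * M `^ (b - 1) * `|x - y|.
Proof.
move=> b1; have b0 : 0 <= b by rewrite (le_trans _ b1).
wlog yx : x y / y <= x => [H xM yM|].
  have [yx|/ltW xy] := leP y x; first exact: H.
  by rewrite distrC [`|x - y|]distrC; exact: H.
move=> /andP[x0 xM] /andP[y0 yM].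
rewrite !ger0_norm ?subr_ge0//; last by apply: ge0_ler_powR; rewrite ?nnegrE.
have := powR_tangent x0 y0 b1.
have : b * x `^ (b - 1) * (x - y) <= b * M `^ (b - 1) * (x - y).
  apply: ler_wpM2r; first by rewrite subr_ge0.
  apply: ler_wpM2l => //; apply: ge0_ler_powR; rewrite ?nnegrE ?subr_ge0//.
  exact: le_trans xM.
have -> : b * x `^ (b - 1) * (y - x) = - (b * x `^ (b - 1) * (x - y)) by ring.
by move: (x `^ b) (y `^ b) (b * x `^ _ * _) (b * M `^ _ * _) => s t u v; lra.
Qed.

(** The convexity inequality behind Moser's iteration.  It is Jensen's
    inequality [((x^th - y^th) / (x - y))^p <= mean of (th r^(th-1))^p] over
    [y <= r <= x], since [(r^(th-1))^p = r^(b-1)]. *)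
Lemma power_convexity p th x y : 1 < p -> 1 <= th -> 0 <= y <= x ->
  (x `^ th - y `^ th) `^ p <=
  th `^ p / (p * th - p + 1) *
    ((x - y) `^ (p - 1) * (x `^ (p * th - p + 1) - y `^ (p * th - p + 1))).
Proof.
move=> p1 th1 /andP[y0 yx]; set b := p * th - p + 1.
have p0 : 0 < p by rewrite (lt_trans _ p1).
have th0 : 0 < th by rewrite (lt_le_trans _ th1).
have pth : 0 <= p * (th - 1) by rewrite mulr_ge0 ?subr_ge0 ?(ltW p0).
have b1 : 1 <= b by rewrite /b; lra.
have b0 : 0 < b by rewrite (lt_le_trans _ b1).
have K0 : 0 <= th `^ p / b by rewrite divr_ge0 ?powR_ge0// ltW.
move: yx; rewrite le_eqVlt => /predU1P[->|yx].
  by rewrite !subrr mulr0 mulr0 powR0// gt_eqF.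
move: y0; rewrite le_eqVlt => /predU1P[y0|y0].
  rewrite -y0 in yx *; rewrite !powR0 ?gt_eqF// !subr0.
  have -> : x `^ (p - 1) * x `^ b = x `^ (th * p).
    rewrite /b -powRD; last by apply/implyP => _; rewrite gt_eqF.
    by congr (_ `^ _); ring.
  rewrite -powRrM ler_peMl ?powR_ge0// ler_pdivlMr// mul1r.
  have := @powR_tangent 1 th p ler01 (ltW th0) (ltW p1).
  by rewrite !powR1 /b; lra.
(* The tangent at the mean [m] bounds the [p]-th power from below, and [F] is a
   primitive of the difference [F']. *)
pose m := (x `^ th - y `^ th) / (x - y).
have xy0 : 0 < x - y by rewrite subr_gt0.
have x0 : 0 < x by rewrite (lt_trans y0).
have m0 : 0 <= m.
  rewrite divr_ge0 ?(ltW xy0)// subr_ge0.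
  by apply: ge0_ler_powR; rewrite ?nnegrE ?(ltW th0) ?(ltW y0) ?(ltW x0) ?(ltW
    yx).
have mE : x `^ th - y `^ th = m * (x - y) by rewrite /m divfK// gt_eqF.
pose F r := th `^ p / b * r `^ b - p * m `^ (p - 1) * r `^ th + (p - 1) * m `^
  p * r.
pose F' r := th `^ p / b * (b * r `^ (b - 1)) - p * m `^ (p - 1) * (th * r `^
  (th - 1))
   + (p - 1) * m `^ p.
have dF (r : R) : 0 < r -> is_derive r 1 F (F' r).
  move=> r0.
  have h1 := is_derive1_powR b r0; have h2 := is_derive1_powR th r0.
  rewrite /F /F'; apply: is_derive_eq.
  by rewrite /GRing.scale/= mulr1.
have F'0 (r : R) : 0 < r -> 0 <= F' r.
  move=> r0; have y1 : 0 <= th * r `^ (th - 1)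
    by rewrite mulr_ge0 ?powR_ge0// ltW.
  have := powR_tangent m0 y1 (ltW p1).
  rewrite powRM ?powR_ge0 ?(ltW th0)// -powRrM.
  have -> : (th - 1) * p = b - 1 by rewrite /b; ring.
  rewrite /F' mulrA divfK ?gt_eqF//.
  have := mulr_powRB1 m0 p0.
  move: (m `^ p) (m `^ (p - 1)) => u v <- h.
  have -> : th `^ p * r `^ (b - 1) - p * v * (th * r `^ (th - 1)) + (p - 1) *
    (m * v) =
    th `^ p * r `^ (b - 1) - (m * v + p * v * (th * r `^ (th - 1) - m)) by ring.
  by rewrite subr_ge0.
have : F y <= F x.
  have [||c cyx] := @MVT_segment R F F' y x (ltW yx).
  - by move=> r /itvP ryx; apply: dF; rewrite (lt_trans y0)// ryx.
  - apply: derivable_within_continuous => r /itvP ryx.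
    by apply: ex_derive; apply: dF; rewrite (lt_le_trans y0)// ryx.
  rewrite -subr_ge0 => ->; rewrite mulr_ge0 ?(ltW xy0)// F'0//.
  by rewrite (lt_le_trans y0)// (itvP cyx).
rewrite -subr_ge0 => Fxy.
have hF : m `^ p * (x - y) <= th `^ p / b * (x `^ b - y `^ b).
  rewrite -subr_ge0; apply: le_trans Fxy _.
  have mm := mulr_powRB1 m0 p0.
  have -> : F x - F y = th `^ p / b * (x `^ b - y `^ b) -
     p * m `^ (p - 1) * (x `^ th - y `^ th) + (p - 1) * m `^ p * (x - y).
    by rewrite /F; ring.
  rewrite mE -mm le_eqVlt; apply/orP; left; apply/eqP; ring.
rewrite mE powRM ?(ltW xy0)// -(mulr_powRB1 (ltW xy0) p0).
have -> : th `^ p / b * ((x - y) `^ (p - 1) * (x `^ b - y `^ b)) =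
  (x - y) `^ (p - 1) * (th `^ p / b * (x `^ b - y `^ b)) by ring.
have -> : m `^ p * ((x - y) * (x - y) `^ (p - 1)) =
  (x - y) `^ (p - 1) * (m `^ p * (x - y)) by ring.
by rewrite ler_wpM2l// powR_ge0.
Qed.

Definition clip M x : R := Num.min (Num.max x 0) M.

Lemma clip_itv M x : 0 <= M -> 0 <= clip M x <= M.
Proof.
by move=> M0; rewrite /clip ge_min lexx orbT le_min le_max lexx orbT M0.
Qed.

Lemma clip0 M : 0 <= M -> clip M 0 = 0.
Proof. by move=> M0; rewrite /clip maxxx min_l. Qed.

Lemma clip_le M x : clip M x <= Num.max x 0.
Proof. by rewrite /clip ge_min lexx. Qed.

Lemma clip_nondecreasing M : {homo clip M : x y / x <= y}.
Proof.
move=> x y xy; rewrite /clip le_min !ge_min lexx orbT andbT.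
by rewrite ge_max !le_max xy lexx !orbT.
Qed.

Lemma clip_lipschitz M x y : 0 <= M -> `|clip M x - clip M y| <= `|x - y|.
Proof.
move=> M0; wlog yx : x y / y <= x => [H|].
  have [yx|/ltW xy] := leP y x; first exact: H.
  by rewrite distrC [`|x - y|]distrC; exact: H.
rewrite !ger0_norm ?subr_ge0//; last exact: clip_nondecreasing.
rewrite /clip !minElt !maxElt.
by case: (ltP x 0) => x0; case: (ltP y 0) => y0; do 2?case: ltP => ?; lra.
Qed.

(** Truncation shortens [x - y] and leaves the powers unchanged, so that
    [power_convexity] survives it. *)
Lemma clip_convexity M p th x y : 0 <= M -> 1 < p -> 1 <= th ->
  `|clip M x `^ th - clip M y `^ th| `^ p <=
  th `^ p / (p * th - p + 1) * (`|x - y| `^ (p - 1) *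
    `|clip M x `^ (p * th - p + 1) - clip M y `^ (p * th - p + 1)|).
Proof.
move=> M0 p1 th1; set b := p * th - p + 1.
have p0 : 0 < p by rewrite (lt_trans _ p1).
have th0 : 0 < th by rewrite (lt_le_trans _ th1).
have pth : 0 <= p * (th - 1) by rewrite mulr_ge0 ?subr_ge0 ?(ltW p0).
have b1 : 1 <= b by rewrite /b; lra.
have b0 : 0 < b by rewrite (lt_le_trans _ b1).
wlog yx : x y / y <= x => [H|].
  have [yx|/ltW xy] := leP y x; first exact: H.
  by rewrite distrC [`|x - y|]distrC [`|_ `^ b - _|]distrC; exact: H.
have cyx := clip_nondecreasing M yx.
have /andP[cy0 _] := clip_itv y M0; have /andP[cx0 _] := clip_itv x M0.
have pw r : 0 <= r -> clip M y `^ r <= clip M x `^ r.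
  by move=> r0; apply: ge0_ler_powR; rewrite ?nnegrE.
rewrite !ger0_norm ?subr_ge0 ?pw ?(ltW th0) ?(ltW b0)//.
have := @power_convexity p th (clip M x) (clip M y) p1 th1.
rewrite cy0 cyx => /(_ isT) /le_trans; apply.
apply: ler_wpM2l; first by rewrite divr_ge0 ?powR_ge0// ltW.
apply: ler_wpM2r; first by rewrite subr_ge0 pw// ltW.
have := clip_lipschitz x y M0; rewrite !ger0_norm ?subr_ge0// => h.
by apply: ge0_ler_powR; rewrite ?nnegrE ?subr_ge0 ?(ltW p1).
Qed.

End pointwise.

(** * Smooth functions and test functions *)

Section smooth.
Context (R : realType).

(** Directional derivatives are derivatives along a line, which gives access to
    the chain rule and the mean value theorem of one real variable. *)
Lemma is_derive_line N (f : 'rV[R]_N -> R) x v l :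
  is_derive x v f l <-> is_derive (0 : R) 1 (fun h : R => f (h *: v + x)) l.
Proof.
have E : (fun h : R => h^-1 *: ((f \o shift x) (h *: v) - f x)) =
    (fun h => h^-1 *: (((fun h : R => f (h *: v + x)) \o shift 0) (h *: 1) -
       f (0 *: v + x))).
  by apply/funext => h /=; rewrite addr0 scale0r add0r [_%:A]mulr1.
by split=> -[df dl]; split; rewrite /derivable /derive ?E// in df dl *.
Qed.

Lemma is_derive_line_at N (f : 'rV[R]_N -> R) x v (t : R) :
  derivable f (t *: v + x) v ->
  is_derive t 1 (fun h : R => f (h *: v + x)) ('D_v f (t *: v + x)).
Proof.
move=> /derivableP /is_derive_line df.
have -> : (fun h : R => f (h *: v + x)) =
    (fun h : R => f (h *: v + (t *: v + x))) \o (fun h => h - t).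
  by apply/funext => h /=; rewrite scalerBl addrA subrK.
rewrite -[X in is_derive _ _ _ X]mulr1.
apply: is_derive1_comp; rewrite ?subrr//.
apply: (is_derive_eq (is_deriveB (is_derive_id t 1) (is_derive_cst t t 1))).
by rewrite subr0.
Qed.

Lemma is_derive_comp N (g : R -> R) (f : 'rV[R]_N -> R) x v a b :
  is_derive (f x) 1 g a -> is_derive x v f b ->
  is_derive x v (g \o f) (a * b).
Proof.
move=> dg /is_derive_line df; apply/is_derive_line.
apply: (@is_derive1_comp _ g (fun h : R => f (h *: v + x)) 0) => //=.
by rewrite scale0r add0r.
Qed.

Lemma CkS N k (f : 'rV[R]_N -> R) : Ck k.+1 f -> Ck k f.
Proof.
elim: k f => [|k IH] f [cf df]; first by split.
split=> // i; have [di ci] := df i; split=> //; exact: IH.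
Qed.

Lemma Ck_cst N k (c : R) : Ck k (fun _ : 'rV[R]_N => c).
Proof.
elim: k c => [|k IH] c; split=> //; do ?exact: cst_continuous.
move=> i; split=> [x|]; first exact: derivable_cst.
have -> : (fun x => 'D_(delta_mx 0 i) (fun _ : 'rV[R]_N => c) x) = fun=> 0.
  by apply/funext => x; exact: derive_cst.
exact: IH.
Qed.

Lemma CkD N k (f g : 'rV[R]_N -> R) :
  Ck k f -> Ck k g -> Ck k (fun x => f x + g x).
Proof.
elim: k f g => [|k IH] f g [cf df] [cg dg]; split=> //;
  do ?by move=> x; apply: continuousD; [exact: cf|exact: cg].
move=> i; have [di ci] := df i; have [di' ci'] := dg i; split=> [x|].
  exact: derivableD.
have -> : (fun x => 'D_(delta_mx 0 i) (fun x => f x + g x) x) =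
    (fun x => 'D_(delta_mx 0 i) f x + 'D_(delta_mx 0 i) g x).
  by apply/funext => x; exact: deriveD.
exact: IH.
Qed.

Lemma CkM N k (f g : 'rV[R]_N -> R) :
  Ck k f -> Ck k g -> Ck k (fun x => f x * g x).
Proof.
elim: k f g => [|k IH] f g kf kg; have [cf df] := kf; have [cg dg] := kg;
  split=> //; do ?by move=> x; apply: continuousM; [exact: cf|exact: cg].
move=> i; have [di ci] := df i; have [di' ci'] := dg i; split=> [x|].
  exact: derivableM.
have -> : (fun x => 'D_(delta_mx 0 i) (fun x => f x * g x) x) =
    (fun x => f x * 'D_(delta_mx 0 i) g x + g x * 'D_(delta_mx 0 i) f x).
  by apply/funext => x; exact: deriveM.
by apply: CkD; apply: IH => //; exact: CkS.
Qed.

(** The exponent varies in the induction because a differentiation lowers it. *)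
Lemma Ck_powR N k (f : 'rV[R]_N -> R) (b : R) : (forall x, 0 < f x) ->
  Ck k f -> Ck k (fun x => f x `^ b).
Proof.
move=> f0; elim: k b => [|k IH] b kf; have [cf df] := kf.
  split=> // x.
  apply: (@continuous_comp _ _ _ f (fun t => t `^ b)); first exact: cf.
  apply: differentiable_continuous; apply/derivable1_diffP.
  by apply: derivable_powR; rewrite in_itv/= andbT.
have dfb i x : is_derive x (delta_mx 0 i) (fun x => f x `^ b)
    (b * f x `^ (b - 1) * 'D_(delta_mx 0 i) f x).
  have h1 := is_derive1_powR b (f0 x).
  exact: (is_derive_comp h1 (derivableP ((df i).1 x))).
split.
  move=> x.
  apply: (@continuous_comp _ _ _ f (fun t => t `^ b)); first exact: cf.
  apply: differentiable_continuous; apply/derivable1_diffP.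
  by apply: derivable_powR; rewrite in_itv/= andbT.
move=> i; split=> [x|]; first by have [] := dfb i x.
have -> : (fun x => 'D_(delta_mx 0 i) (fun x => f x `^ b) x) =
    (fun x => b * f x `^ (b - 1) * 'D_(delta_mx 0 i) f x).
  by apply/funext => x; have [_ ->] := dfb i x.
apply: CkM; last exact: (df i).2.
by apply: CkM; [exact: Ck_cst|apply: IH; exact: CkS].
Qed.

Lemma test_function_comp N (Omega : set 'rV[R]_N) (g : R -> R) phi :
  test_function Omega phi -> smooth (g \o phi) -> g 0 = 0 ->
  test_function Omega (g \o phi).
Proof.
move=> [sphi cphi phiO] sg g0.
have sub : [set x | (g \o phi) x != 0] `<=` [set x | phi x != 0].
  by move=> x /=; apply: contra_neq => ->.
have csub := closureS sub.
split=> //; last exact: subset_trans phiO.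
by apply: subclosed_compact cphi csub; exact: closed_closure.
Qed.

Lemma test_functionS N (A B : set 'rV[R]_N) phi :
  A `<=` B -> test_function A phi -> test_function B phi.
Proof. by move=> AB [s c phiA]; split=> //; exact: subset_trans AB. Qed.

Lemma measurable_test_function N (Omega : set 'rV[R]_N) phi :
  test_function Omega phi -> measurable_fun setT phi.
Proof. by move=> [s _ _]; apply: continuous_measurable_row; have [] :=
  s 0%N. Qed.

Lemma test_function_out N (Omega : set 'rV[R]_N) phi x :
  test_function Omega phi -> ~ Omega x -> phi x = 0.
Proof.
move=> [_ _ phiO] nx; apply/eqP; apply: contra_notT nx => px.
by apply: phiO; exact: subset_closure.
Qed.

(** The Euclidean norm of [(x - c, e)], a smooth substitute for [|x - c|]. *)
Definition sabs (e c x : R) : R := ((x - c) ^+ 2 + e ^+ 2) `^ 2^-1.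

(** A smooth approximation of [clip M x = (M + |x| - |x - M|) / 2]. *)
Definition sclip (M e x : R) : R := (M + sabs e 0 x - sabs e M x) / 2.

Lemma sabs_sqr (e c x : R) : sabs e c x ^+ 2 = (x - c) ^+ 2 + e ^+ 2.
Proof.
rewrite /sabs powR12_sqrt ?sqr_sqrtr//; by rewrite addr_ge0 ?sqr_ge0.
Qed.

Lemma sabs_ge0 (e c x : R) : 0 <= sabs e c x. Proof. exact: powR_ge0. Qed.

Lemma sabs_gt (e c x : R) : 0 < e -> `|x - c| < sabs e c x.
Proof.
move=> e0; rewrite -(@ltr_pXn2r _ 2)// ?nnegrE ?sabs_ge0// sabs_sqr.
by rewrite real_normK ?num_real// ltrDl exprn_gt0.
Qed.

Lemma sabs_le (e c x : R) : 0 < e -> sabs e c x <= `|x - c| + e.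
Proof.
move=> e0; rewrite -(@ler_pXn2r _ 2)// ?nnegrE ?sabs_ge0//
  ?addr_ge0 ?(ltW e0)//.
rewrite sabs_sqr [(_ + e) ^+ 2]sqrrD real_normK ?num_real// lerD2r lerDl.
by rewrite mulrn_wge0// mulr_ge0// ltW.
Qed.

Lemma sabs_lipschitz (e c x y : R) : 0 < e ->
  `|sabs e c x - sabs e c y| <= `|x - y|.
Proof.
move=> e0; wlog yx : x y / sabs e c y <= sabs e c x => [H|].
  have [yx|/ltW xy] := leP (sabs e c y) (sabs e c x); first exact: H.
  by rewrite distrC [`|x - y|]distrC; exact: H.
rewrite ger0_norm ?subr_ge0// lerBlDr.
rewrite -(@ler_pXn2r _ 2)// ?nnegrE ?sabs_ge0// ?addr_ge0 ?sabs_ge0//.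
rewrite sabs_sqr [(_ + sabs _ _ _) ^+ 2]sqrrD sabs_sqr real_normK ?num_real//.
have -> : (x - c) ^+ 2 = (x - y) ^+ 2 + (x - y) * (y - c) *+ 2 + (y - c) ^+ 2.
  by rewrite -sqrrD; congr (_ ^+ 2); ring.
have : (x - y) * (y - c) *+ 2 <= `|x - y| * sabs e c y *+ 2.
  rewrite lerMn2r /= (le_trans (ler_norm _))// normrM ler_wpM2l// ltW//.
  exact: sabs_gt.
by move: ((x - y) * (y - c) *+ 2) (`|x - y| * sabs e c y *+ 2) => u v; lra.
Qed.

Lemma sabs_shift (e c x : R) : 0 < e -> 0 <= c ->
  `|sabs e 0 x - sabs e c x| <= c.
Proof.
move=> e0 c0.
have -> : sabs e c x = sabs e 0 (x - c) by rewrite /sabs subr0.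
apply: le_trans (sabs_lipschitz _ _ _ e0) _.
by rewrite opprB addrC subrK ger0_norm.
Qed.

Lemma sclip_itv (M e x : R) : 0 < e -> 0 <= M -> 0 <= sclip M e x <= M.
Proof.
move=> e0 M0; have := sabs_shift x e0 M0; rewrite /sclip ler_norml.
by move: (sabs e 0 x) (sabs e M x) => u v; lra.
Qed.

(** Strict positivity makes every real power of [sclip M e] smooth. *)
Lemma sclip_gt0 (M e x : R) : 0 < e -> 0 < M -> 0 < sclip M e x.
Proof.
move=> e0 M0; rewrite divr_gt0// -addrA -opprB subr_gt0 ltrBlDr.
rewrite -(@ltr_pXn2r _ 2)// ?nnegrE ?sabs_ge0// ?addr_ge0 ?sabs_ge0 ?(ltW M0)//.
rewrite sqrrD !sabs_sqr subr0.
have h : 0 < M * (x + sabs e 0 x).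
  rewrite mulr_gt0//; have := sabs_gt 0 x e0; rewrite subr0 ltr_norml.
  by move: (sabs e 0 x) => u; lra.
by move: h; rewrite mulrDr; move: (M * sabs e 0 x) => u h; rewrite mulr2n; nra.
Qed.

Lemma sclip_lipschitz (M e x y : R) : 0 < e ->
  `|sclip M e x - sclip M e y| <= `|x - y|.
Proof.
move=> e0; have h1 := sabs_lipschitz 0 x y e0; have h2 :=
  sabs_lipschitz M x y e0.
rewrite /sclip; move: h1 h2; rewrite !ler_norml.
by move: `|x - y| (sabs _ _ _) (sabs _ _ _) (sabs _ _ _) (sabs _ _ _) => ? ? ?
  ? ?; lra.
Qed.

Lemma sclip_clip (M e x : R) : 0 < e -> 0 <= M ->
  `|sclip M e x - clip M x| <= e.
Proof.
move=> e0 M0.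
have -> : clip M x = (M + `|x| - `|x - M|) / 2.
  rewrite /clip minElt maxElt; case: (ltP x 0) => x0.
    by rewrite (ltr0_norm x0) ltr0_norm; [case: ltP => ?; lra|lra].
  by rewrite (ger0_norm x0); case: ltP => xM;
    [rewrite ltr0_norm ?subr_lt0|rewrite ger0_norm ?subr_ge0//]; lra.
have h1 := sabs_gt 0 x e0; have h2 := sabs_gt M x e0.
have h3 := sabs_le 0 x e0; have h4 := sabs_le M x e0.
rewrite subr0 in h1 h3; rewrite /sclip ler_norml.
by move: h1 h2 h3 h4; move: (sabs _ _ _) (sabs _ _ _) `|x| `|x - M| => ? ? ? ?;
  lra.
Qed.

Lemma smooth_comb N (f g : 'rV[R]_N -> R) (c1 c2 c3 : R) : smooth f ->
  smooth g ->
  smooth (fun x : 'rV[R]_N => c1 * f x + c2 * (g x + c3)).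
Proof.
move=> sf sg k; apply: CkD; apply: CkM => //; try exact: Ck_cst.
by apply: CkD => //; exact: Ck_cst.
Qed.

Lemma smooth_sclip N (M e : R) (phi : 'rV[R]_N -> R) : 0 < e -> smooth phi ->
  smooth (fun x => sclip M e (phi x)).
Proof.
move=> e0 sphi k.
have sC c : Ck k (fun x => sabs e c (phi x)).
  apply: Ck_powR => [x|]; first by rewrite ltr_wpDl ?sqr_ge0// exprn_gt0.
  apply: CkD; last exact: Ck_cst.
  have -> : (fun x => (phi x - c) ^+ 2) = (fun x => (phi x - c) * (phi x - c)).
    by apply/funext => x; rewrite expr2.
  by apply: CkM; apply: CkD => //; exact: Ck_cst.
apply: CkM; last exact: Ck_cst.
apply: CkD; first by apply: CkD => //; exact: Ck_cst.
have -> : (fun x => - sabs e M (phi x)) = (fun x => -1 * sabs e M (phi x)).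
  by apply/funext => x; rewrite mulN1r.
by apply: CkM => //; exact: Ck_cst.
Qed.

End smooth.

(** * Finiteness of the energy of test functions *)

Section finite_energy.
Context (R : realType).

Lemma powRD_gt0 (x a b : R) : 0 < x -> x `^ (a + b) = x `^ a * x `^ b.
Proof. by move=> x0; rewrite powRD//; apply/implyP => _; rewrite gt_eqF. Qed.

Lemma nneseries_geometric_le (A r : R) : 0 <= A -> 0 <= r < 1 ->
  (\sum_(n <oo) (A * r ^+ n)%:E <= (A / (1 - r))%:E)%E.
Proof.
move=> A0 /andP[r0 r1]; apply: lime_le.
  by apply: is_cvg_nneseries => n _ _; rewrite lee_fin mulr_ge0 ?exprn_ge0.
apply: nearW => n; rewrite sumEFin lee_fin.
have := @geometric_seriesE R A r; rewrite lt_eqF//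
  => /(_ isT) /(congr1 (@^~ n)).
rewrite /series/= => ->.
rewrite ler_pdivrMr ?subr_gt0// divfK ?gt_eqF ?subr_gt0//.
by rewrite ler_piMr// gerBl exprn_ge0.
Qed.

Lemma dyadic_lt1 (e : R) : 0 < e -> e < 1 ->
  exists j : nat, 2 `^ (- j.+1%:R) <= e < 2 `^ (- j%:R).
Proof.
move=> e0 e1.
have ex : exists j : nat, 2 `^ (- j.+1%:R) <= e.
  exists (Num.trunc e^-1); rewrite powRN powR_mulrn//
    invf_ple ?posrE ?exprn_gt0//.
  rewrite (le_trans (ltW (truncnS_gt _)))// -natrX ler_nat.
  by rewrite ltnW// ltn_expl.
exists (ex_minn ex); case: ex_minnP => -[|j] je jmin.
  by rewrite je oppr0 powRr0.
by rewrite je ltNge; apply/negP => /jmin; rewrite ltnn.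
Qed.

Lemma dyadic_ge1 (e : R) : 1 <= e ->
  exists j : nat, 2 `^ j%:R <= e < 2 `^ j.+1%:R.
Proof.
move=> e1.
have ex : exists j : nat, e < 2 `^ j.+1%:R.
  exists (Num.trunc e); rewrite powR_mulrn//.
  rewrite (lt_le_trans (truncnS_gt _))// -natrX ler_nat.
  by rewrite ltnW// ltn_expl.
exists (ex_minn ex); case: ex_minnP => -[|j] je jmin.
  by rewrite je andbT powRr0.
by rewrite je andbT leNgt; apply/negP => /jmin; rewrite ltnn.
Qed.

Context (N : nat).
Local Notation mu := (@lebesgue_row R N).

Lemma lebesgue_dyadic_cube (x : 'rV[R]_N) (r : R) :
  mu (cube x (2 `^ r)) = (2 `^ (N%:R * (1 + r)))%:E.
Proof.
rewrite lebesgue_cube ?powR_gt0// -powR_mulrn ?mulr_ge0 ?powR_ge0//.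
by rewrite -{1}(@powRr1 _ 2)// -powRD_gt0// -powRrM mulrC.
Qed.

Lemma integral_dyadic_cube (x : 'rV[R]_N) (r : R) :
  (\int[mu]_y (\1_(cube x (2 `^ r)) y)%:E = (2 `^ (N%:R * (1 + r)))%:E)%E.
Proof.
rewrite integral_indic//; last exact: measurable_cube.
by rewrite setIT; exact: lebesgue_dyadic_cube.
Qed.

(** An integrable majorant, up to a constant, of the energy density of a bounded
    Lipschitz function. *)
Definition wkern (s p : R) (z : 'rV[R]_N * 'rV[R]_N) : R :=
  Num.min 1 (eucl (z.1 - z.2) `^ p) * kern (N%:R + s * p) z.

Lemma wkern_ge0 s p z : 0 <= wkern s p z.
Proof. by rewrite mulr_ge0 ?kern_ge0// le_min ler01 powR_ge0. Qed.

Lemma wkernC s p x y : wkern s p (x, y) = wkern s p (y, x).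
Proof. by rewrite /wkern /kern /= -[x - y]opprB euclN. Qed.

Lemma measurable_wkern s p : measurable_fun setT (wkern s p).
Proof.
apply: measurable_funM; last exact: measurable_kern.
apply: measurable_minr => //; apply: measurable_fun_powR.
exact: (measurableT_comp (@measurable_eucl R N) (@measurable_rowB R N)).
Qed.

(** The integrals over the dyadic annuli [2^j <= |x - y| < 2^(j+1)] form two
    geometric series, of ratio [2^(-p(1-s))] towards the diagonal and
    [2^(-sp)] at infinity. *)
Lemma wkern_integral_le (s p : R) : 0 < p -> 0 < s < 1 ->
  exists2 C : R, 0 <= C &
    forall x, (\int[mu]_y (wkern s p (x, y))%:E <= C%:E)%E.
Proof.
move=> p0 /andP[s0 s1]; pose a := N%:R + s * p.
have a0 : 0 <= a by rewrite addr_ge0// mulr_ge0// ltW.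
pose al (j : nat) : R := 2 `^ (- j%:R * p) * 2 `^ (j.+1%:R * a).
pose be (j : nat) : R := 2 `^ (- j%:R * a).
pose c : R := Num.min (p * (1 - s)) (s * p).
have c0 : 0 < c by rewrite lt_min !mulr_gt0// subr_gt0.
pose r : R := 2 `^ (- c).
pose A : R := 2 * 2 `^ (2 * N%:R + s * p).
have A0 : 0 <= A by rewrite mulr_ge0// powR_ge0.
have rE j : r ^+ j = 2 `^ (- c * j%:R).
  by rewrite -powR_mulrn ?powR_ge0// -powRrM.
have r01 : 0 <= r < 1.
  have one : 1 `^ c = 1 :> R by rewrite powR1.
  rewrite /r powR_ge0 /= powRN invf_lt1 ?powR_gt0// -[ltLHS]one.
  by apply: gt0_ltr_powR; rewrite ?nnegrE// ltr1n.
exists (A / (1 - r)).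
  by rewrite divr_ge0// subr_ge0; case/andP: r01 => _ /ltW.
move=> x.
pose h j y : R := al j * \1_(cube x (2 `^ (- j%:R))) y +
                  be j * \1_(cube x (2 `^ j.+1%:R)) y.
have h0 j y : 0 <= h j y.
  by rewrite addr_ge0// mulr_ge0// ?mulr_ge0 ?powR_ge0// indicE.
have mh j : measurable_fun setT (h j).
  apply: measurable_funD; apply: measurable_funM => //;
    apply: measurable_indic; exact: measurable_cube.
have hint j : (\int[mu]_y (h j y)%:E <= (A * r ^+ j)%:E)%E.
  rewrite (_ : (fun y => (h j y)%:E) = (fun y =>
     ((al j)%:E * (\1_(cube x (2 `^ (- j%:R))) y)%:E +
      (be j)%:E * (\1_(cube x (2 `^ j.+1%:R)) y)%:E)%E)); last first.
    by apply/funext => y; rewrite /h EFinD !EFinM.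
  have mi (t : R) : measurable_fun setT
      (fun y => (\1_(cube x t) y)%:E : \bar R).
    apply/measurable_EFinP; apply: measurable_indic; exact: measurable_cube.
  rewrite ge0_integralD//; do ?[exact: measurable_funeM
    | by move=> y _; rewrite mule_ge0 ?lee_fin ?mulr_ge0 ?powR_ge0].
  rewrite !ge0_integralZl_EFin//; do ?[by move=> y _; rewrite lee_fin
    | by rewrite ?mulr_ge0 ?powR_ge0].
  rewrite !integral_dyadic_cube -!EFinM -EFinD lee_fin.
  rewrite /al /be -!powRD_gt0//.
  have h1 : 2 `^ (- j%:R * p + j.+1%:R * a + N%:R * (1 + - j%:R)) <=
      2 `^ (2 * N%:R + s * p) * r ^+ j.
    rewrite rE -powRD_gt0// ler_powR ?ler1n//.
    have : c * j%:R <= p * (1 - s) * j%:R by rewrite ler_wpM2r// ge_min lexx.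
    rewrite /a -natr1; lra.
  have h2 : 2 `^ (- j%:R * a + N%:R * (1 + j.+1%:R)) <=
      2 `^ (2 * N%:R + s * p) * r ^+ j.
    rewrite rE -powRD_gt0// ler_powR ?ler1n//.
    have : c * j%:R <= s * p * j%:R by rewrite ler_wpM2r// ge_min lexx orbT.
    have : 0 <= s * p by rewrite mulr_ge0// ltW.
    rewrite /a -natr1; lra.
  by rewrite /A; lra.
apply: (@le_trans _ _ (\int[mu]_y (\sum_(j <oo) (h j y)%:E))%E); last first.
  have mhE j : measurable_fun setT (fun y => (h j y)%:E)
    by apply/measurable_EFinP.
  have h0E j y : (0 <= (h j y)%:E)%E by rewrite lee_fin.
  rewrite (integral_nneseries mu measurableT mhE (fun j y _ => h0E j y)).
  apply: le_trans (nneseries_geometric_le A0 r01).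
  by apply: lee_nneseries => // j _ _; apply: integral_ge0 => y _;
    rewrite lee_fin.
have ser j y : ((h j y)%:E <= \sum_(j <oo) (h j y)%:E)%E.
  apply: le_trans (nneseries_lim_ge j.+1 _); last by move=> *; rewrite lee_fin.
  rewrite big_nat_recr//= leeDr// sume_ge0// => i _; by rewrite lee_fin.
apply: ge0_le_integral => //.
- by move=> y _; rewrite lee_fin wkern_ge0.
- apply/measurable_EFinP.
  exact: (measurableT_comp (measurable_wkern s p) (measurable_pair1 x)).
- apply: ge0_emeasurable_sum; first by move=> j y _ _; rewrite lee_fin.
  by move=> j _; apply/measurable_EFinP.
move=> y _.
have [xy|xy] := eqVneq (x - y) 0.
  rewrite /wkern /= xy; have -> : eucl (0 : 'rV[R]_N) = 0.
    rewrite /eucl big1 ?sqrtr0// => i _; by rewrite mxE expr0n.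
  rewrite powR0 ?gt_eqF// min_r// mul0r.
  by apply: nneseries_ge0 => j _ _; rewrite lee_fin.
set e := eucl (x - y); have e0 : 0 < e by exact: eucl_gt0.
have incube (t : R) : e < t -> (\1_(cube x t) y : R) = 1.
  move=> et; rewrite indicE mem_set// => i; apply: le_lt_trans et.
  by have := coord_le_eucl (x - y) i; rewrite !mxE.
have [e1|e1] := ltP e 1.
  have [j /andP[j1 j2]] := dyadic_lt1 e0 e1.
  apply: le_trans (ser j y); rewrite lee_fin /h incube// mulr1.
  rewrite -[leLHS]addr0 lerD ?mulr_ge0 ?powR_ge0//.
  rewrite /wkern /kern /= -/e -/a ler_pM ?le_min ?ler01 ?invr_ge0 ?powR_ge0//.
    rewrite ge_min; apply/orP; right.
    by rewrite powRrM; apply: ge0_ler_powR;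
      rewrite ?nnegrE ?powR_ge0 ?(ltW p0) ?(ltW e0) ?(ltW j2).
  rewrite invf_ple ?posrE ?powR_gt0// -powRN -mulNr powRrM.
  by apply: ge0_ler_powR; rewrite ?nnegrE ?powR_ge0 ?(ltW e0).
have [j /andP[j1 j2]] := dyadic_ge1 e1.
apply: le_trans (ser j y); rewrite lee_fin /h [X in be j * X]incube// mulr1.
rewrite -[leLHS]add0r lerD ?mulr_ge0 ?powR_ge0//.
rewrite /wkern /kern /= -/e -/a -[leRHS]mul1r ler_pM ?le_min ?ler01 ?invr_ge0
  ?powR_ge0//.
rewrite /be mulNr powRN lef_pV2 ?posrE ?powR_gt0// powRrM.
by apply: ge0_ler_powR; rewrite ?nnegrE ?powR_ge0 ?(ltW e0).
Qed.

(** The energy density is at most a multiple of [wkern], and it vanishes unless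
    one of the two points lies in the cube.  Both halves are integrated by
    Tonelli's theorem, starting with the other point. *)
Lemma energy_lipschitz_lty (s p M L rho : R) (f : 'rV[R]_N -> R) :
  0 < p -> 0 < s < 1 -> measurable_fun setT f -> 0 <= M -> 0 <= L -> 0 < rho ->
  (forall x, `|f x| <= M) -> (forall x y, `|f x - f y| <= L * eucl (x - y)) ->
  (forall x, ~ cube 0 rho x -> f x = 0) -> (energy s p f < +oo)%E.
Proof.
move=> p0 s01 mf M0 L0 rho0 fM fL fQ; have [C C0 wC] :=
  wkern_integral_le p0 s01.
pose K : R := Num.max (2 * M) L `^ p; have K0 : 0 <= K by exact: powR_ge0.
have mL0 : 0 <= Num.max (2 * M) L by rewrite le_max L0 orbT.
set Q := cube 0 rho in fQ; have mQ : measurable Q by exact: measurable_cube.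
have muQ : (mu Q < +oo)%E by rewrite lebesgue_cube// ltry.
pose g1 z := ((\1_Q z.1 : R)%:E * (K * wkern s p z)%:E)%E.
pose g2 z := ((\1_Q z.2 : R)%:E * (K * wkern s p z)%:E)%E.
have mK : measurable_fun setT (fun z => (K * wkern s p z)%:E).
  apply/measurable_EFinP; apply: measurable_funM => //.
  exact: measurable_wkern.
have mI (T : measurableType _) (h : T -> 'rV[R]_N) : measurable_fun setT h ->
    measurable_fun setT (fun z => (\1_Q (h z) : R)%:E).
  move=> mh; apply/measurable_EFinP.
  by apply: (measurableT_comp _ mh); exact: measurable_indic.
have mg1 : measurable_fun setT g1 by apply: emeasurable_funM => //; exact: mI.
have mg2 : measurable_fun setT g2 by apply: emeasurable_funM => //; exact: mI.
have I0 x : 0 <= \1_Q x :> R by rewrite indicE.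
have W0 z : 0 <= K * wkern s p z by rewrite mulr_ge0 ?wkern_ge0.
have g10 z : (0 <= g1 z)%E by rewrite mule_ge0 ?lee_fin.
have g20 z : (0 <= g2 z)%E by rewrite mule_ge0 ?lee_fin.
have mW x : measurable_fun setT (fun y => (wkern s p (x, y))%:E).
  apply/measurable_EFinP.
  exact: (measurableT_comp (measurable_wkern s p) (measurable_pair1 x)).
have inner x : (\int[mu]_y ((\1_Q x : R)%:E * (K * wkern s p (x, y))%:E) <=
    (K * C)%:E * (\1_Q x : R)%:E)%E.
  have E : (fun y => (\1_Q x : R)%:E * (K * wkern s p (x, y))%:E)%E =
      (fun y => (K * \1_Q x)%:E * (wkern s p (x, y))%:E)%E.
    by apply/funext => y; rewrite -!EFinM; congr EFin; ring.
  have w0 y : setT y -> (0 <= (wkern s p (x, y))%:E)%E.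
    by rewrite lee_fin wkern_ge0.
  rewrite E (ge0_integralZl_EFin _ measurableT w0 (mW x) (mulr_ge0 K0 (I0 x))).
  have -> : ((K * C)%:E * (\1_Q x : R)%:E = (K * \1_Q x)%:E * C%:E)%E.
    by rewrite -!EFinM; congr EFin; ring.
  by apply: lee_wpmul2l; rewrite ?lee_fin ?mulr_ge0.
have fin1 : ((K * C)%:E * mu Q < +oo)%E.
  by apply: lte_mul_pinfty => //; rewrite lee_fin mulr_ge0.
have int1 : (\int[mu]_x ((K * C)%:E * (\1_Q x : R)%:E) = (K * C)%:E * mu Q)%E.
  have i0 x : setT x -> (0 <= (\1_Q x : R)%:E)%E by rewrite lee_fin.
  rewrite (ge0_integralZl_EFin _ measurableT i0 (mI _ _ _ (@measurable_id _ _
    setT)) (mulr_ge0 K0 C0)).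
  by rewrite integral_indic// setIT.
have G1 : (\int[mu \x mu]_z g1 z <= (K * C)%:E * mu Q)%E.
  rewrite fubini_tonelli1// -int1; apply: ge0_le_integral => //.
  - by move=> x _; apply: integral_ge0.
  - exact: measurable_fun_fubini_tonelli_F.
  - by apply: measurable_funeM; exact: mI.
  - by move=> x _; exact: inner.
have G2 : (\int[mu \x mu]_z g2 z <= (K * C)%:E * mu Q)%E.
  rewrite fubini_tonelli2// -int1; apply: ge0_le_integral => //.
  - by move=> x _; apply: integral_ge0.
  - exact: measurable_fun_fubini_tonelli_G.
  - by apply: measurable_funeM; exact: mI.
  - move=> x _; rewrite /fubini_G /g2 /=.
    by under eq_integral do rewrite wkernC; exact: inner.
rewrite energyE//; apply: (@le_lt_trans _ _ (\int[mu \x mu]_z (g1 z + g2 z))%E).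
  apply: ge0_le_integral => //.
  - by move=> z _; rewrite lee_fin mulr_ge0 ?powR_ge0 ?kern_ge0.
  - by apply/measurable_EFinP; exact: measurable_energy.
  - exact: emeasurable_funD.
  move=> [x y] _; rewrite /g1 /g2 -!EFinM -EFinD lee_fin -mulrDl /=.
  have b : `|f x - f y| `^ p * kern (N%:R + s * p) (x, y) <= K * wkern s p (x,
    y).
    rewrite /wkern mulrA ler_wpM2r ?kern_ge0//= /K.
    have [e1|e1] := leP 1 (eucl (x - y) `^ p).
      rewrite mulr1; apply: ge0_ler_powR; rewrite ?nnegrE ?(ltW p0)//.
      rewrite le_max; apply/orP; left; rewrite (le_trans (ler_normB _ _))//.
      by have := fM x; have := fM y; lra.
    rewrite -powRM ?eucl_ge0//; apply: ge0_ler_powR;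
      rewrite ?nnegrE ?(ltW p0)//.
      by rewrite mulr_ge0 ?eucl_ge0.
    by rewrite (le_trans (fL _ _))// ler_wpM2r ?eucl_ge0// le_max lexx orbT.
  have [Qx|Qx] := boolP (x \in Q).
    apply: le_trans b _; rewrite ler_peMl// !indicE Qx lerDl; exact: I0.
  have [Qy|Qy] := boolP (y \in Q).
    apply: le_trans b _; rewrite ler_peMl// !indicE Qy lerDr; exact: I0.
  rewrite (fQ x) ?(fQ y); last 2 first.
  - by move/mem_set; apply/negP.
  - by move/mem_set; apply/negP.
  by rewrite subrr normr0 powR0 ?gt_eqF// mul0r mulr_ge0// addr_ge0.
rewrite ge0_integralD//.
by apply: lte_add_pinfty; apply: le_lt_trans fin1.
Qed.

Lemma lipschitz_of_derive (g g' : R -> R) (B : R) :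
  (forall t : R, is_derive t 1 g (g' t)) -> (forall t, `|g' t| <= B) ->
  forall a b, `|g a - g b| <= B * `|a - b|.
Proof.
move=> dg gB a b; wlog ab : a b / b <= a => [H|].
  have [ab|/ltW ab] := leP b a; first exact: H.
  by rewrite distrC [`|a - b|]distrC; exact: H.
have [|c _ ->] := @MVT_segment R g g' b a ab (fun t _ => dg t).
  by apply: derivable_within_continuous => t _; apply: ex_derive; exact: dg.
by rewrite normrM ler_wpM2r.
Qed.

(** Bounded partial derivatives suffice: two points are joined by moving one
    coordinate at a time. *)
Lemma lipschitz_of_partials (f : 'rV[R]_N -> R) (B : R) : 0 <= B ->
  (forall i x, derivable f x (delta_mx 0 i)) ->
  (forall i x, `|'D_(delta_mx 0 i) f x| <= B) ->
  forall x y, `|f x - f y| <= N%:R * B * eucl (x - y).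
Proof.
move=> B0 df fB x y.
have step i z t : `|f (t *: delta_mx 0 i + z) - f z| <= B * `|t|.
  have := @lipschitz_of_derive (fun h : R => f (h *: delta_mx 0 i + z))
    (fun h => 'D_(delta_mx 0 i) f (h *: delta_mx 0 i + z)) B.
  move=> /(_ (fun h => is_derive_line_at (df i _)) (fun h => fB i _) t 0).
  by rewrite scale0r add0r subr0.
pose z (k : nat) : 'rV[R]_N := \row_j (if (j < k)%N then x 0 j else y 0 j).
have zN : z N = x by apply/rowP => j; rewrite mxE ltn_ord.
suff H k : (k <= N)%N -> `|f (z k) - f y| <= k%:R * B * eucl (x - y).
  by rewrite -{1}zN; exact: H.
elim: k => [_|k IH kN].
  have -> : z 0%N = y by apply/rowP => j; rewrite mxE.
  by rewrite subrr normr0 !mul0r.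
pose i := Ordinal kN.
have zS : z k.+1 = (x 0 i - y 0 i) *: delta_mx 0 i + z k.
  apply/rowP => j; rewrite !mxE eqxx /= ltnS.
  case: (ltngtP j k) => jk.
  - have -> : (j == i) = false by apply/negbTE; rewrite -val_eqE /= ltn_eqF.
    by rewrite mulr0 add0r.
  - have -> : (j == i) = false by apply/negbTE; rewrite -val_eqE /= gtn_eqF.
    by rewrite mulr0 add0r.
  - have -> : j = i by apply/val_inj.
    by rewrite eqxx mulr1 subrK.
rewrite -(subrKA (f (z k))) (le_trans (ler_normD _ _))//.
rewrite -natr1 !mulrDl mul1r addrC lerD//; first exact/IH/ltnW.
rewrite zS (le_trans (step _ _ _))// ler_wpM2l//.
by have := coord_le_eucl (x - y) i; rewrite !mxE.
Qed.

Lemma compact_support_bounded (K : set 'rV[R]_N) (g : 'rV[R]_N -> R) :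
  compact K -> continuous g -> (forall x, ~ K x -> g x = 0) ->
  exists2 M : R, 0 <= M & forall x, `|g x| <= M.
Proof.
move=> cK cg g0.
have : compact (g @` K) by apply: continuous_compact => //;
  exact: continuous_subspaceT.
move=> /compact_bounded[M [_ gM]].
exists (`|M| + 1); first by rewrite addr_ge0.
move=> x; have [Kx|Kx] := pselect (K x).
  apply: gM; last by exists x.
  by rewrite (le_lt_trans (ler_norm _))// ltrDl.
by rewrite g0// normr0 addr_ge0.
Qed.

Lemma energy_test_function_lty (s p : R) Omega (phi : 'rV[R]_N -> R) :
  0 < p -> 0 < s < 1 -> test_function Omega phi -> (energy s p phi < +oo)%E.
Proof.
move=> p0 s01 tphi; have mphi := measurable_test_function tphi.
have [sphi cK _] := tphi; set K := closure _ in cK.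
have phi0 x : ~ K x -> phi x = 0 by exact: closure_support_out.
have [cphi dphi] := sphi 1%N.
have [M M0 phiM] := compact_support_bounded cK cphi phi0.
have dphi0 i x : ~ K x -> 'D_(delta_mx 0 i) phi x = 0.
  move=> nKx; rewrite (@near_eq_derive _ _ _ phi (cst 0)) ?derive_cst//.
  have : nbhs x (~` K) by apply: open_nbhs_nbhs; split=> //;
    exact/closed_openC/closed_closure.
  by apply: filterS => z; exact: phi0.
have /choice[B BP] : forall i, exists B, 0 <= B /\
    forall x, `|'D_(delta_mx 0 i) phi x| <= B.
  move=> i; have [_ [cd _]] := dphi i.
  by have [B B0 BP] := compact_support_bounded cK cd (dphi0 i); exists B.
have B0 : 0 <= \sum_i B i by apply: sumr_ge0 => i _; have [] := BP i.
have lphi := @lipschitz_of_partials phi (\sum_i B i) B0 (fun i => (dphi i).1).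
have {}lphi : forall x y, `|phi x - phi y| <=
  N%:R * (\sum_i B i) * eucl (x - y).
  apply: lphi => i x; rewrite (le_trans ((BP i).2 x))// (bigD1 i)//= lerDl.
  by apply: sumr_ge0 => j _; have [] := BP j.
have [r r0 Kr] := bounded_sub_cube (compact_bounded cK).
apply: (@energy_lipschitz_lty s p M (N%:R * (\sum_i B i)) r) => //.
  by rewrite mulr_ge0.
by move=> x nx; apply: phi0; apply: contra_not nx => /Kr.
Qed.

End finite_energy.

(** * Approximation by test functions *)

Section convergence.
Context (R : realType).

Lemma nneseries_cvg0 (u : R^nat) : (forall k, 0 <= u k) ->
  (\sum_(k <oo) (u k)%:E < +oo)%E -> u @ \oo --> 0.
Proof. by move=> u0 us; apply: cvg_series_cvg_0; exact: nnseries_is_cvg. Qed.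

Lemma cvg_powR_norm (p : R) (x : R^nat) : 0 < p -> x @ \oo --> 0 ->
  (fun k => `|x k| `^ p) @ \oo --> 0.
Proof.
move=> p0 /cvgr0Pnorm_lt x0; apply/cvgr0Pnorm_lt => e e0.
have := x0 (e `^ p^-1) (powR_gt0 _ e0).
apply: filterS => k; rewrite (ger0_norm (powR_ge0 _ _)) => xe.
have -> : e = (e `^ p^-1) `^ p by rewrite -powRrM mulVf ?gt_eqF// powRr1// ltW.
by apply: gt0_ltr_powR; rewrite ?nnegrE ?powR_ge0.
Qed.

Lemma cvg_of_powR_norm (p : R) (x : R^nat) : 0 < p ->
  (fun k => `|x k| `^ p) @ \oo --> 0 -> x @ \oo --> 0.
Proof.
move=> p0 xp; apply/norm_cvg0P.
have pV0 : 0 < p^-1 by rewrite invr_gt0.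
have := cvg_powR_norm pV0 xp.
under eq_fun do rewrite (ger0_norm (powR_ge0 _ _)) -powRrM mulfV ?gt_eqF//
  powRr1//.
by [].
Qed.

Lemma cvg_powR_norm_lim (p l : R) (x : R^nat) : 0 < p -> x @ \oo --> l ->
  (fun k => `|x k| `^ p) @ \oo --> `|l| `^ p.
Proof.
move=> p0 xl; have [l0|l0] := eqVneq l 0.
  by rewrite l0 normr0 powR0 ?gt_eqF//; apply: cvg_powR_norm => //; rewrite -l0.
apply: (@continuous_cvg _ _ _ _ _ _ (fun t : R => t `^ p));
  last exact: cvg_norm.
apply: differentiable_continuous; apply/derivable1_diffP.
by apply: derivable_powR; rewrite in_itv/= andbT normr_gt0.
Qed.

Lemma ler_powR_add (p a b : R) : 0 < p -> 0 <= a -> 0 <= b ->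
  (a + b) `^ p <= 2 `^ p * (a `^ p + b `^ p).
Proof.
move=> p0; wlog ab : a b / b <= a => [H a0 b0|a0 b0].
  have [ab|/ltW ab] := leP b a; first exact: H.
  by rewrite addrC [a `^ p + _]addrC; exact: H.
apply: (@le_trans _ _ ((2 * a) `^ p)).
  by apply: ge0_ler_powR; rewrite ?nnegrE ?addr_ge0 ?mulr_ge0 ?(ltW p0)//; lra.
by rewrite powRM// ler_wpM2l ?powR_ge0// lerDl powR_ge0.
Qed.

Lemma ae_cvg0_of_summable d (T : measurableType d)
    (m : {measure set T -> \bar R}) (f : nat -> T -> R) :
  (forall k, measurable_fun setT (f k)) -> (forall k x, 0 <= f k x) ->
  (\sum_(k <oo) \int[m]_x (f k x)%:E < +oo)%E ->
  {ae m, forall x, f k x @[k --> \oo] --> 0}.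
Proof.
move=> mf f0; have mfE k : measurable_fun setT (fun x => (f k x)%:E).
  by apply/measurable_EFinP.
have f0E k x : setT x -> (0 <= (f k x)%:E)%E by rewrite lee_fin.
rewrite -(integral_nneseries m measurableT mfE f0E) => fin.
have ms : measurable_fun setT (fun x => (\sum_(k <oo) (f k x)%:E)%E).
  by apply: ge0_emeasurable_sum => // k x _ _; rewrite lee_fin.
have s0 x : (0 <= \sum_(k <oo) (f k x)%:E)%E.
  by apply: nneseries_ge0 => k _ _; rewrite lee_fin.
have /(integrable_ae measurableT) : m.-integrable setT
    (fun x => (\sum_(k <oo) (f k x)%:E)%E).
  apply/integrableP; split=> //.
  by under eq_integral do rewrite gee0_abs//.
apply: filterS => x /(_ I); rewrite ge0_fin_numE// => fx.
exact: nneseries_cvg0.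
Qed.

(** Dominated convergence for the weighted powers of a sequence [X] that is
    controlled by a fixed function [U] and by a summable sequence [D]. *)
Lemma cvg_integral_powR d (T : measurableType d) (m : {measure set T -> \bar R})
    (p L : R) (K U : T -> R) (D X : nat -> T -> R) :
  0 < p -> 0 <= L -> measurable_fun setT K -> measurable_fun setT U ->
  (forall k, measurable_fun setT (D k)) -> (forall k,
    measurable_fun setT (X k)) ->
  (forall z, 0 <= K z) ->
  (forall k z, `|X k z| <= L * (`|D k z| + 2 * `|U z|)) ->
  (\sum_(k <oo) \int[m]_z (`|D k z| `^ p * K z)%:E < +oo)%E ->
  (\int[m]_z (`|U z| `^ p * K z)%:E < +oo)%E ->
  {ae m, forall z, X k z @[k --> \oo] --> 0} ->
  (\int[m]_z (`|X k z| `^ p * K z)%:E)%E @[k --> \oo] --> 0%E.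
Proof.
move=> p0 L0 mK mU mD mX K0 XDU Dfin Ufin X0.
pose f k z : R := `|X k z| `^ p * K z.
pose fD k z : R := `|D k z| `^ p * K z.
pose fU z : R := `|U z| `^ p * K z.
pose S z := (\sum_(k <oo) (fD k z)%:E)%E.
pose c : R := L `^ p * 2 `^ p; pose c2 : R := 2 `^ p.
have c0 : 0 <= c by rewrite mulr_ge0 ?powR_ge0.
have c20 : 0 <= c2 by exact: powR_ge0.
pose G z := (c%:E * (S z + c2%:E * (fU z)%:E))%E.
have mf k : measurable_fun setT (fun z => (f k z)%:E).
  by apply/measurable_EFinP; apply: measurable_funM => //;
    exact: measurable_powR_norm.
have mfD k : measurable_fun setT (fun z => (fD k z)%:E).
  by apply/measurable_EFinP; apply: measurable_funM => //;
    exact: measurable_powR_norm.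
have mfU : measurable_fun setT (fun z => (fU z)%:E).
  by apply/measurable_EFinP; apply: measurable_funM => //;
    exact: measurable_powR_norm.
have fD0 k z : (0 <= (fD k z)%:E)%E by rewrite lee_fin mulr_ge0 ?powR_ge0.
have fU0 z : (0 <= (fU z)%:E)%E by rewrite lee_fin mulr_ge0 ?powR_ge0.
have mS : measurable_fun setT S by apply: ge0_emeasurable_sum.
have S0 z : (0 <= S z)%E by apply: nneseries_ge0.
have mcU : measurable_fun setT (fun z => (c2%:E * (fU z)%:E)%E).
  exact: measurable_funeM.
have cU0 z : (0 <= c2%:E * (fU z)%:E)%E by rewrite mule_ge0.
have mSU : measurable_fun setT (fun z => (S z + c2%:E * (fU z)%:E)%E).
  exact: emeasurable_funD.
have SU0 z : (0 <= S z + c2%:E * (fU z)%:E)%E by rewrite adde_ge0.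
have mG : measurable_fun setT G by exact: measurable_funeM.
have G0 z : (0 <= G z)%E by rewrite mule_ge0.
have iG : m.-integrable setT G.
  apply/integrableP; split=> //; under eq_integral do rewrite gee0_abs//.
  rewrite (ge0_integralZl_EFin m measurableT (fun z _ => SU0 z) mSU c0).
  rewrite (ge0_integralD m measurableT (fun z _ => S0 z) mS (fun z _ => cU0 z)
    mcU).
  rewrite (ge0_integralZl_EFin m measurableT (fun z _ => fU0 z) mfU c20).
  rewrite (integral_nneseries m measurableT mfD (fun k z _ => fD0 k z)).
  apply: lte_mul_pinfty => //; apply: lte_add_pinfty => //.
  by apply: lte_mul_pinfty.
have [| |_ _] := @dominated_convergence _ T R m setT measurableT
  (fun k z => (f k z)%:E) (cst 0%E) G mf (measurable_cst _) _ iG _.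
- apply: filterS X0 => z Xz _; apply: cvg_EFin; first exact: nearW.
  rewrite -[X in _ --> X](mul0r (K z)).
  by apply: cvgM; [exact: cvg_powR_norm|exact: cvg_cst].
- apply: aeW => z k _; rewrite gee0_abs ?lee_fin ?mulr_ge0 ?powR_ge0//.
  apply: (@le_trans _ _ (c * (fD k z + c2 * fU z))%:E); last first.
    rewrite /G EFinM lee_wpmul2l ?lee_fin//= EFinD EFinM leeD2r//.
    apply: le_trans (nneseries_lim_ge k.+1 _); last by [].
    by rewrite big_nat_recr//= leeDr// sume_ge0.
  rewrite lee_fin /f /fD /fU.
  have -> : c * (`|D k z| `^ p * K z + c2 * (`|U z| `^ p * K z)) =
      L `^ p * (2 `^ p * (`|D k z| `^ p + c2 * `|U z| `^ p)) * K z.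
    by rewrite /c; ring.
  apply: ler_wpM2r => //.
  have -> : c2 * `|U z| `^ p = (2 * `|U z|) `^ p by rewrite powRM.
  apply: (@le_trans _ _ ((L * (`|D k z| + 2 * `|U z|)) `^ p)).
    by apply: ge0_ler_powR; rewrite ?nnegrE ?mulr_ge0 ?addr_ge0 ?mulr_ge0 ?(ltW
      p0).
  rewrite powRM ?addr_ge0 ?mulr_ge0// ler_wpM2l ?powR_ge0//.
  by apply: ler_powR_add; rewrite ?mulr_ge0.
- by rewrite integral0.
Qed.

End convergence.

Section approximation.
Context (R : realType) (N : nat).
Local Notation mu := (@lebesgue_row R N).
Implicit Types (Omega : set 'rV[R]_N) (u v : 'rV[R]_N -> R).

Lemma ereal_cvg0_lt (f : nat -> \bar R) (e : R) : f @ \oo --> 0%E -> 0 < e ->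
  \forall k \near \oo, (f k < e%:E)%E.
Proof.
move=> /fine_cvgP[ff f0] e0; near=> k.
have fk : f k \is a fin_num by near: k.
rewrite -(fineK fk) lte_fin (le_lt_trans (ler_norm _))//.
by near: k; move/cvgr0Pnorm_lt : f0; exact.
Unshelve. all: by end_near. Qed.

Lemma ereal_cvg0_le (f : nat -> \bar R) : (forall k, 0 <= f k)%E ->
  (forall e : R, 0 < e -> \forall k \near \oo, (f k <= e%:E)%E) ->
    f @ \oo --> 0%E.
Proof.
move=> f0 fe; apply/fine_cvgP.
have ffin e k : (f k <= e%:E)%E -> f k \is a fin_num.
  by move=> fk; rewrite ge0_fin_numE// (le_lt_trans fk)// ltry.
split; first by apply: filterS (fe 1 ltr01) => k; exact: ffin.
apply/cvgr0Pnorm_le => e e0; apply: filterS (fe e e0) => k fk.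
by rewrite ger0_norm ?fine_ge0// -lee_fin fineK//; exact: ffin fk.
Qed.

Definition pint (q : R) v : \bar R := (\int[mu]_x (`|v x| `^ q)%:E)%E.

Lemma pint_ge0 q v : (0 <= pint q v)%E.
Proof. by apply: integral_ge0 => x _; rewrite lee_fin powR_ge0. Qed.

Lemma poweR_root_le (x : \bar R) (p e : R) : 0 < p -> 0 <= e -> (0 <= x)%E ->
  (x <= (e `^ p)%:E)%E -> (x `^ p^-1 <= e%:E)%E.
Proof.
move=> p0 e0 x0 xe; have -> : (e%:E = ((e `^ p)%:E) `^ p^-1)%E.
  by rewrite poweR_EFin -powRrM mulfV ?gt_eqF// powRr1.
apply: gt0_ler_poweR => //; first by rewrite invr_ge0 ltW.
  by rewrite in_itv/= x0 leey.
by rewrite in_itv/= lee_fin powR_ge0 leey.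
Qed.

Lemma Lp_norm_powR Omega v (p : R) : 0 < p -> measurable Omega ->
  measurable_fun setT v -> {ae mu, forall x, ~ Omega x -> v x = 0} ->
  (Lp_norm p%:E Omega v `^ p = pint p v)%E.
Proof.
move=> p0 mO mv v0; rewrite /Lp_norm poweR_Lnorm ?gt_eqF//.
have E x : (`|((EFin \o v) \_ Omega) x| `^ p = (`|v x * \1_Omega x| `^ p)%:E)%E.
  rewrite /patch indicE; case: ifPn => _; first by rewrite mulr1.
  by rewrite mulr0 normr0 abse0 poweR_EFin.
under eq_integral do rewrite E; apply: ge0_ae_eq_integral => //.
- apply/measurable_EFinP; apply: measurable_powR_norm.
  by apply: measurable_funM => //; exact: measurable_indic.
- by apply/measurable_EFinP; exact: measurable_powR_norm.
apply: filterS v0 => x v0 _; rewrite indicE.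
by case: (boolP (x \in Omega)) => [_|/negP xO];
  rewrite ?mulr1// v0 ?mul0r// => /mem_set.
Qed.

Lemma Lp_normE Omega v (p : R) : 0 < p -> measurable Omega ->
  measurable_fun setT v -> {ae mu, forall x, ~ Omega x -> v x = 0} ->
  (Lp_norm p%:E Omega v = pint p v `^ p^-1)%E.
Proof.
move=> p0 mO mv v0; rewrite -(Lp_norm_powR p0 mO mv v0) -poweRrM mulfV
  ?gt_eqF//.
by rewrite poweRe1// Lnorm_ge0.
Qed.

(** The triangle inequality up to the factor [2^p], which is enough for
    finiteness and for convergence to [0]. *)
Lemma energyD (s p : R) u v : 0 < p -> measurable_fun setT u ->
  measurable_fun setT v ->
  (energy s p (u \+ v)%R <= (2 `^ p)%:E * (energy s p u + energy s p v))%E.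
Proof.
move=> p0 mu_ mv; rewrite !energyE//; last exact: measurable_funD.
have m1 := measurable_energy s p mu_; have m2 := measurable_energy s p mv.
have pos w z : (0 <= (`|w z.1 - w z.2 : R| `^ p * @kern R N (N%:R + s * p)
  z)%:E)%E.
  by rewrite lee_fin mulr_ge0 ?powR_ge0 ?kern_ge0.
have m1E := measurableT_comp (@EFin_measurable R setT) m1.
have m2E := measurableT_comp (@EFin_measurable R setT) m2.
rewrite -(ge0_integralD _ measurableT (fun z _ => pos u z) m1E (fun z _ => pos
  v z) m2E).
rewrite -(ge0_integralZl_EFin _ measurableT
  (fun z _ => adde_ge0 (pos u z) (pos v z)) (emeasurable_funD m1E m2E)
  (powR_ge0 2 p)).
apply: ge0_le_integral => //.
- apply/measurable_EFinP; apply: measurable_energy; exact: measurable_funD.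
- by apply: measurable_funeM; exact: emeasurable_funD m1E m2E.
move=> z _; rewrite -EFinD -EFinM lee_fin -mulrDl mulrA ler_wpM2r ?kern_ge0//.
apply: le_trans (ler_powR_add p0 (normr_ge0 _) (normr_ge0 _)).
apply: ge0_ler_powR; rewrite ?nnegrE ?addr_ge0 ?(ltW p0)//=.
by have -> : u z.1 + v z.1 - (u z.2 + v z.2) = (u z.1 - u z.2) + (v z.1 - v
  z.2);
  [ring|exact: ler_normD].
Qed.

Lemma energyZ (s p c : R) (f : 'rV[R]_N -> R) : 0 <= c ->
  measurable_fun setT f ->
  (energy s p (fun x => c * f x)%R = (c `^ p)%:E * energy s p f)%E.
Proof.
move=> c0 mf; rewrite !energyE//; last exact: measurable_funM.
have f0 z : setT z -> (0 <= (`|f z.1 - f z.2| `^ p * @kern R N (N%:R + s * p)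
  z)%:E)%E.
  by rewrite lee_fin mulr_ge0 ?powR_ge0 ?kern_ge0.
have mE := measurableT_comp (@EFin_measurable R setT) (measurable_energy s p
  mf).
rewrite -(ge0_integralZl_EFin _ measurableT f0 mE (powR_ge0 c p)).
apply: eq_integral => z _; rewrite -EFinM mulrA -mulrBr normrM powRM//.
by rewrite (ger0_norm c0).
Qed.

Lemma pintZ (q c : R) (f : 'rV[R]_N -> R) : 0 <= c -> measurable_fun setT f ->
  (pint q (fun x => c * f x)%R = (c `^ q)%:E * pint q f)%E.
Proof.
move=> c0 mf; rewrite /pint.
have f0 z : setT z -> (0 <= (`|f z| `^ q)%:E)%E by rewrite lee_fin powR_ge0.
have mE := measurableT_comp (@EFin_measurable R setT) (measurable_powR_norm q
  mf).
rewrite -(ge0_integralZl_EFin _ measurableT f0 mE (powR_ge0 c q)).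
apply: eq_integral => z _; rewrite -EFinM normrM powRM//.
by rewrite (ger0_norm c0).
Qed.

Definition approximates (s p : R) Omega v (psi : nat -> 'rV[R]_N -> R) :=
  [/\ forall k, test_function Omega (psi k),
      energy s p (psi k \- v)%R @[k --> \oo] --> 0%E,
      pint p (psi k \- v)%R @[k --> \oo] --> 0%E
    & {ae mu, forall x, psi k x @[k --> \oo] --> v x}].

(** A geometric rate of approximation gives convergence almost everywhere, and
    dominating functions obtained by summation. *)
Lemma W0tilde_fast (s p : R) Omega u : 0 < p -> measurable Omega ->
  W0tilde s p Omega u -> exists phi : nat -> 'rV[R]_N -> R, forall k,
    [/\ test_function Omega (phi k),
        (energy s p (phi k \- u)%R <= (1 * 2^-1 ^+ k)%:E)%E
      & (pint p (phi k \- u)%R <= (1 * 2^-1 ^+ k)%:E)%E].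
Proof.
move=> p0 mO [mu_ u0 ua].
suff /choice[phi phiP] : forall k : nat, exists phi,
  [/\ test_function Omega phi,
        (energy s p (phi \- u)%R <= (1 * 2^-1 ^+ k)%:E)%E
      & (pint p (phi \- u)%R <= (1 * 2^-1 ^+ k)%:E)%E] by exists phi.
move=> k.
have k0 : 0 < 2^-1 ^+ k :> R by rewrite exprn_gt0// invr_gt0.
have [phi tphi phie] := ua ((2^-1 ^+ k) `^ p^-1) (powR_gt0 _ k0).
have eE : ((2^-1 ^+ k) `^ p^-1) `^ p = 1 * 2^-1 ^+ k :> R.
  by rewrite -powRrM mulVf ?gt_eqF// powRr1 ?mul1r// ltW.
have G0 : (0 <= gagliardo s p (phi \- u)%R)%E by exact: poweR_ge0.
have L0 : (0 <= Lp_norm p%:E Omega (phi \- u)%R)%E by exact: Lnorm_ge0.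
have pw (x : \bar R) : (0 <= x)%E -> (x <= ((2^-1 ^+ k) `^ p^-1)%:E)%E ->
    (x `^ p <= (1 * 2^-1 ^+ k)%:E)%E.
  move=> x0 xe; rewrite -eE -poweR_EFin; apply: gt0_ler_poweR => //.
  - exact: ltW.
  - by rewrite in_itv/= x0 leey.
  - by rewrite in_itv/= lee_fin powR_ge0 leey.
have mphi := measurable_test_function tphi.
exists phi; split=> //.
  rewrite -gagliardo_powR//; apply: pw => //.
  by apply: le_trans (ltW phie); rewrite leeDl.
rewrite -(Lp_norm_powR p0 mO); last 2 first.
- exact: measurable_funB.
- apply: filterS u0 => x u0 nO /=.
  by rewrite (test_function_out tphi nO) u0// subrr.
by apply: pw => //; apply: le_trans (ltW phie); rewrite leeDr.
Qed.

Lemma W0tilde_energy_lty (s p : R) Omega u : 0 < p -> 0 < s < 1 ->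
  measurable Omega -> W0tilde s p Omega u -> (energy s p u < +oo)%E.
Proof.
move=> p0 s01 mO uW; have [mu_ _ _] := uW.
have [phi /(_ 0%N)[tphi Ephi _]] := W0tilde_fast p0 mO uW.
have mphi := measurable_test_function tphi.
have -> : u = (phi 0%N \+ (u \- phi 0%N))%R.
  by apply/funext => x /=; rewrite addrC subrK.
apply: le_lt_trans (energyD _ p0 mphi (measurable_funB mu_ mphi)) _.
apply: lte_mul_pinfty => //.
apply: lte_add_pinfty; first exact: energy_test_function_lty tphi.
rewrite energy_sub_sym; by apply: le_lt_trans Ephi _; rewrite ltry.
Qed.

Lemma geometric_half_lty (f : nat -> \bar R) : (forall k, 0 <= f k)%E ->
  (forall k, f k <= (1 * 2^-1 ^+ k)%:E)%E -> (\sum_(k <oo) f k < +oo)%E.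
Proof.
move=> f0 fk; apply: (@le_lt_trans _ _ (\sum_(k <oo) (1 * 2^-1 ^+ k)%:E)%E).
  exact: lee_nneseries.
have h : 0 <= (2^-1 : R) < 1.
  by apply/andP; split; [rewrite invr_ge0|rewrite invf_lt1 ?ltr1n].
by apply: le_lt_trans (nneseries_geometric_le ler01 h) _; rewrite ltry.
Qed.

(** Superposition with a limit [g] of smooth equi-Lipschitz functions stays in
    the closure of the test functions: [g_k o phi_k] converges to [g o u] by
    dominated convergence, the increments of [g_k o phi_k - g o u] being at most
    [L (|phi_k - u| + 2 |u|)] in terms of increments. *)
Lemma comp_approximates (s p L : R) Omega u (g : R -> R) (gk : nat -> R -> R) :
  0 < p -> 0 < s < 1 -> measurable Omega -> W0tilde s p Omega u ->
  (pint p u < +oo)%E -> 0 <= L -> measurable_fun setT g ->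
  (forall k x y, `|gk k x - gk k y| <= L * `|x - y|) ->
  (forall k, gk k 0 = 0) -> (forall x, gk k x @[k --> \oo] --> g x) ->
  (forall k phi, test_function Omega phi -> smooth (gk k \o phi)) ->
  exists psi, approximates s p Omega (g \o u) psi.
Proof.
move=> p0 s01 mO uW pu L0 mg gL g0 gkg gsm; have [mu_ u0 _] := uW.
have [phi phiP] := W0tilde_fast p0 mO uW.
have tphi k : test_function Omega (phi k) by have [] := phiP k.
have mphi k := measurable_test_function (tphi k).
pose psi k := gk k \o phi k.
have tpsi k : test_function Omega (psi k).
  by apply: test_function_comp => //; exact: gsm.
have mpsi k := measurable_test_function (tpsi k).
have mgu : measurable_fun setT (g \o u) by exact: measurableT_comp.
have gLg x y : `|g x - g y| <= L * `|x - y|.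
  have h : `|gk k x - gk k y| @[k --> \oo] --> `|g x - g y|.
    by apply: cvg_norm; apply: cvgB.
  by apply: (cvgr_to_le h); apply: nearW => k; exact: gL.
have sum_pint : (\sum_(k <oo) pint p (phi k \- u)%R < +oo)%E.
  by apply: geometric_half_lty => k; [exact: pint_ge0|have [] := phiP k].
have phiu : {ae mu, forall x, phi k x @[k --> \oo] --> u x}.
  have mw k : measurable_fun setT (fun x => `|(phi k \- u)%R x| `^ p).
    by apply: measurable_powR_norm; exact: measurable_funB.
  have := @ae_cvg0_of_summable _ _ _ mu _ mw (fun k x => powR_ge0 _ _) sum_pint.
  apply: filterS => x /(cvg_of_powR_norm p0) h.
  apply/subr_cvg0; exact: h.
have psiu : {ae mu, forall x, psi k x @[k --> \oo] --> (g \o u) x}.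
  apply: filterS phiu => x phiu.
  have h1 : (gk k (phi k x) - gk k (u x)) @[k --> \oo] --> 0.
    apply/norm_cvg0P; apply: (@squeeze_cvgr _ _ _ _ (cst 0) (fun k => L * `|phi
      k x - u x|)).
    - by apply: nearW => k; rewrite normr_ge0 gL.
    - exact: cvg_cst.
    - rewrite -(mulr0 L); apply: cvgM; first exact: cvg_cst.
      by apply/norm_cvg0P; apply/subr_cvg0.
  have -> : psi ^~ x = (fun k => (gk k (phi k x) - gk k (u x)) + gk k (u x)).
    by apply/funext => k; rewrite subrK.
  by rewrite -[X in _ --> X]add0r; apply: cvgD.
have Lu k x : `|psi k x - g (u x)| <= L * (`|phi k x - u x| + 2 * `|u x|).
  have h1 := gL k (phi k x) 0; have h2 := gLg (u x) 0.
  have g00 : g 0 = 0.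
    have := gkg 0; under eq_fun do rewrite g0.
    by move=> /(cvg_unique _ (cvg_cst _)) <-.
  rewrite g0 !subr0 in h1; rewrite g00 !subr0 in h2.
  have h3 : `|phi k x| <= `|phi k x - u x| + `|u x|.
    by rewrite -{1}(subrK (u x) (phi k x)) ler_normD.
  rewrite (le_trans (ler_normB _ _))// (le_trans (lerD h1 h2))//.
  rewrite -mulrDr ler_wpM2l// (le_trans (lerD h3 (lexx _)))//.
  by rewrite -addrA lerD2l mulr_natl mulr2n.
exists psi; split=> //.
- under eq_fun do rewrite (energyE _ _ (measurable_funB (mpsi _) mgu)).
  pose D k z := (phi k z.1 - u z.1) - (phi k z.2 - u z.2).
  pose X k z := (psi k z.1 - g (u z.1)) - (psi k z.2 - g (u z.2)).
  apply: (@cvg_integral_powR _ _ _ _ p L (@kern R N (N%:R + s * p))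
    (fun z => u z.1 - u z.2) D X) => //.
  + exact: measurable_kern.
  + exact: measurable_incr.
  + by move=> k; exact: (measurable_incr (measurable_funB (mphi k) mu_)).
  + by move=> k; exact: (measurable_incr (measurable_funB (mpsi k) mgu)).
  + by move=> z; exact: kern_ge0.
  + move=> k z; rewrite /X /D.
    have h1 := gL k (phi k z.1) (phi k z.2); have h2 := gLg (u z.1) (u z.2).
    have -> : psi k z.1 - g (u z.1) - (psi k z.2 - g (u z.2)) =
      (gk k (phi k z.1) - gk k (phi k z.2)) - (g (u z.1) - g (u z.2)).
      by rewrite /psi /=; ring.
    have h3 : `|phi k z.1 - phi k z.2| <=
       `|phi k z.1 - u z.1 - (phi k z.2 - u z.2)| + `|u z.1 - u z.2|.
      have -> : phi k z.1 - phi k z.2 =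
        (phi k z.1 - u z.1 - (phi k z.2 - u z.2)) + (u z.1 - u z.2) by ring.
      by rewrite -[in leRHS](addrK (u z.1 - u z.2) (phi k z.1 - u z.1 - _))
        addrK ler_normD.
    rewrite (le_trans (ler_normB _ _))// (le_trans (lerD h1 h2))//.
    rewrite -mulrDr ler_wpM2l// (le_trans (lerD h3 (lexx _)))//.
    by rewrite -addrA lerD2l mulr_natl mulr2n.
  + have E k : (\int[mu \x mu]_z (`|D k z| `^ p * kern (N%:R + s * p) z)%:E =
      energy s p (phi k \- u)%R)%E.
      by rewrite energyE//; exact: measurable_funB.
    under eq_eseriesr do rewrite E.
    by apply: geometric_half_lty => k; [exact: energy_ge0|have [] := phiP k].
  + by rewrite -energyE//; exact: W0tilde_energy_lty uW.
  + have h1 := @ae_product_fst _ _ _ _ _ mu mu _ psiu.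
    have h2 := @ae_product_snd _ _ _ _ _ mu mu _ psiu.
    apply: filterS2 h1 h2 => z h1 h2.
    rewrite /X -(subrr 0); apply: cvgB; apply/subr_cvg0; [exact: h1|exact: h2].
- have E k (w : nat -> 'rV[R]_N -> R) : pint p (w k) =
    (\int[mu]_z (`|w k z| `^ p * 1)%:E)%E.
    by apply: eq_integral => z _; rewrite mulr1.
  under eq_fun do rewrite (E _ (fun k => psi k \- (g \o u))%R).
  apply: (@cvg_integral_powR _ _ _ _ p L (cst 1) u (fun k => phi k \- u)%R) =>
    //.
  + by move=> k; exact: measurable_funB.
  + by move=> k; exact: measurable_funB.
  + by under eq_eseriesr do rewrite -(E _ (fun k => phi k \- u)%R).
  + by rewrite -(E 0%N (fun=> u)).
  + by apply: filterS psiu => x h; apply/subr_cvg0; exact: h.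
Qed.

Lemma gagliardo_cvg0 (s p : R) (f : nat -> 'rV[R]_N -> R) : 0 < p ->
  energy s p (f k) @[k --> \oo] --> 0%E -> gagliardo s p (f k) @[k --> \oo] -->
    0%E.
Proof.
move=> p0 fk; apply: ereal_cvg0_le => [k|e e0]; first exact: poweR_ge0.
have := ereal_cvg0_lt fk (powR_gt0 p e0); apply: filterS => k h.
by apply: poweR_root_le; rewrite ?energy_ge0 ?(ltW e0) ?(ltW h).
Qed.

Lemma approximates_W0 (s p : R) Omega v psi : 0 < p -> measurable_fun setT v ->
  approximates s p Omega v psi -> W0 s p v.
Proof.
move=> p0 mv [tpsi Epsi _ psiv]; split=> //; exists psi; split=> //.
- by move=> k; apply: test_functionS (tpsi k).
- exact: gagliardo_cvg0.
Qed.

Lemma approximates_W0tilde (s p : R) Omega v psi : 0 < p -> measurable Omega ->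
  measurable_fun setT v -> {ae mu, forall x, ~ Omega x -> v x = 0} ->
  approximates s p Omega v psi -> W0tilde s p Omega v.
Proof.
move=> p0 mO mv v0 [tpsi Epsi Ppsi _]; split=> // e e0.
have e30 : 0 < e / 3 by rewrite divr_gt0.
have e3p : 0 < (e / 3) `^ p by rewrite powR_gt0.
have h1 := ereal_cvg0_lt Epsi e3p; have h2 := ereal_cvg0_lt Ppsi e3p.
have [k [k1 k2]] : exists k, (energy s p (psi k \- v)%R < ((e / 3) `^ p)%:E)%E
  /\
    (pint p (psi k \- v)%R < ((e / 3) `^ p)%:E)%E.
  by apply: (@filter_ex _ (nbhs \oo)); apply: filterS2 h1 h2.
exists (psi k) => //.
apply: (@le_lt_trans _ _ ((e / 3)%:E + (e / 3)%:E)%E); last first.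
  by rewrite -EFinD lte_fin; lra.
apply: leeD.
  by apply: poweR_root_le; rewrite ?energy_ge0 ?(ltW e30) ?(ltW k1).
rewrite Lp_normE//.
- by apply: poweR_root_le; rewrite ?pint_ge0 ?(ltW e30) ?(ltW k2).
- by apply: measurable_funB => //; exact: measurable_test_function (tpsi k).
- apply: filterS v0 => x v0 nO /=.
  by rewrite (test_function_out (tpsi k) nO) v0// subrr.
Qed.

End approximation.

(** * The Caccioppoli inequality of a minimizer *)

Section clip_power.
Context (R : realType).
Implicit Types M p th b t x y : R.

Lemma clip_powR_lipschitz M b x y : 0 <= M -> 1 <= b ->
  `|clip M x `^ b - clip M y `^ b| <= b * M `^ (b - 1) * `|x - y|.
Proof.
move=> M0 b1.
apply: (le_trans (powR_lipschitz b1 (clip_itv x M0) (clip_itv y M0))).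
apply: ler_wpM2l; last exact: clip_lipschitz.
by rewrite mulr_ge0 ?powR_ge0// (le_trans _ b1).
Qed.

Lemma clip_powR_nondecreasing M b x y : 0 <= M -> 0 <= b -> y <= x ->
  clip M y `^ b <= clip M x `^ b.
Proof.
move=> M0 b0 yx; have /andP[cy0 _] := clip_itv y M0; have /andP[cx0 _] :=
  clip_itv x M0.
by apply: ge0_ler_powR; rewrite ?nnegrE// clip_nondecreasing.
Qed.

(** Subtracting the small multiple [t (clip M x)^b] shortens every increment,
    by an amount that controls the increments of [(clip M x)^th]. *)
Lemma shrink_increment M p th t x y : 0 <= M -> 1 < p -> 1 <= th -> 0 <= t ->
  let b := p * th - p + 1 in p * t * (b * M `^ (b - 1)) <= 1 ->
  `|x - t * clip M x `^ b - (y - t * clip M y `^ b)| `^ p +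
   p * t * (1 - p * t * (b * M `^ (b - 1))) * (b / th `^ p) *
      `|clip M x `^ th - clip M y `^ th| `^ p
  <= `|x - y| `^ p.
Proof.
move=> M0 p1 th1 t0 b; set L := b * M `^ (b - 1) => tL.
have p0 : 0 < p by rewrite (lt_trans _ p1).
have th0 : 0 < th by rewrite (lt_le_trans _ th1).
have pth : 0 <= p * (th - 1) by rewrite mulr_ge0 ?subr_ge0 ?(ltW p0).
have b1 : 1 <= b by rewrite /b; lra.
have b0 : 0 < b by rewrite (lt_le_trans _ b1).
have L0 : 0 <= L by rewrite mulr_ge0 ?powR_ge0 ?(ltW b0).
have tL0 : 0 <= t * L by rewrite mulr_ge0.
have tL1 : t * L <= 1.
  by rewrite (le_trans _ tL)// -mulrA ler_peMl// ltW.
wlog yx : x y / y <= x => [H|].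
  have [yx|/ltW xy] := leP y x; first exact: H.
  have := H y x xy.
  by rewrite distrC [`|y - x|]distrC [`|clip M y `^ th - _|]distrC.
set gx := clip M x `^ b; set gy := clip M y `^ b.
have gyx : gy <= gx by apply: clip_powR_nondecreasing => //; exact: ltW.
have gL := clip_powR_lipschitz x y M0 b1.
rewrite -/gx -/gy -/L !ger0_norm ?subr_ge0// in gL.
have tg : t * (gx - gy) <= t * L * (x - y) by rewrite -mulrA ler_wpM2l.
have xy0 : 0 <= x - y by rewrite subr_ge0.
have hE : x - t * gx - (y - t * gy) = (x - y) - t * (gx - gy) by ring.
have hlow : (1 - t * L) * (x - y) <= (x - y) - t * (gx - gy).
  by rewrite mulrBl mul1r lerB.
have h0 : 0 <= (x - y) - t * (gx - gy).
  by apply: le_trans hlow; rewrite mulr_ge0// subr_ge0.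
rewrite hE (ger0_norm h0) [`|x - y|]ger0_norm//.
have tan := powR_tangent h0 xy0 (ltW p1).
set h := (x - y) - t * (gx - gy) in tan h0 hlow *.
have dE : x - y - h = t * (gx - gy) by rewrite /h; ring.
rewrite dE in tan.
have conv := @clip_convexity R M p th x y M0 p1 th1.
rewrite -/b -/gx -/gy [`|x - y|]ger0_norm// [`|gx - gy|]ger0_norm ?subr_ge0//
  in conv.
set Gp := `|clip M x `^ th - clip M y `^ th| `^ p in conv *.
have thp : 0 < th `^ p by rewrite powR_gt0.
have conv' : b / th `^ p * Gp <= (x - y) `^ (p - 1) * (gx - gy).
  rewrite -ler_pdivlMl ?divr_gt0// invf_div; exact: conv.
have bern : (1 - p * t * L) * (x - y) `^ (p - 1) <= h `^ (p - 1).
  apply: (@le_trans _ _ (((1 - t * L) * (x - y)) `^ (p - 1))); last first.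
    have p10 : 0 <= p - 1 by rewrite subr_ge0 ltW.
    have cxy0 : 0 <= (1 - t * L) * (x - y) by rewrite mulr_ge0// subr_ge0.
    by apply: ge0_ler_powR; rewrite ?nnegrE.
  have c0 : 0 <= 1 - t * L by rewrite subr_ge0.
  rewrite powRM// ler_wpM2r ?powR_ge0//.
  have := powR_tangent ler01 c0 (ltW p1).
  rewrite !powR1 mulr1 => hb.
  apply: (@le_trans _ _ ((1 - t * L) `^ p)).
    by apply: le_trans hb; rewrite -mulrA; lra.
  rewrite -(mulr_powRB1 c0 p0) ler_piMl ?powR_ge0//; lra.
have d0 : 0 <= gx - gy by rewrite subr_ge0.
apply: le_trans tan; rewrite lerD2l.
have pt0 : 0 <= p * t by rewrite mulr_ge0// ltW.
apply: (@le_trans _ _ (p * t * (1 - p * t * L) * ((x - y) `^ (p - 1) * (gx -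
  gy)))).
  rewrite -mulrA ler_wpM2l// mulr_ge0// subr_ge0//.
have -> : p * h `^ (p - 1) * (t * (gx - gy)) =
  p * t * (gx - gy) * h `^ (p - 1) by ring.
have -> : p * t * (1 - p * t * L) * ((x - y) `^ (p - 1) * (gx - gy)) =
  p * t * (gx - gy) * ((1 - p * t * L) * (x - y) `^ (p - 1)) by ring.
by rewrite ler_wpM2l// mulr_ge0.
Qed.

(** The matching bound for the [L^p] norm: convexity at [|x|]. *)
Lemma shrink_norm M p b t x : 0 <= M -> 1 <= p -> 1 <= b -> 0 <= t ->
  `|x| `^ p <= `|x - t * clip M x `^ b| `^ p +
    p * t * (`|x| `^ (p - 1) * clip M x `^ b).
Proof.
move=> M0 p1 b1 t0.
have := powR_tangent (normr_ge0 x) (normr_ge0 (x - t * clip M x `^ b)) p1.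
have tg : 0 <= t * clip M x `^ b by rewrite mulr_ge0// powR_ge0.
have low : - (t * clip M x `^ b) <= `|x - t * clip M x `^ b| - `|x|.
  by have := lerB_dist x (t * clip M x `^ b); rewrite (ger0_norm tg); lra.
have : p * `|x| `^ (p - 1) * - (t * clip M x `^ b) <=
    p * `|x| `^ (p - 1) * (`|x - t * clip M x `^ b| - `|x|).
  by rewrite ler_wpM2l// mulr_ge0 ?powR_ge0// (le_trans _ p1).
have -> : p * `|x| `^ (p - 1) * - (t * clip M x `^ b) =
  - (p * t * (`|x| `^ (p - 1) * clip M x `^ b)) by ring.
move: (`|x| `^ p) (`|x - _| `^ p) (p * t * _) (_ * (_ - _)) => a1 a2 a3 a4; lra.
Qed.

Lemma clip_powR_le M b x : 0 <= M -> 1 <= b ->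
  clip M x `^ b <= b * M `^ (b - 1) * `|x|.
Proof.
move=> M0 b1; have := clip_powR_lipschitz x 0 M0 b1.
rewrite clip0// powR0 ?subr0; last by rewrite gt_eqF// (lt_le_trans _ b1).
by rewrite ger0_norm ?powR_ge0.
Qed.

Lemma clip_moment M p th x : 0 <= M -> 1 < p -> 1 <= th ->
  `|x| `^ (p - 1) * clip M x `^ (p * th - p + 1) <= `|Num.max x 0| `^ (p * th).
Proof.
move=> M0 p1 th1.
have p0 : 0 < p by rewrite (lt_trans _ p1).
have pth : 0 <= p * (th - 1) by rewrite mulr_ge0 ?subr_ge0 ?(ltW p0).
have b0 : 0 < p * th - p + 1 by lra.
have [x0|x0] := leP x 0.
  have -> : clip M x = 0 by rewrite /clip max_r// min_l.
  by rewrite powR0 ?gt_eqF// mulr0 powR_ge0.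
rewrite gtr0_norm//.
apply: (@le_trans _ _ (x `^ (p - 1) * x `^ (p * th - p + 1))); last first.
  by rewrite -powRD_gt0// le_eqVlt; apply/orP; left; apply/eqP;
    congr (_ `^ _); ring.
rewrite ler_wpM2l ?powR_ge0//.
have /andP[c0 _] := clip_itv x M0.
apply: ge0_ler_powR; rewrite ?nnegrE ?(ltW x0) ?(ltW b0)//.
by rewrite (le_trans (clip_le M x))// max_l// ltW.
Qed.

Lemma measurable_clip M : measurable_fun setT (clip M).
Proof. by apply: measurable_minr => //; apply: measurable_maxr. Qed.

(** The competitors of the variational argument are limits of test functions:
    replacing [clip M] by [sclip M e] makes the superposition smooth, with a
    Lipschitz constant independent of [e]. *)
Lemma clip_approximates N (s p c1 c2 M b : R) (Omega : set 'rV[R]_N) u :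
  0 < p -> 0 < s < 1 -> measurable Omega -> W0tilde s p Omega u ->
  (pint p u < +oo)%E -> 0 < M -> 1 <= b ->
  exists psi, approximates s p Omega
    ((fun x => c1 * x + c2 * clip M x `^ b) \o u) psi.
Proof.
move=> p0 s01 mO uW pu M0 b1.
have b0 : 0 < b by rewrite (lt_le_trans _ b1).
pose e (k : nat) : R := k.+1%:R^-1; have e0 k : 0 < e k by rewrite invr_gt0.
pose L := b * M `^ (b - 1); have L0 : 0 <= L
  by rewrite mulr_ge0 ?powR_ge0 ?(ltW b0).
pose gk k x := c1 * x + c2 * (sclip M (e k) x `^ b - sclip M (e k) 0 `^ b).
have sL k x y : `|sclip M (e k) x `^ b - sclip M (e k) y `^ b| <= L * `|x - y|.
  apply: (le_trans (powR_lipschitz b1 (sclip_itv x (e0 k) (ltW M0))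
    (sclip_itv y (e0 k) (ltW M0)))).
  by apply: ler_wpM2l => //; exact: sclip_lipschitz.
have sC k x : `|sclip M (e k) x `^ b - clip M x `^ b| <= L * e k.
  apply: (le_trans (powR_lipschitz b1 (sclip_itv x (e0 k) (ltW M0))
    (clip_itv x (ltW M0)))).
  by apply: ler_wpM2l => //; exact: sclip_clip (ltW M0).
apply: (@comp_approximates _ _ s p (`|c1| + `|c2| * L) Omega u _ gk) => //.
- by rewrite addr_ge0// mulr_ge0.
- apply: measurable_funD; apply: measurable_funM => //.
  by apply: measurable_fun_powR; exact: measurable_clip.
- move=> k x y; rewrite /gk.
  move: (sL k x y).
  move: (sclip _ _ x `^ b) (sclip _ _ y `^ b) (sclip _ _ 0 `^ b) => A B C AB.
  have -> : c1 * x + c2 * (A - C) - (c1 * y + c2 * (B - C)) =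
    c1 * (x - y) + c2 * (A - B) by ring.
  rewrite (le_trans (ler_normD _ _))// !normrM mulrDl lerD2l -mulrA.
  by rewrite ler_wpM2l.
- by move=> k; rewrite /gk subrr !mulr0 addr0.
- move=> x; rewrite /gk; apply: cvgD; first exact: cvg_cst.
  apply: cvgM; first exact: cvg_cst.
  have h z : sclip M (e k) z `^ b @[k --> \oo] --> clip M z `^ b.
    apply/subr_cvg0/norm_cvg0P.
    apply: (@squeeze_cvgr _ _ _ _ (cst 0) (fun k => L * e k)).
    - by apply: nearW => k; rewrite normr_ge0 sC.
    - exact: cvg_cst.
    - by rewrite -(mulr0 L); apply: cvgM; [exact: cvg_cst|exact: cvg_harmonic].
  rewrite -[clip M x `^ b]subr0; apply: cvgB; first exact: h.
  by have := h 0; rewrite clip0 ?(ltW M0)// powR0// gt_eqF.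
- move=> k phi [sphi _ _]; apply: smooth_comb => //.
  move=> n; apply: Ck_powR; last exact: smooth_sclip.
  by move=> x; exact: sclip_gt0.
Qed.

End clip_power.

Section caccioppoli.
Context (R : realType) (N : nat).
Local Notation mu := (@lebesgue_row R N).
Implicit Types (Omega : set 'rV[R]_N) (u v : 'rV[R]_N -> R) (s p : R).

Lemma le_pint (q : R) u v : 0 <= q -> measurable_fun setT u ->
  measurable_fun setT v -> (forall x, `|u x| <= `|v x|) -> (pint q u <=
    pint q v)%E.
Proof.
move=> q0 mu_ mv uv; apply: ge0_le_integral => //.
- by apply/measurable_EFinP; exact: measurable_powR_norm.
- by apply/measurable_EFinP; exact: measurable_powR_norm.
by move=> x _; rewrite lee_fin; apply: ge0_ler_powR; rewrite ?nnegrE.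
Qed.

Lemma measurable_clip_powR (M b : R) u : measurable_fun setT u ->
  measurable_fun setT (fun x => clip M (u x) `^ b).
Proof.
move=> mu_; apply: measurable_fun_powR.
exact: (measurableT_comp (@measurable_clip R M) mu_).
Qed.

Lemma measurable_comb_clip (c1 c2 M b : R) u : measurable_fun setT u ->
  measurable_fun setT ((fun x => c1 * x + c2 * clip M x `^ b) \o u).
Proof.
move=> mu_; apply: (@measurableT_comp _ _ _ _ _ _ (fun x => c1 * x + c2 * clip
  M x `^ b) _ u) => //.
apply: measurable_funD; apply: measurable_funM => //.
by apply: measurable_fun_powR; exact: measurable_clip.
Qed.

Lemma comb_clip_W0tilde s p (c1 c2 M b : R) Omega u :
  0 < p -> 0 < s < 1 -> measurable Omega -> W0tilde s p Omega u ->
  (pint p u < +oo)%E -> 0 < M -> 1 <= b ->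
  W0tilde s p Omega ((fun x => c1 * x + c2 * clip M x `^ b) \o u).
Proof.
move=> p0 s01 mO uW pu M0 b1; have [mu_ u0 _] := uW.
have [psi psiP] := clip_approximates c1 c2 p0 s01 mO uW pu M0 b1.
apply: approximates_W0tilde psiP => //; first exact: measurable_comb_clip.
apply: filterS u0 => x u0 nO /=; rewrite u0// mulr0 clip0 ?(ltW M0)//.
by rewrite powR0 ?mulr0 ?addr0// gt_eqF// (lt_le_trans _ b1).
Qed.

Lemma admissible_pint s p Omega u : 0 < p -> measurable Omega ->
  lambda_admissible s p Omega u -> pint p u = 1%E.
Proof.
move=> p0 mO [[mu_ u0 _] un _].
by rewrite -(Lp_norm_powR p0 mO mu_ u0) un poweR1r.
Qed.

(** By homogeneity, the minimality applies to functions of any norm. *)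
Lemma lambda1_le s p Omega v (m : R) : 0 < p -> measurable Omega -> 0 < m ->
  W0tilde s p Omega (fun x => m `^ (- p^-1) * v x) -> measurable_fun setT v ->
  {ae mu, forall x, 0 <= v x} -> pint p v = m%:E ->
  (lambda1 s p Omega * m%:E <= energy s p v)%E.
Proof.
move=> p0 mO m0 vW mv v0 pv; pose c := m `^ (- p^-1).
have c0 : 0 < c by exact: powR_gt0.
have cp : c `^ p = m^-1.
  by rewrite /c -powRrM mulNr mulVf ?gt_eqF// powR_inv1// ltW.
have [mcv cv0 _] := vW.
rewrite muleC -lee_pdivlMl//.
rewrite -[X in (_ <= X * _)%E]/((m^-1)%:E) -cp -energyZ ?(ltW c0)//.
rewrite -gagliardo_powR//; apply: ereal_inf_lbound.
exists (fun x => c * v x) => //; split=> //.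
  rewrite Lp_normE// pintZ ?(ltW c0)// cp pv -EFinM mulVf ?gt_eqF//.
  by rewrite poweR_EFin powR1.
by apply: filterS v0 => x v0; rewrite mulr_ge0// ltW.
Qed.

Lemma pint_clip_lty p (M b : R) u : 1 < p -> 0 < M -> 1 <= b ->
  measurable_fun setT u -> pint p u = 1%E ->
  (\int[mu]_x (`|u x| `^ (p - 1) * clip M (u x) `^ b)%:E <=
     (b * M `^ (b - 1))%:E)%E.
Proof.
move=> p1 M0 b1 mu_ pu; have p0 : 0 < p by rewrite (lt_trans _ p1).
set L := b * M `^ (b - 1).
have L0 : 0 <= L by rewrite mulr_ge0 ?powR_ge0// (le_trans _ b1).
have f0 x : setT x -> (0 <= (`|u x| `^ p)%:E)%E by rewrite lee_fin powR_ge0.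
have mE := measurableT_comp (@EFin_measurable R setT) (measurable_powR_norm p
  mu_).
rewrite -[leRHS]mule1 -pu /pint -(ge0_integralZl_EFin _ measurableT f0 mE L0).
apply: ge0_le_integral => //.
- by move=> x _; rewrite lee_fin mulr_ge0 ?powR_ge0.
- apply/measurable_EFinP; apply: measurable_funM;
    first exact: measurable_powR_norm.
  exact: measurable_clip_powR.
- exact: measurable_funeM.
move=> x _; rewrite -EFinM lee_fin -(mulr_powRB1 (normr_ge0 (u x)) p0).
have := clip_powR_le (u x) (ltW M0) b1; rewrite -/L => h.
have -> : L * (`|u x| * `|u x| `^ (p - 1)) = `|u x| `^ (p - 1) * (L * `|u x|).
  by ring.
by rewrite ler_wpM2l// powR_ge0.
Qed.

(** Testing the minimality of [u] with [u - t (clip M u)^b] and letting [t] tend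
    to [0] replaces the weak Euler-Lagrange equation tested with
    [(clip M u)^b]. *)
Lemma minimizer_variation s p Omega u (la M th t : R) :
  1 < p -> 0 < s < 1 -> measurable Omega -> lambda1_minimizer s p Omega u ->
  lambda1 s p Omega = la%:E -> 0 < M -> 1 <= th -> 0 < t ->
  let b := p * th - p + 1 in let L := b * M `^ (b - 1) in p * t * L <= 2^-1 ->
  forall ga P : R, (energy s p (fun x => clip M (u x) `^ th)%R = ga%:E)%E ->
  (\int[mu]_x (`|u x| `^ (p - 1) * clip M (u x) `^ b)%:E = P%:E)%E ->
  (1 - p * t * L) * (b / th `^ p) * ga <= la * P.
Proof.
move=> p1 s01 mO [uadm uE] laE M0 th1 t0 b L tL ga P gaE PE.
have p0 : 0 < p by rewrite (lt_trans _ p1).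
have th0 : 0 < th by rewrite (lt_le_trans _ th1).
have pth : 0 <= p * (th - 1) by rewrite mulr_ge0 ?subr_ge0 ?(ltW p0).
have b1 : 1 <= b by rewrite /b; lra.
have b0 : 0 < b by rewrite (lt_le_trans _ b1).
have L0 : 0 <= L by rewrite mulr_ge0 ?powR_ge0 ?(ltW b0).
have [uW _ u0] := uadm; have [mu_ _ _] := uW.
have pu := admissible_pint p0 mO uadm.
have Eu : energy s p u = la%:E by rewrite -gagliardo_powR// uE laE.
have la0 : 0 <= la by rewrite -lee_fin -Eu energy_ge0.
have tL2 : t * L <= 2^-1.
  have tL0 : 0 <= t * L by rewrite mulr_ge0// ltW.
  by rewrite (le_trans _ tL)// -mulrA ler_peMl// ltW.
pose k : R := p * t * (1 - p * t * L) * (b / th `^ p).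
have k0 : 0 <= k.
  rewrite !mulr_ge0 ?(ltW p0) ?(ltW t0) ?(ltW b0) ?invr_ge0 ?powR_ge0//.
  by rewrite subr_ge0 (le_trans tL)// invf_le1// ler1n.
pose h x := x - t * clip M x `^ b.
have hE (c : R) : (fun x => c * h (u x)) =
    ((fun x => c * x + (- (c * t)) * clip M x `^ b) \o u).
  by apply/funext => x; rewrite /h /=; ring.
have mh : measurable_fun setT (h \o u).
  have -> : h \o u = ((fun x => 1 * x + (- (1 * t)) * clip M x `^ b) \o u).
    by rewrite -hE; apply/funext => x; rewrite mul1r.
  exact: measurable_comb_clip.
have mG : measurable_fun setT (fun x => clip M (u x) `^ th).
  exact: measurable_clip_powR.
have hlow x : 2^-1 * `|x| <= `|h x|.
  have := clip_powR_le x (ltW M0) b1; rewrite -/L => gL.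
  have g0 : 0 <= clip M x `^ b by exact: powR_ge0.
  have h1 : t * clip M x `^ b <= 2^-1 * `|x|.
    rewrite (le_trans (ler_wpM2l (ltW t0) gL))// mulrA ler_wpM2r//.
  have := lerB_dist x (t * clip M x `^ b).
  by rewrite [`|t * _|]ger0_norm ?mulr_ge0 ?(ltW t0)// /h; lra.
have hup x : `|h x| <= `|x|.
  have [x0|x0] := leP x 0.
    have -> : h x = x.
      rewrite /h; have -> : clip M x = 0 by rewrite /clip max_r// min_l// ltW.
      by rewrite powR0 ?gt_eqF// mulr0 subr0.
    by [].
  have := clip_powR_le x (ltW M0) b1; rewrite -/L (gtr0_norm x0) => gL.
  have g0 : 0 <= t * clip M x `^ b by rewrite mulr_ge0 ?powR_ge0 ?(ltW t0).
  have h1 : t * clip M x `^ b <= 2^-1 * x.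
    rewrite (le_trans (ler_wpM2l (ltW t0) gL))// mulrA ler_wpM2r// ltW//.
  by rewrite /h ger0_norm; lra.
(* [shrink_increment], integrated against the kernel *)
have E1 : (energy s p (h \o u) + k%:E * ga%:E <= la%:E)%E.
  rewrite -gaE -Eu !energyE//.
  have pos w z : setT z ->
      (0 <= (`|w z.1 - w z.2 : R| `^ p * @kern R N (N%:R + s * p) z)%:E)%E.
    by rewrite lee_fin mulr_ge0 ?powR_ge0 ?kern_ge0.
  have m1 := measurableT_comp (@EFin_measurable R setT) (measurable_energy s p
    mh).
  have m2 := measurableT_comp (@EFin_measurable R setT) (measurable_energy s p
    mG).
  rewrite -(ge0_integralZl_EFin _ measurableT
    (pos (fun x => clip M (u x) `^ th)) m2 k0).
  have m3 := measurable_funeM k%:E m2.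
  have pos3 z : setT z -> (0 <= k%:E * (`|clip M (u z.1) `^ th - clip M (u z.2)
    `^ th|
       `^ p * @kern R N (N%:R + s * p) z)%:E)%E.
    by move=> _; rewrite mule_ge0 ?lee_fin// mulr_ge0 ?powR_ge0 ?kern_ge0.
  rewrite -(ge0_integralD _ measurableT (pos (h \o u)) m1 pos3 m3).
  apply: ge0_le_integral => //.
  - by move=> z _; rewrite adde_ge0 ?pos ?pos3.
  - exact: emeasurable_funD m1 m3.
  - by apply/measurable_EFinP; exact: measurable_energy.
  move=> z _; rewrite -EFinM -EFinD lee_fin mulrA -mulrDl.
  apply: ler_wpM2r; first exact: kern_ge0.
  apply: (shrink_increment (u z.1) (u z.2) (ltW M0) p1 th1 (ltW t0)).
  by rewrite (le_trans tL)// invf_le1// ler1n.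
have hfin : (pint p (h \o u) <= 1)%E.
  rewrite -pu; apply: le_pint => //; first exact: ltW.
  by move=> x; exact: hup.
have [m mE] : exists m : R, pint p (h \o u) = m%:E.
  exists (fine (pint p (h \o u))); rewrite fineK// ge0_fin_numE ?pint_ge0//.
  by rewrite (le_lt_trans hfin)// ltry.
have m0 : 0 < m.
  have : (pint p (fun x => 2^-1 * u x)%R <= pint p (h \o u))%E.
    apply: le_pint => //; [exact: ltW|exact: measurable_funM|].
    by move=> x; rewrite normrM ger0_norm.
  rewrite pintZ// pu mule1 mE lee_fin; apply: lt_le_trans.
  by rewrite powR_gt0.
(* [shrink_norm], integrated *)
have E2 : 1 <= m + p * t * P.
  have pt0 : 0 <= p * t by rewrite mulr_ge0 ?(ltW p0) ?(ltW t0).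
  rewrite -lee_fin EFinD EFinM -mE -PE -pu /pint.
  have f1 x : setT x -> (0 <= (`|(h \o u) x| `^ p)%:E)%E
    by rewrite lee_fin powR_ge0.
  have f2 x : setT x -> (0 <= (`|u x| `^ (p - 1) * clip M (u x) `^ b)%:E)%E.
    by rewrite lee_fin mulr_ge0 ?powR_ge0.
  have m1 := measurableT_comp (@EFin_measurable R setT) (measurable_powR_norm p
    mh).
  have m2 : measurable_fun setT (fun x => (`|u x| `^ (p - 1) * clip M (u x) `^
    b)%:E).
    apply/measurable_EFinP; apply: measurable_funM;
      first exact: measurable_powR_norm.
    exact: measurable_clip_powR.
  rewrite -(ge0_integralZl_EFin _ measurableT f2 m2 pt0).
  have m3 := measurable_funeM (p * t)%:E m2.
  have f3 x : setT x -> (0 <= (p * t)%:E * (`|u x| `^ (p - 1) * clip M (u x) `^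
    b)%:E)%E.
    by move=> ?; rewrite mule_ge0 ?f2.
  rewrite -(ge0_integralD _ measurableT f1 m1 f3 m3).
  apply: ge0_le_integral => //.
  - by apply/measurable_EFinP; exact: measurable_powR_norm.
  - exact: emeasurable_funD m1 m3.
  move=> x _; rewrite -EFinM -EFinD lee_fin.
  exact: (shrink_norm (u x) (ltW M0) (ltW p1) b1 (ltW t0)).
(* minimality: the competitor is nonnegative since [t clip^b <= x / 2] *)
have E3 : ((la * m)%:E <= energy s p (h \o u))%E.
  rewrite EFinM -laE; apply: lambda1_le => //.
    by rewrite (hE (m `^ (- p^-1))); apply: comb_clip_W0tilde => //;
      rewrite pu ltry.
  apply: filterS u0 => x u0 /=.
  have := clip_powR_le (u x) (ltW M0) b1; rewrite -/L (ger0_norm u0) => gL.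
  have h1 : t * clip M (u x) `^ b <= 2^-1 * u x.
    rewrite (le_trans (ler_wpM2l (ltW t0) gL))// mulrA ler_wpM2r//.
  by rewrite /h; lra.
have E4 : la * m + k * ga <= la.
  rewrite -lee_fin EFinD [(k * ga)%:E]EFinM; apply: le_trans E1.
  by rewrite leeD2r.
have : k * ga <= la * (p * t * P).
  apply: (@le_trans _ _ (la - la * m)); first by lra.
  rewrite -[X in X - _]mulr1 -mulrBr ler_wpM2l//; lra.
have -> : k * ga = (p * t) * ((1 - p * t * L) * (b / th `^ p) * ga)
  by rewrite /k; ring.
have -> : la * (p * t * P) = (p * t) * (la * P) by ring.
by rewrite ler_pM2l// mulr_gt0.
Qed.

(** The limit [t -> 0] of [minimizer_variation], where [r = p t L]; the constant
    [th^p / b] is at most [th^(p-1)] because [th <= b]. *)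
Lemma caccioppoli s p Omega u (la M th : R) :
  1 < p -> 0 < s < 1 -> measurable Omega -> lambda1_minimizer s p Omega u ->
  lambda1 s p Omega = la%:E -> 0 < M -> 1 <= th ->
  (energy s p (fun x => clip M (u x) `^ th)%R <=
    (la * th `^ (p - 1))%:E * pint (p * th) (fun x => Num.max (u x) 0)%R)%E.
Proof.
move=> p1 s01 mO umin laE M0 th1.
have p0 : 0 < p by rewrite (lt_trans _ p1).
have th0 : 0 < th by rewrite (lt_le_trans _ th1).
pose b := p * th - p + 1; pose L := b * M `^ (b - 1).
have pth : 0 <= p * (th - 1) by rewrite mulr_ge0 ?subr_ge0 ?(ltW p0).
have b1 : 1 <= b by rewrite /b; lra.
have b0 : 0 < b by rewrite (lt_le_trans _ b1).
have L0 : 0 < L by rewrite mulr_gt0 ?powR_gt0.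
have [uadm uE] := umin; have [uW _ u0] := uadm; have [mu_ _ _] := uW.
have pu := admissible_pint p0 mO uadm.
have la0 : 0 <= la by rewrite -lee_fin -laE -uE poweR_ge0.
have [ga gaE] : exists ga : R, (energy s p (fun x => clip M (u x) `^ th)%R =
  ga%:E)%E.
  exists (fine (energy s p (fun x => clip M (u x) `^ th)%R)).
  rewrite fineK// ge0_fin_numE ?energy_ge0//.
  have -> : (fun x => clip M (u x) `^ th)%R =
      ((fun x => 0 * x + 1 * clip M x `^ th) \o u).
    by apply/funext => x /=; rewrite mul0r add0r mul1r.
  apply: (W0tilde_energy_lty p0 s01 mO); apply: comb_clip_W0tilde => //.
  by rewrite pu ltry.
have ga0 : 0 <= ga by rewrite -lee_fin -gaE energy_ge0.
have [P PE] : exists P : R,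
    (\int[mu]_x (`|u x| `^ (p - 1) * clip M (u x) `^ b)%:E = P%:E)%E.
  exists (fine (\int[mu]_x (`|u x| `^ (p - 1) * clip M (u x) `^ b)%:E)%E).
  rewrite fineK// ge0_fin_numE; last first.
    by apply: integral_ge0 => x _; rewrite lee_fin mulr_ge0 ?powR_ge0.
  by rewrite (le_lt_trans (pint_clip_lty p1 M0 b1 mu_ pu))// ltry.
have P0 : 0 <= P.
  by rewrite -lee_fin -PE integral_ge0// => x _;
    rewrite lee_fin mulr_ge0 ?powR_ge0.
have thp : 0 < th `^ p by rewrite powR_gt0.
pose K := b / th `^ p * ga.
have K0 : 0 <= K by rewrite mulr_ge0// divr_ge0// ltW.
have var r : 0 < r -> r <= 2^-1 -> (1 - r) * K <= la * P.
  move=> r0 r2; have t0 : 0 < r / (p * L) by rewrite divr_gt0// mulr_gt0.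
  have rE : p * (r / (p * L)) * L = r by field; rewrite !gt_eqF.
  have := @minimizer_variation s p Omega u la M th _ p1 s01 mO umin laE M0 th1
    t0.
  cbv zeta; rewrite -/b -/L rE => /(_ r2 ga P gaE PE).
  by rewrite -mulrA.
have KP : K <= la * P.
  have laP : 0 <= la * P by rewrite mulr_ge0.
  rewrite leNgt; apply/negP => PK.
  have Kp : 0 < K by rewrite (le_lt_trans laP).
  pose r := (K - la * P) / (2 * K).
  have r0 : 0 < r by rewrite divr_gt0 ?subr_gt0// mulr_gt0.
  have r2 : r <= 2^-1.
    by rewrite /r invfM mulrCA ler_piMr// ler_pdivrMr// mul1r gerBl.
  have := var r r0 r2.
  have -> : (1 - r) * K = K - (K - la * P) / 2 by rewrite /r; field;
    rewrite gt_eqF.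
  by lra.
have step1 : ga <= la * th `^ (p - 1) * P.
  have -> : ga = th `^ p / b * K by rewrite /K; field; rewrite !gt_eqF.
  apply: (@le_trans _ _ (th `^ p / b * (la * P))).
    by rewrite ler_wpM2l// divr_ge0 ?powR_ge0 ?(ltW b0).
  have -> : la * th `^ (p - 1) * P = th `^ (p - 1) * (la * P) by ring.
  rewrite ler_wpM2r ?mulr_ge0// ler_pdivrMr// -(mulr_powRB1 (ltW th0) p0) mulrC.
  rewrite ler_wpM2l ?powR_ge0// -subr_ge0.
  have -> : b - th = (p - 1) * (th - 1) by rewrite /b; ring.
  by rewrite mulr_ge0 ?subr_ge0// ltW.
rewrite gaE; apply: (@le_trans _ _ ((la * th `^ (p - 1))%:E * P%:E)%E).
  by rewrite -EFinM lee_fin.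
apply: lee_wpmul2l; first by rewrite lee_fin mulr_ge0 ?powR_ge0.
rewrite -PE; apply: ge0_le_integral => //.
- by move=> x _; rewrite lee_fin mulr_ge0 ?powR_ge0.
- apply/measurable_EFinP; apply: measurable_funM;
    first exact: measurable_powR_norm.
  exact: measurable_clip_powR.
- apply/measurable_EFinP; apply: measurable_powR_norm.
  exact: measurable_maxr.
by move=> x _; rewrite lee_fin; exact: clip_moment (ltW M0) p1 th1.
Qed.

End caccioppoli.

(** * Moser's iteration *)

Section moser.
Context (R : realType).

(** Closed form of the product of [(D th^(p-1))^(1/(p th))] over all
    [th = chi^k]. *)
Definition moser_bound (p chi D : R) : R :=
  D `^ (chi / (p * (chi - 1))) *
  chi `^ ((p - 1) / p * (chi / (chi - 1) ^+ 2)).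

(** The exponents are the closed forms of the two series
    [sum_(i < k) chi^(k-i)] and [(p - 1) sum_(i < k) i chi^(k-i)]. *)
Lemma moser_sequence (p chi D : R) (j : nat -> \bar R) : 1 < p -> 1 < chi ->
  0 < D ->
  (forall k, 0 <= j k)%E -> (j 0%N <= 1)%E ->
  (forall k, (j k < +oo)%E ->
     j k.+1 <= ((D * (chi ^+ k) `^ (p - 1))%:E * j k) `^ chi)%E ->
  forall k, (j k <= (D `^ (- (chi / (chi - 1))) *
    moser_bound p chi D `^ (p * chi ^+ k))%:E)%E.
Proof.
move=> p1 c1 D0 j0 j1 jS.
have p0 : 0 < p by rewrite (lt_trans _ p1).
have c0 : 0 < chi by rewrite (lt_trans _ c1).
have cm0 : 0 < chi - 1 by rewrite subr_gt0.
pose E k := chi / (chi - 1) * chi ^+ k - chi / (chi - 1).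
pose F k := (p - 1) * (chi / (chi - 1) ^+ 2 * chi ^+ k - k%:R * (chi / (chi -
  1))
   - chi / (chi - 1) ^+ 2).
have H k : (j k <= (D `^ E k * chi `^ F k)%:E)%E.
  elim: k => [|k IH].
    have -> : E 0%N = 0 by rewrite /E expr0 mulr1 subrr.
    have -> : F 0%N = 0 by rewrite /F expr0 mulr1 mul0r subr0 subrr mulr0.
    by rewrite !powRr0 mulr1.
  have jfin : (j k < +oo)%E by rewrite (le_lt_trans IH)// ltry.
  apply: (le_trans (jS k jfin)).
  have cc : (chi ^+ k) `^ (p - 1) = chi `^ (k%:R * (p - 1)).
    by rewrite -powR_mulrn ?(ltW c0)// -powRrM.
  have a0 : 0 <= D * (chi ^+ k) `^ (p - 1)
    by rewrite mulr_ge0 ?powR_ge0 ?(ltW D0).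
  apply: (@le_trans _ _ (((D * (chi ^+ k) `^ (p - 1))%:E *
      (D `^ E k * chi `^ F k)%:E) `^ chi)%E).
    apply: gt0_ler_poweR; rewrite ?(ltW c0)//.
    - by rewrite in_itv/= leey andbT mule_ge0.
    - by rewrite in_itv/= leey andbT mule_ge0// lee_fin mulr_ge0 ?powR_ge0.
    - by apply: lee_wpmul2l; rewrite ?lee_fin.
  rewrite -EFinM poweR_EFin lee_fin cc.
  have -> : D * chi `^ (k%:R * (p - 1)) * (D `^ E k * chi `^ F k) =
      D `^ (1 + E k) * chi `^ (k%:R * (p - 1) + F k).
    by rewrite !powRD_gt0// powRr1 ?(ltW D0)//; ring.
  rewrite powRM ?powR_ge0// -!powRrM.
  have -> : (1 + E k) * chi = E k.+1.
    by rewrite /E exprS; field; rewrite gt_eqF.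
  have -> : (k%:R * (p - 1) + F k) * chi = F k.+1.
    by rewrite /F [chi ^+ k.+1]exprS -[k.+1%:R]natr1; field; rewrite gt_eqF.
  by [].
move=> k; apply: (le_trans (H k)); rewrite lee_fin /moser_bound.
rewrite powRM ?powR_ge0// -!powRrM mulrA -powRD_gt0//.
have -> : - (chi / (chi - 1)) + chi / (p * (chi - 1)) * (p * chi ^+ k) = E k.
  by rewrite /E; field; rewrite !gt_eqF.
rewrite ler_wpM2l ?powR_ge0// ler_powR ?(ltW c1)//.
have -> : (p - 1) / p * (chi / (chi - 1) ^+ 2) * (p * chi ^+ k) =
    (p - 1) * (chi / (chi - 1) ^+ 2 * chi ^+ k).
  by field; rewrite !gt_eqF.
rewrite /F ler_wpM2l ?subr_ge0 ?(ltW p1)// -addrA gerDl.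
rewrite -opprD oppr_le0 addr_ge0 ?mulr_ge0 ?invr_ge0 ?exprn_ge0 ?(ltW c0) ?(ltW
  cm0)//.
Qed.

Lemma geometric_null (x A r : R) : 0 <= r < 1 ->
  (forall k : nat, (0 < k)%N -> x <= A * r ^+ k) -> x <= 0.
Proof.
move=> /andP[r0 r1] xk.
have : A * r ^+ k @[k --> \oo] --> 0.
  by apply: cvg_geometric; rewrite ger0_norm.
move=> /cvgr_to_ge; apply; exists 1%N => // k /= k0; exact: xk.
Qed.

Context (N : nat).
Local Notation mu := (@lebesgue_row R N).

Lemma chebyshev_pint (q K : R) (w : 'rV[R]_N -> R) : 0 < q -> 0 < K ->
  measurable_fun setT w ->
  ((K `^ q)%:E * mu [set x | (K <= `|w x|)%R] <= pint q w)%E.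
Proof.
move=> q0 K0 mw.
have mwq := measurableT_comp (@EFin_measurable R setT) (measurable_powR_norm q
  mw).
have := @le_integral_abse _ _ R mu setT measurableT _ _ mwq (powR_gt0 q K0).
under [X in (_ <= X)%E -> _]eq_integral do rewrite /= ger0_norm ?powR_ge0//.
apply: le_trans; apply: lee_wpmul2l; first by rewrite lee_fin powR_ge0.
apply: le_measure; rewrite ?inE//.
- rewrite -[X in measurable X]setTI; apply: measurable_fun_ler => //.
  exact: measurable_fun_norm.
- rewrite setTI -[X in measurable X]setTI; apply: emeasurable_fun_c_infty => //.
  exact: (@measurableT_comp _ _ _ _ _ _ abse).
move=> y /= ay; split=> //=; rewrite lee_fin ger0_norm ?powR_ge0//.
by apply: ge0_ler_powR; rewrite ?nnegrE ?(ltW q0) ?(ltW K0).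
Qed.

(** The L^q norms along [q = p chi^k] being bounded by [moser_bound] up to a
    factor [A^(1/q)], Chebyshev's inequality makes larger values negligible. *)
Lemma moser (p chi D : R) (w : 'rV[R]_N -> R) : 1 < p -> 1 < chi -> 0 < D ->
  measurable_fun setT w -> (pint p w <= 1)%E ->
  (forall th : R, (1 <= th)%R -> (pint (p * th) w < +oo)%E ->
    pint (p * th * chi) w <= ((D * th `^ (p - 1))%:E * pint (p * th) w) `^
      chi)%E ->
  (ess_sup mu (fun x => `|w x|%:E) <= (moser_bound p chi D)%:E)%E.
Proof.
move=> p1 c1 D0 mw w1 wS.
have p0 : 0 < p by rewrite (lt_trans _ p1).
have c0 : 0 < chi by rewrite (lt_trans _ c1).
set B := moser_bound p chi D.
have B0 : 0 < B by rewrite mulr_gt0 ?powR_gt0.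
set A := D `^ (- (chi / (chi - 1))).
have A0 : 0 < A by rewrite powR_gt0.
have jk : forall k, (pint (p * chi ^+ k) w <= (A * B `^ (p * chi ^+ k))%:E)%E.
  apply: (moser_sequence p1 c1 D0) => [k||k jfin].
  - exact: pint_ge0.
  - by rewrite expr0 mulr1.
  rewrite exprSr mulrA; apply: wS => //.
  by rewrite exprn_ege1// ltW.
apply/lee_addgt0Pr => e e0; rewrite -EFinD; apply/ess_supP.
set K := B + e; have K0 : 0 < K by rewrite addr_gt0.
have mK : measurable [set x | (K <= `|w x|)%R].
  rewrite -[X in measurable X]setTI; apply: measurable_fun_ler => //.
  exact: measurable_fun_norm.
suff mu0 : mu [set x | (K <= `|w x|)%R] = 0%E.
  exists [set x | (K <= `|w x|)%R]; split=> //.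
  by move=> x /= /negP; rewrite lee_fin -ltNge => /ltW.
(* [chi^k >= k (chi - 1)] turns the bound into a geometric sequence *)
pose r := (B / K) `^ (p * (chi - 1)).
have BK0 : 0 < B / K by rewrite divr_gt0.
have BK1 : B / K < 1 by rewrite ltr_pdivrMr// mul1r ltrDl.
have pc0 : 0 < p * (chi - 1) by rewrite mulr_gt0// subr_gt0.
have r01 : 0 <= r < 1.
  rewrite powR_ge0 /=; have one : 1 `^ (p * (chi - 1)) = 1 :> R
    by rewrite powR1.
  by rewrite -[ltRHS]one; apply: gt0_ltr_powR; rewrite ?nnegrE ?(ltW BK0).
have mur k : (0 < k)%N -> (mu [set x | (K <= `|w x|)%R] <= (A * r ^+ k)%:E)%E.
  move=> k0; have q0 : 0 < p * chi ^+ k by rewrite mulr_gt0 ?exprn_gt0.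
  have Kq : 0 < K `^ (p * chi ^+ k) by rewrite powR_gt0.
  have := le_trans (chebyshev_pint q0 K0 mw) (jk k).
  rewrite muleC -lee_pdivlMr// -EFinM => /le_trans; apply; rewrite lee_fin.
  rewrite -mulrA ler_wpM2l ?(ltW A0)//.
  have -> : B `^ (p * chi ^+ k) / K `^ (p * chi ^+ k) = (B / K) `^ (p * chi ^+
    k).
    rewrite powRM ?invr_ge0 ?(ltW B0) ?(ltW K0)//; congr (_ * _).
    by rewrite -powRN -[K^-1]powR_inv1 ?(ltW K0)// -powRrM mulN1r.
  have -> : r ^+ k = (B / K) `^ (p * (chi - 1) * k%:R).
    by rewrite -powR_mulrn ?powR_ge0// /r -powRrM.
  apply: ger_powR; first by rewrite BK0 ltW.
  rewrite -mulrA ler_pM2l//.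
  have k1 : 1 <= k%:R :> R by rewrite ler1n.
  have := powR_tangent ler01 (ltW c0) k1.
  by rewrite !powR1 mulr1 powR_mulrn ?(ltW c0)// mulrC; lra.
have mufin : mu [set x | (K <= `|w x|)%R] \is a fin_num.
  by rewrite ge0_fin_numE// (le_lt_trans (mur 1%N isT))// ltry.
apply/eqP; rewrite eq_le measure_ge0 andbT -(fineK mufin) lee_fin.
apply: (@geometric_null _ A r r01) => k k0.
by rewrite -lee_fin (fineK mufin) mur.
Qed.

End moser.

(** * The Sobolev quotient *)

Section fatou_bound.
Context d (T : measurableType d) (R : realType) (m : {measure set T -> \bar R}).

Lemma limn_einf_le (v : (\bar R)^nat) (y : \bar R) :
  (forall k, v k <= y)%E -> (limn_einf v <= y)%E.
Proof.
move=> vy; rewrite limn_einf_lim; apply: lime_le; first exact: is_cvg_einfs.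
apply: nearW => k; apply: le_trans (vy k); apply: ereal_inf_lbound.
by exists k => //=.
Qed.

Lemma fatou_le (f : nat -> T -> R) (g : T -> R) (y : \bar R) :
  (forall k, measurable_fun setT (f k)) -> measurable_fun setT g ->
  (forall k x, 0 <= f k x) -> (forall x, 0 <= g x) ->
  {ae m, forall x, f k x @[k --> \oo] --> g x} ->
  (forall k, \int[m]_x (f k x)%:E <= y)%E -> (\int[m]_x (g x)%:E <= y)%E.
Proof.
move=> mf mg f0 g0 fg fy.
have mfE k : measurable_fun setT (fun x => (f k x)%:E)
  by apply/measurable_EFinP.
have f0E k x : setT x -> (0 <= (f k x)%:E)%E by rewrite lee_fin.
have fat := fatou m measurableT mfE f0E.
have minf : measurable_fun setT (fun x => limn_einf (fun k => (f k x)%:E)).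
  apply: (measurableT_comp (@oppe_measurable R setT)).
  apply: measurable_fun_limn_esup => k.
  exact: (measurableT_comp (@oppe_measurable R setT)).
have inf0 x : (0 <= limn_einf (fun k => (f k x)%:E))%E.
  rewrite limn_einf_lim; apply: lime_ge; first exact: is_cvg_einfs.
  by apply: nearW => k; apply: le_ereal_inf_tmp => _ [n _ <-]; rewrite lee_fin.
have -> : (\int[m]_x (g x)%:E = \int[m]_x limn_einf (fun k => (f k x)%:E))%E.
  apply: ge0_ae_eq_integral => //.
  - by apply/measurable_EFinP.
  - by move=> x _; rewrite lee_fin.
  apply: filterS fg => x fgx _.
  have h : (f k x)%:E @[k --> \oo] --> (g x)%:E.
    by apply: cvg_EFin => //; exact: nearW.
  by have [-> _] := cvg_limn_einf_sup h.
by apply: (le_trans fat); exact: limn_einf_le.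
Qed.

End fatou_bound.

Section sobolev_quotient.
Context (R : realType) (N : nat).
Local Notation mu := (@lebesgue_row R N).
Implicit Types (Omega : set 'rV[R]_N) (u v : 'rV[R]_N -> R) (s p q : R).

Lemma pint_bounded_lty q (M : R) (A : set 'rV[R]_N) v : 0 < q -> 0 <= M ->
  measurable A -> (mu A < +oo)%E -> measurable_fun setT v ->
  (forall x, `|v x| <= M) -> {ae mu, forall x, ~ A x -> v x = 0} ->
  (pint q v < +oo)%E.
Proof.
move=> q0 M0 mA muA mv vM v0.
have f0 x : setT x -> (0 <= (\1_A x : R)%:E)%E by rewrite lee_fin.
have mi : measurable_fun setT (fun x => (\1_A x : R)%:E).
  by apply/measurable_EFinP; exact: measurable_indic.
apply: (@le_lt_trans _ _ (\int[mu]_x ((M `^ q)%:E * (\1_A x : R)%:E))%E).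
  apply: ae_ge0_le_integral => //.
  - by apply/measurable_EFinP; exact: measurable_powR_norm.
  - by move=> x _; rewrite mule_ge0 ?f0 ?lee_fin ?powR_ge0.
  - exact: measurable_funeM.
  apply: filterS v0 => x v0 _; rewrite -EFinM lee_fin indicE.
  have [Ax|Ax] := boolP (x \in A).
    by rewrite mulr1; apply: ge0_ler_powR; rewrite ?nnegrE ?(ltW q0).
  by rewrite v0 ?normr0 ?powR0 ?gt_eqF// ?mulr0// => /mem_set; apply/negP.
rewrite (ge0_integralZl_EFin _ measurableT f0 mi (powR_ge0 M q))
  integral_indic//.
by rewrite setIT; apply: lte_mul_pinfty => //; rewrite lee_fin powR_ge0.
Qed.

Lemma pint_eq0 q v : 0 < q -> measurable_fun setT v -> pint q v = 0%E ->
  {ae mu, forall x, v x = 0}.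
Proof.
move=> q0 mv pv.
have mE := measurableT_comp (@EFin_measurable R setT) (measurable_powR_norm q
  mv).
have : (\int[mu]_x `|(EFin \o (fun x => `|v x| `^ q)%R) x| = 0)%E.
  by rewrite -pv; apply: eq_integral => x _;
    rewrite gee0_abs ?lee_fin ?powR_ge0.
move=> /(ae_eq_integral_abs mu measurableT mE);
  apply: filterS => x /(_ I) /= [] h.
by apply/normr0_eq0; exact: powR_eq0_eq0 h.
Qed.

Lemma test_function_pint_lty q Omega phi : 0 < q -> test_function Omega phi ->
  (pint q phi < +oo)%E.
Proof.
move=> q0 tphi; have mphi := measurable_test_function tphi.
have [sphi cK _] := tphi; set K := closure _ in cK.
have phi0 x : ~ K x -> phi x = 0 by exact: closure_support_out.
have [M M0 phiM] := compact_support_bounded cK (sphi 0%N).1 phi0.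
have [r r0 Kr] := bounded_sub_cube (compact_bounded cK).
apply: (@pint_bounded_lty q M (cube 0 r)) => //.
- exact: measurable_cube.
- by rewrite lebesgue_cube// ltry.
- by apply: aeW => x nx; apply: phi0; apply: contra_not nx => /Kr.
Qed.

(** The Sobolev inequality passes to the limits of test functions by Fatou's
    lemma. *)
Lemma sobolev_W0 s p : 1 < p -> 0 < s -> s * p < N%:R ->
  exists2 C : R, 0 < C & forall v, W0 s p v ->
    (pint (N%:R * p / (N%:R - s * p)) v `^ ((N%:R - s * p) / N%:R) <=
      C%:E * energy s p v)%E.
Proof.
move=> p1 s0 spN; have p0 : 0 < p by rewrite (lt_trans _ p1).
have sp0 : 0 < s * p by rewrite mulr_gt0.
have NR0 : 0 < N%:R :> R by rewrite (lt_trans sp0).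
have N0 : (0 < N)%N by rewrite -(ltr0n R).
have d0 : 0 < N%:R - s * p by rewrite subr_gt0.
set q := N%:R * p / (N%:R - s * p).
have q0 : 0 < q by rewrite divr_gt0// mulr_gt0.
have t0 : 0 <= s * p / N%:R <= s * p / N%:R by rewrite lexx andbT divr_ge0 ?ltW.
have qt : q * (1 - s * p / N%:R) = p.
  by rewrite /q; field; rewrite !gt_eqF.
have tE : (N%:R - s * p) / N%:R = 1 - s * p / N%:R by field; rewrite gt_eqF.
rewrite tE.
have e0 : 0 < 1 - s * p / N%:R by rewrite -tE divr_gt0.
have [C C0 CP] := sobolev N0 p0 (ltW s0) q0 t0 qt ltr01.
exists (C * 2 `^ p); first by rewrite mulr_gt0// powR_gt0.
move=> v [mv [phi [tphi Gphi phiv]]].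
have [Ev|Ev] := eqVneq (energy s p v) +oo%E.
  by rewrite Ev gt0_muley ?leey// lte_fin mulr_gt0// powR_gt0.
have Evfin : energy s p v \is a fin_num.
  by rewrite ge0_fin_numE ?energy_ge0// ltey.
have mphi k := measurable_test_function (tphi k).
apply/lee_addgt0Pr => e ee.
(* far enough in the sequence, [energy (phi k - v)] is below [e'] *)
pose e' := e / (C * 2 `^ p).
have Cp0 : 0 < C * 2 `^ p by rewrite mulr_gt0// powR_gt0.
have e'0 : 0 < e' by rewrite divr_gt0.
have [K _ KP] := ereal_cvg0_lt Gphi (powR_gt0 p^-1 e'0).
have Ek k : (energy s p (phi (k + K)%N) <= (2 `^ p)%:E * (e'%:E + energy s p
  v))%E.
  have -> : phi (k + K)%N = ((phi (k + K)%N \- v) \+ v)%R.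
    by apply/funext => x /=; rewrite subrK.
  apply: le_trans (energyD s p0 (measurable_funB (mphi _) mv) mv) _.
  apply: lee_wpmul2l; first by rewrite lee_fin powR_ge0.
  rewrite leeD2r// -gagliardo_powR//.
  have -> : (e'%:E = ((e' `^ p^-1)%:E) `^ p)%E.
    by rewrite poweR_EFin -powRrM mulVf ?gt_eqF// powRr1// ltW.
  apply: gt0_ler_poweR; rewrite ?(ltW p0)//.
  - by rewrite in_itv/= poweR_ge0 leey.
  - by rewrite in_itv/= lee_fin powR_ge0 leey.
  - by apply/ltW/KP; rewrite /= leq_addl.
pose Y := (((C * 2 `^ p)%:E * (e'%:E + energy s p v)) `^ (1 - s * p /
  N%:R)^-1)%E.
have Z0 : (0 <= (C * 2 `^ p)%:E * (e'%:E + energy s p v))%E.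
  apply: mule_ge0; first by rewrite lee_fin ltW.
  by rewrite adde_ge0 ?energy_ge0 ?lee_fin ?(ltW e'0).
have Xk k : (\int[mu]_x (`|phi (k + K)%N x| `^ q)%:E <= Y)%E.
  have fin := test_function_pint_lty q0 (tphi (k + K)%N).
  have := CP _ (mphi (k + K)%N) (or_introl erefl) fin.
  have C0' : (0 <= C%:E)%E by rewrite lee_fin ltW.
  move=> /le_trans - /(_ _ (lee_wpmul2l C0' (Ek k))).
  rewrite muleA -EFinM => h.
  have -> : (\int[mu]_x (`|phi (k + K)%N x| `^ q)%:E =
     (pint q (phi (k + K)%N) `^ (1 - s * p / N%:R)) `^ (1 - s * p / N%:R)^-1)%E.
    by rewrite -poweRrM mulfV ?gt_eqF// poweRe1// pint_ge0.
  apply: gt0_ler_poweR => //.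
  - by rewrite invr_ge0 ltW.
  - by rewrite in_itv/= poweR_ge0 leey.
  - by rewrite in_itv/= Z0 leey.
have Xv : (pint q v <= Y)%E.
  apply: (@fatou_le _ _ _ mu (fun k x => `|phi (k + K)%N x| `^ q)) => //.
  - by move=> k; exact: measurable_powR_norm.
  - exact: measurable_powR_norm.
  apply: filterS phiv => x phiv.
  have h : phi (k + K)%N x @[k --> \oo] --> v x.
    by move: phiv; rewrite -(cvg_shiftn K).
  exact: cvg_powR_norm_lim h.
apply: (@le_trans _ _ (Y `^ (1 - s * p / N%:R))%E).
  apply: gt0_ler_poweR => //; first exact: ltW.
  - by rewrite in_itv/= pint_ge0 leey.
  - by rewrite in_itv/= poweR_ge0 leey.
rewrite /Y -poweRrM mulVf ?gt_eqF// poweRe1//.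
rewrite muleDr// ?fin_num_adde_defr// addeC leeD2l//.
by rewrite -EFinM lee_fin /e' mulrC divfK// gt_eqF.
Qed.

Lemma sobolev_sup_lty s p : 1 < p -> 0 < s -> s * p < N%:R ->
  (sobolev_sup N s p < +oo)%E.
Proof.
move=> p1 s0 spN; have [C C0 CP] := sobolev_W0 p1 s0 spN.
have p0 : 0 < p by rewrite (lt_trans _ p1).
have sp0 : 0 < s * p by rewrite mulr_gt0.
have NR0 : 0 < N%:R :> R by rewrite (lt_trans sp0).
have d0 : 0 < N%:R - s * p by rewrite subr_gt0.
apply: (@le_lt_trans _ _ C%:E); last exact: ltry.
apply: ge_ereal_sup => _ [v [vW v0] <-]; rewrite /sobolev_quotient
  gagliardo_powR//.
have := CP v vW; rewrite /pint; set X := (_ `^ _)%E => XE.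
have [Ey|Ey] := eqVneq (energy s p v) +oo%E.
  by rewrite Ey invey mule0 lee_fin ltW.
have [E0|E0] := eqVneq (energy s p v) 0%E.
  exfalso; apply: v0; have [mv _] := vW.
  apply: (@pint_eq0 (N%:R * p / (N%:R - s * p))) => //.
    by rewrite divr_gt0// mulr_gt0.
  rewrite E0 mule0 in XE.
  apply: (@poweR_eq0_eq0 _ _ ((N%:R - s * p) / N%:R)); first exact: pint_ge0.
  by apply/eqP; rewrite eq_le XE poweR_ge0.
have Efin : energy s p v \is a fin_num by rewrite ge0_fin_numE ?energy_ge0//
  ltey.
move: XE E0; rewrite -(fineK Efin) eqe => XE E0.
have e0 : 0 < fine (energy s p v).
  by rewrite lt_neqAle eq_sym E0 fine_ge0// energy_ge0.
by rewrite inver (negbTE E0) lee_pdivrMr.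
Qed.

(** The quotient gives the bound when [energy s p v] is positive; otherwise
    [sobolev_W0] already makes the left side vanish. *)
Lemma sobolev_sup_ineq s p v : 1 < p -> 0 < s -> s * p < N%:R -> W0 s p v ->
  (0 <= sobolev_sup N s p)%E -> (energy s p v < +oo)%E ->
  (pint (N%:R * p / (N%:R - s * p)) v `^ ((N%:R - s * p) / N%:R) <=
      sobolev_sup N s p * energy s p v)%E.
Proof.
move=> p1 s0 spN vW T0 Elty; have [C C0 CP] := sobolev_W0 p1 s0 spN.
have p0 : 0 < p by rewrite (lt_trans _ p1).
have XE := CP v vW.
have [E0|E0] := eqVneq (energy s p v) 0%E.
  by move: XE; rewrite E0 !mule0.
have Efin : energy s p v \is a fin_num by rewrite ge0_fin_numE ?energy_ge0.
have e0 : 0 < fine (energy s p v).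
  by rewrite lt_neqAle eq_sym fine_eq0// E0 fine_ge0// energy_ge0.
have sp0 : 0 < s * p by rewrite mulr_gt0.
have NR0 : 0 < N%:R :> R by rewrite (lt_trans sp0).
have d0 : 0 < N%:R - s * p by rewrite subr_gt0.
have q0 : 0 < N%:R * p / (N%:R - s * p) by rewrite divr_gt0// mulr_gt0.
have [v0|v0] := pselect {ae mu, forall x, v x = 0}.
  have : pint (N%:R * p / (N%:R - s * p)) v = 0%E.
    have [mv _] := vW; rewrite -(@integral0 _ _ _ mu setT).
    apply: ae_eq_integral => //.
      by apply/measurable_EFinP; exact: measurable_powR_norm.
    by apply: filterS v0 => x v0 _; rewrite v0 normr0 powR0// gt_eqF.
  move=> ->; rewrite poweR0r; last by rewrite gt_eqF// divr_gt0.
  by rewrite mule_ge0 ?energy_ge0.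
have : (sobolev_quotient s p v <= sobolev_sup N s p)%E.
  by apply: ereal_sup_ubound; exists v.
rewrite /sobolev_quotient gagliardo_powR// -(fineK Efin) inver gt_eqF//.
by rewrite lee_pdivrMr.
Qed.

End sobolev_quotient.

(** * Boundedness of the minimizers *)

Section boundedness.
Context (R : realType) (N : nat).
Local Notation mu := (@lebesgue_row R N).
Implicit Types (Omega : set 'rV[R]_N) (u v : 'rV[R]_N -> R) (s p q : R).

Lemma bounded_measure_lty Omega : bounded_set Omega -> measurable Omega ->
  exists2 V : R, 0 < V & (mu Omega <= V%:E)%E.
Proof.
move=> bO mO; have [r r0 Or] := bounded_sub_cube bO.
exists ((2 * r) ^+ N); first by rewrite exprn_gt0// mulr_gt0.
rewrite -(lebesgue_cube (0 : 'rV[R]_N) r0).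
by apply: le_measure; rewrite ?inE//; exact: measurable_cube.
Qed.

Lemma clip_pint_lty s p q Omega u (M th : R) : 0 < q -> 0 < M -> 1 <= th ->
  measurable Omega -> (mu Omega < +oo)%E -> W0tilde s p Omega u ->
  (pint q (fun x => clip M (u x) `^ th)%R < +oo)%E.
Proof.
move=> q0 M0 th1 mO muO [mu_ u0 _].
have th0 : 0 < th by rewrite (lt_le_trans _ th1).
apply: (@pint_bounded_lty _ _ q (M `^ th) Omega) => //.
- exact: powR_ge0.
- exact: measurable_clip_powR.
- move=> x; rewrite ger0_norm ?powR_ge0//.
  have /andP[c0 cM] := clip_itv (u x) (ltW M0).
  by apply: ge0_ler_powR; rewrite ?nnegrE ?(ltW th0) ?(ltW M0).
- apply: filterS u0 => x u0 nO; rewrite u0// clip0 ?(ltW M0)// powR0//.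
  by rewrite gt_eqF.
Qed.

Lemma poweR_inv_le (x y : \bar R) (a : R) : 0 < a -> (0 <= x)%E -> (0 <= y)%E ->
  (x `^ a^-1 <= y)%E -> (x <= y `^ a)%E.
Proof.
move=> a0 x0 y0 xy; have -> : x = ((x `^ a^-1) `^ a)%E.
  by rewrite -poweRrM mulVf ?gt_eqF// poweRe1.
apply: gt0_ler_poweR; rewrite ?(ltW a0)//.
- by rewrite in_itv/= poweR_ge0 leey.
- by rewrite in_itv/= y0 leey.
Qed.

(** One step of the iteration: the Sobolev and the Caccioppoli inequalities for
    [(clip M u)^th], in which [M] tends to infinity. *)
Lemma moser_step s p chi (C la D : R) Omega u : 1 < p -> 0 < s < 1 ->
  measurable Omega -> lambda1_minimizer s p Omega u ->
  lambda1 s p Omega = la%:E -> 1 < chi -> 0 <= C -> C * la <= D ->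
  (forall M th : R, 0 < M -> 1 <= th ->
    (pint (p * chi) (fun x => clip M (u x) `^ th)%R `^ chi^-1 <=
      C%:E * energy s p (fun x => clip M (u x) `^ th)%R)%E) ->
  forall th : R, 1 <= th ->
  (pint (p * th * chi) (fun x => Num.max (u x) 0)%R <=
    ((D * th `^ (p - 1))%:E * pint (p * th) (fun x => Num.max (u x) 0)%R) `^
      chi)%E.
Proof.
move=> p1 s01 mO umin laE c1 C0 CD sob th th1.
have p0 : 0 < p by rewrite (lt_trans _ p1).
have c0 : 0 < chi by rewrite (lt_trans _ c1).
have th0 : 0 < th by rewrite (lt_le_trans _ th1).
have [[uW _ _] uE] := umin; have [mu_ _ _] := uW.
have la0 : 0 <= la by rewrite -lee_fin -laE -uE poweR_ge0.
have D0 : 0 <= D by rewrite (le_trans _ CD)// mulr_ge0.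
set P := pint (p * th) _.
have P0 : (0 <= P)%E by exact: pint_ge0.
apply: (@fatou_le _ _ _ mu
  (fun k x => `|clip k.+1%:R (u x) `^ th| `^ (p * chi))).
- by move=> k; apply: measurable_powR_norm; exact: measurable_clip_powR.
- by apply: measurable_powR_norm; exact: measurable_maxr.
- by move=> k x; exact: powR_ge0.
- by move=> x; exact: powR_ge0.
- (* the truncation is inactive once [k] exceeds [u x] *)
  apply: aeW => x; apply: cvg_near_cst; near=> k.
  have m0 : 0 <= Num.max (u x) 0 by rewrite le_max lexx orbT.
  have -> : clip k.+1%:R (u x) = Num.max (u x) 0.
    rewrite /clip min_l//.
    have : Num.max (u x) 0 <= k%:R by near: k; exact: nbhs_infty_ger.
    by move=> /le_trans; apply; rewrite ler_nat.
  rewrite ger0_norm ?powR_ge0// (ger0_norm m0) -powRrM.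
  by congr (_ `^ _); ring.
move=> k; have k0 : 0 < k.+1%:R :> R by [].
have DP0 : (0 <= (D * th `^ (p - 1))%:E * P)%E.
  by rewrite mule_ge0// lee_fin mulr_ge0 ?powR_ge0.
apply: (poweR_inv_le c0 (pint_ge0 _ _) DP0).
apply: (le_trans (sob _ _ k0 th1)).
apply: (@le_trans _ _ (C%:E * ((la * th `^ (p - 1))%:E * P))%E).
  apply: lee_wpmul2l; first by rewrite lee_fin.
  exact: (caccioppoli p1 s01 mO umin laE k0 th1).
rewrite muleA -EFinM; apply: lee_wpmul2r => //.
by rewrite lee_fin mulrA ler_wpM2r ?powR_ge0.
Unshelve. all: by end_near. Qed.

Lemma minimizer_ess_sup s p chi (C la D : R) Omega u : 1 < p -> 0 < s < 1 ->
  measurable Omega -> lambda1_minimizer s p Omega u ->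
  lambda1 s p Omega = la%:E -> 1 < chi -> 0 <= C -> 0 < D -> C * la <= D ->
  (forall M th : R, 0 < M -> 1 <= th ->
    (pint (p * chi) (fun x => clip M (u x) `^ th)%R `^ chi^-1 <=
      C%:E * energy s p (fun x => clip M (u x) `^ th)%R)%E) ->
  (ess_sup mu (fun x => `|u x|%:E) <= (moser_bound p chi D)%:E)%E.
Proof.
move=> p1 s01 mO umin laE c1 C0 D0 CD sob.
have p0 : 0 < p by rewrite (lt_trans _ p1).
have [uadm _] := umin; have [uW _ u0] := uadm; have [mu_ _ _] := uW.
have mup : measurable_fun setT (fun x => Num.max (u x) 0)
  by exact: measurable_maxr.
have step := moser_step p1 s01 mO umin laE c1 C0 CD sob.
have := @moser R N p chi D _ p1 c1 D0 mup _ (fun th th1 _ => step th th1).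
move=> /(_ _)/(le_trans _); apply; last first.
  rewrite -(admissible_pint p0 mO uadm); apply: le_pint => //; first exact: ltW.
  move=> x; have [ux|ux] := leP (u x) 0; last by [].
  by rewrite normr0.
apply: le_ess_sup; apply: filterS u0 => x u0.
by rewrite lee_fin max_l.
Qed.

Lemma Lnorm_oo_le Omega u (B : \bar R) :
  (ess_sup mu (fun x => `|u x|%:E) <= B)%E ->
  (Lp_norm +oo Omega u <= B)%E /\ ('N[mu]_+oo[EFin \o u] <= B)%E.
Proof.
move=> uB; rewrite /Lp_norm unlock lebesgue_row_setT_gt0; split; last exact: uB.
apply: le_trans uB; apply: le_ess_sup; apply: aeW => x /=.
by rewrite /patch; case: ifPn => //= _; rewrite lee_fin normr0.
Qed.

Lemma Lfun_oo u (B : R) : measurable_fun setT u ->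
  (ess_sup mu (fun x => `|u x|%:E) <= B%:E)%E -> u \in Lfun mu +oo%E.
Proof.
move=> mu_ uB; have [_ uN] := Lnorm_oo_le set0 uB.
apply/andP; split; rewrite inE//=.
by rewrite /finite_norm (le_lt_trans uN)// ltry.
Qed.

Lemma lambda1_fin s p Omega u : 1 < p -> 0 < s < 1 -> measurable Omega ->
  lambda1_minimizer s p Omega u ->
  exists la : R, lambda1 s p Omega = la%:E /\ energy s p u = la%:E.
Proof.
move=> p1 s01 mO [uadm uE]; have p0 : 0 < p by rewrite (lt_trans _ p1).
have [uW _ _] := uadm.
exists (fine (energy s p u)); rewrite -uE gagliardo_powR// fineK//.
by rewrite ge0_fin_numE ?energy_ge0// (W0tilde_energy_lty p0 s01 mO uW).
Qed.

(** In the limiting case [sp = N], the Sobolev inequality with an exponent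
    [t = 1/2 < sp/N] is available because [Omega] has finite measure. *)
Lemma bounded_critical s p Omega u : 1 < p -> 0 < s < 1 -> s * p = N%:R ->
  (0 < N)%N -> bounded_set Omega -> measurable Omega ->
  lambda1_minimizer s p Omega u -> u \in Lfun mu +oo%E.
Proof.
move=> p1 s01 spN N0 bO mO umin; have p0 : 0 < p by rewrite (lt_trans _ p1).
have NR0 : 0 < N%:R :> R by rewrite ltr0n.
have [s0 _] := andP s01.
have [la [laE Eu]] := lambda1_fin p1 s01 mO umin.
have la0 : 0 <= la by rewrite -lee_fin -Eu energy_ge0.
have [uadm _] := umin; have [uW _ _] := uadm; have [mu_ u0 _] := uW.
have [V V0 muV] := bounded_measure_lty bO mO.
have muO : (mu Omega < +oo)%E by rewrite (le_lt_trans muV)// ltry.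
have q0 : 0 < p * 2 by rewrite mulr_gt0.
have t01 : 0 <= (2^-1 : R) <= s * p / N%:R.
  by rewrite spN divff ?gt_eqF//; apply/andP; split;
    [rewrite invr_ge0|rewrite invf_le1 ?ler1n].
have qt : p * 2 * (1 - 2^-1) = p by field.
have [C C0 CP] := sobolev N0 p0 (ltW s0) q0 t01 qt V0.
have D0 : 0 < C * (la + 1) by rewrite mulr_gt0// ltr_wpDl.
apply: (@Lfun_oo _ (moser_bound p 2 (C * (la + 1)))) => //.
apply: (minimizer_ess_sup p1 s01 mO umin laE _ (ltW C0) D0) => [||M th M0 th1].
- by rewrite ltr1n.
- by rewrite ler_pM2l// lerDl.
have th0 : 0 < th by rewrite (lt_le_trans _ th1).
have mclip := measurable_clip_powR M th mu_.
have -> : 2^-1 = 1 - 2^-1 :> R by field.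
apply: CP => //; last exact: clip_pint_lty uW.
right; have [A [mA A0 AP]] := u0.
apply: (@le_trans _ _ (mu (Omega `|` A))).
  apply: le_measure; rewrite ?inE; last 2 first.
  - exact: measurableU.
  - move=> x /= fx; apply: contrapT => /not_orP[nO nA].
    apply: nA; apply: AP => /= /(_ nO) ux; move: fx.
    by rewrite ux clip0 ?(ltW M0)// powR0 ?eqxx// gt_eqF.
  rewrite [X in measurable X](_ : _ = setT `&` (fun x => clip M (u x) `^ th)
    @^-1` (~` [set 0])).
    by apply: mclip => //; exact: measurableC.
  by apply/seteqP; split=> [z /= /eqP|z [_ /= /eqP]].
apply: (le_trans (measureU2 mu mO mA)).
by rewrite [X in (_ + X)%E]A0 adde0.
Qed.

Lemma comb_clip_W0 s p Omega u : 1 < p -> 0 < s < 1 ->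
  measurable Omega -> lambda_admissible s p Omega u -> forall c1 c2 M b : R,
  0 < M -> 1 <= b -> W0 s p ((fun x => c1 * x + c2 * clip M x `^ b) \o u).
Proof.
move=> p1 s01 mO uadm c1 c2 M b M0 b1; have p0 : 0 < p
  by rewrite (lt_trans _ p1).
have [uW _ _] := uadm; have [mu_ _ _] := uW.
have pu : (pint p u < +oo)%E by rewrite (admissible_pint p0 mO uadm) ltry.
have [psi psiP] := clip_approximates c1 c2 p0 s01 mO uW pu M0 b1.
by apply: approximates_W0 psiP => //; exact: measurable_comb_clip.
Qed.

(** With the best Sobolev constant [T], [chi = N / (N - sp)] and [D = T la], the
    bound of Moser's iteration is the announced one. *)
Lemma bounded_subcritical s p Omega u : 1 < p -> 0 < s < 1 -> s * p < N%:R ->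
  bounded_set Omega -> measurable Omega -> lambda1_minimizer s p Omega u ->
  [/\ u \in Lfun mu +oo%E, (0 < Ctilde N s p < +oo)%E &
   (Lp_norm +oo Omega u <=
       Ctilde N s p * lambda1 s p Omega `^ (N%:R / (s * p ^+ 2))
         * Lp_norm p%:E Omega u)%E].
Proof.
move=> p1 s01 spN bO mO umin; have p0 : 0 < p by rewrite (lt_trans _ p1).
have [s0 _] := andP s01.
have sp0 : 0 < s * p by rewrite mulr_gt0.
have NR0 : 0 < N%:R :> R by rewrite (lt_trans sp0).
have d0 : 0 < N%:R - s * p by rewrite subr_gt0.
have [la [laE Eu]] := lambda1_fin p1 s01 mO umin.
have [uadm _] := umin; have [uW un _] := uadm; have [mu_ u0 _] := uW.
have pu := admissible_pint p0 mO uadm.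
have [V V0 muV] := bounded_measure_lty bO mO.
have muO : (mu Omega < +oo)%E by rewrite (le_lt_trans muV)// ltry.
have W0u c1 c2 M b := @comb_clip_W0 s p Omega u p1 s01 mO uadm c1 c2 M b.
have uW0 : W0 s p u.
  have := W0u 1 0 1 1 ltr01 (lexx _); congr (W0 s p _).
  by apply/funext => x /=; rewrite mul1r mul0r addr0.
have unz : ~ {ae mu, forall x, u x = 0}.
  move=> uz; have : pint p u = 0%E.
    rewrite -(@integral0 _ _ _ mu setT); apply: ae_eq_integral => //.
      by apply/measurable_EFinP; exact: measurable_powR_norm.
    by apply: filterS uz => x uz _; rewrite uz normr0 powR0// gt_eqF.
  by rewrite pu => /eqP; rewrite onee_eq0.
have q0 : 0 < N%:R * p / (N%:R - s * p) by rewrite divr_gt0// mulr_gt0.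
have X0 : (0 < pint (N%:R * p / (N%:R - s * p)) u)%E.
  rewrite lt_neqAle eq_sym pint_ge0 andbT; apply: contra_notN unz => /eqP.
  exact: pint_eq0.
have Xp0 : (0 < pint (N%:R * p / (N%:R - s * p)) u `^ ((N%:R - s * p) /
  N%:R))%E.
  exact: poweR_gt0.
have T0 : (0 < sobolev_sup N s p)%E.
  apply: (@lt_le_trans _ _ (sobolev_quotient s p u)); last first.
    by apply: ereal_sup_ubound; exists u.
  rewrite /sobolev_quotient gagliardo_powR// Eu mule_gt0//.
  have : 0 <= la by rewrite -lee_fin -Eu energy_ge0.
  rewrite le_eqVlt => /predU1P[<-|la0]; first by rewrite inve0.
  by rewrite inver gt_eqF// lte_fin invr_gt0.
have Tlty := sobolev_sup_lty p1 s0 spN.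
have [T TE] : exists T : R, sobolev_sup N s p = T%:E.
  by exists (fine (sobolev_sup N s p)); rewrite fineK// ge0_fin_numE// ltW.
have Tpos : 0 < T by rewrite -lte_fin -TE.
have sobT v : W0 s p v -> (energy s p v < +oo)%E -> _ :=
  fun vW Ev => sobolev_sup_ineq p1 s0 spN vW (ltW T0) Ev.
have la0 : 0 < la.
  have Ey : (energy s p u < +oo)%E by rewrite Eu ltry.
  have := lt_le_trans Xp0 (sobT u uW0 Ey).
  by rewrite TE Eu -EFinM lte_fin pmulr_rgt0.
pose chi := N%:R / (N%:R - s * p).
have c1 : 1 < chi by rewrite ltr_pdivlMr// mul1r gtrDl oppr_lt0.
have D0 : 0 < T * la by rewrite mulr_gt0.
have ess : (ess_sup mu (fun x => `|u x|%:E) <=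
  (moser_bound p chi (T * la))%:E)%E.
  apply: (minimizer_ess_sup p1 s01 mO umin laE c1 (ltW Tpos) D0 (lexx _)).
  move=> M th M0 th1.
  have E : (fun x => clip M (u x) `^ th) = ((fun x => 0 * x + 1 * clip M x `^
    th) \o u).
    by apply/funext => x /=; rewrite mul0r add0r mul1r.
  have -> : p * chi = N%:R * p / (N%:R - s * p) by rewrite /chi; ring.
  have -> : chi^-1 = (N%:R - s * p) / N%:R by rewrite /chi invf_div.
  rewrite -TE; apply: sobT; rewrite E; first exact: W0u.
  apply: (W0tilde_energy_lty p0 s01 mO); apply: comb_clip_W0tilde => //.
  by rewrite pu ltry.
have CE : Ctilde N s p = (T `^ (N%:R / (s * p ^+ 2)) *
    chi `^ (N%:R * (N%:R - s * p) / (s ^+ 2 * p ^+ 2) * ((p - 1) / p)))%:E.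
  by rewrite /Ctilde TE poweR_EFin -EFinM.
split; first exact: Lfun_oo ess.
  rewrite CE ltry andbT lte_fin mulr_gt0// powR_gt0//.
  by rewrite (lt_trans _ c1).
have [le1 _] := Lnorm_oo_le Omega ess; apply: (le_trans le1).
rewrite un mule1 CE laE poweR_EFin -EFinM lee_fin /moser_bound.
have dN : N%:R + -1 * (N%:R - s * p) = s * p :> R by ring.
have -> : chi / (p * (chi - 1)) = N%:R / (s * p ^+ 2).
  by rewrite /chi; field; rewrite dN !gt_eqF.
have -> : (p - 1) / p * (chi / (chi - 1) ^+ 2) =
    N%:R * (N%:R - s * p) / (s ^+ 2 * p ^+ 2) * ((p - 1) / p).
  by rewrite /chi; field; rewrite dN !gt_eqF.
rewrite powRM ?(ltW Tpos) ?(ltW la0)// le_eqVlt; apply/orP; left; apply/eqP;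
  ring.
Qed.

End boundedness.

Theorem theorem3p3 (R : realType) (N : nat) (Omega : set 'rV[R]_N) (p s : R)
    (Omega_open : open Omega) (Omega_bounded : bounded_set Omega)
    (p_gt1 : 1 < p) (s_gt0 : 0 < s) (s_lt1 : s < 1) (sp_le : s * p <= N%:R)
    (u : 'rV[R]_N -> R) (u_min : lambda1_minimizer s p Omega u) :
  u \in Lfun (lebesgue_row R N) +oo%E /\
  (s * p < N%:R ->
    (0 < Ctilde N s p < +oo)%E /\
    (Lp_norm +oo Omega u <=
       Ctilde N s p * lambda1 s p Omega `^ (N%:R / (s * p ^+ 2))
         * Lp_norm p%:E Omega u)%E).
Proof.
have mO := open_measurable_row Omega_open.
have s01 : 0 < s < 1 by rewrite s_gt0.
have sp0 : 0 < s * p by rewrite mulr_gt0// (lt_trans _ p_gt1).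
have [spN|spN] := ltP (s * p) N%:R.
  by have [] := bounded_subcritical p_gt1 s01 spN Omega_bounded mO u_min.
split; last by [].
have N0 : (0 < N)%N by rewrite -(ltr0n R) (lt_le_trans sp0).
have spE : s * p = N%:R by apply/eqP; rewrite eq_le sp_le.
exact: bounded_critical spE N0 Omega_bounded mO u_min.
Qed.
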